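(* Let $\eta$ be an algebraic function over $\mathbb{C}(x)$ and let $\delta_1$ and $\delta_2$ be two points in $\mathbb{C}\cup\{\infty\}$ at which $\eta$ admits rational Puiseux expansions. Write $\eta_\delta(x):=(x-\delta)\eta(x)$ for $\delta\in\mathbb{C}$ and $\eta_\infty(x):=x\eta(x)$. Then $\eta_{\delta_1}$ has the Gauss property at $\delta_1$ if and only if $\eta_{\delta_2}$ has the Gauss property at $\delta_2$.
   Context: Let $\eta$ be an algebraic function over $\mathbb{C}(x)$, i.e. an element of an algebraic closure of $\mathbb{C}(x)$. A Puiseux expansion of $\eta$ at $\delta\in\mathbb{C}$, respectively at $\delta=\infty$, is an expansion (given by a $\mathbb{C}(x)$-embedding of a field containing $\eta$ in the corresponding field of Puiseux series) of the form $$\sum_{n=r}^\infty p_n (x-\delta)^{n/d},\quad\text{respectively}\quad \sum_{n=r}^\infty p_n x^{-n/d},$$ where $r$ and $d\ge 1$ are integers. The sequence $(p_n)_{n\in\mathbb{Z}}$, with $p_n:=0$ for $n<r$, is the sequence of coefficients of the Puiseux expansion at $\delta$. The Puiseux expansion is rational if $p_n\in\mathbb{Q}$ for all $n$. In this case the function is said to have the Gauss property at $\delta$ if $(p_n)_{n\in\mathbb{Z}}$ has the Gauss property. The expansion of $\eta_\delta$ at $\delta$ is the one obtained from that of $\eta$ by multiplication by $x-\delta$ if $\delta\in\mathbb{C}$, respectively by $x$ if $\delta=\infty$. For a prime $p$, let $\mathbb{Z}_{(p)}=\{r\in\mathbb{Q}: v_p(r)\ge 0\}$, where $v_p$ is the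 $p$-adic valuation. A sequence $(a_n)_{n\in\mathbb{Z}}$ of rational numbers satisfies Gauss congruences for the prime $p$ if $a_{np}-a_n\in np\,\mathbb{Z}_{(p)}$ for all $n\in\mathbb{Z}$. It has the Gauss property if it satisfies Gauss congruences for all but finitely many primes $p$. *)

(* Defs.v *)
From HB Require Import structures.
From mathcomp Require Import all_boot all_order all_algebra.
From mathcomp Require Import all_classical all_reals.
From mathcomp Require Import complex ring lra zify.

Set Implicit Arguments.
Unset Strict Implicit.
Unset Printing Implicit Defensive.

Import Order.TTheory GRing.Theory Num.Theory.
Local Open Scope classical_set_scope.
Local Open Scope ring_scope.

(* A Puiseux series sum_q f(q) t^q in a local parameter t is represented by its
   coefficient function f : rat -> F; the exponents that occur have a common
   denominator d and are bounded below by r / d. *)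
Definition puiseux_supp (F : fieldType) (f : rat -> F) : Prop :=
  exists (d : nat) (r : int), (0 < d)%N /\
    forall q, f q != 0 -> exists2 n : int, r <= n & q = n%:~R / d%:R.

Record puiseux (F : fieldType) := Puiseux {
  pcoef :> rat -> F;
  _ : `[< puiseux_supp pcoef >] }.

HB.instance Definition _ (F : fieldType) := [isSub for @pcoef F].
HB.instance Definition _ (F : fieldType) := [Choice of puiseux F by <:].

Section PuiseuxField.
Variable F : fieldType.
Implicit Types f g h : puiseux F.

Lemma puiseuxP f : puiseux_supp f.
Proof. by case: f => f /= /asboolP. Qed.

Definition mkPuiseux (f : rat -> F) (Hf : puiseux_supp f) : puiseux F :=
  Puiseux (asboolT Hf).

Lemma puiseux_ext f g : (forall q, f q = g q) -> f = g.
Proof. by move=> e; apply/val_inj/funext => q; exact: e. Qed.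

Lemma ratdivn_inj (d : nat) (m n : int) : (0 < d)%N ->
  m%:~R / d%:R = n%:~R / d%:R :> rat -> m = n.
Proof.
move=> d0; have d1 : (d%:R : rat) != 0 by rewrite pnatr_eq0 -lt0n.
by move/(mulIf (invr_neq0 d1))/intr_inj.
Qed.

Lemma ler_divn (d : nat) (m n : int) : (0 < d)%N ->
  (m%:~R / d%:R <= n%:~R / d%:R :> rat) = (m <= n).
Proof. by move=> d0; rewrite ler_pM2r ?ler_int // invr_gt0 ltr0n. Qed.

Lemma supp_refine (f : rat -> F) d r e : (0 < d)%N -> (0 < e)%N ->
  (forall q, f q != 0 -> exists2 n : int, r <= n & q = n%:~R / d%:R) ->
  forall q, f q != 0 ->
    exists2 n : int, r * e%:Z <= n & q = n%:~R / (d * e)%:R.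
Proof.
move=> d0 e0 H q /H[n rn ->]; exists (n * e%:Z).
  by rewrite ler_pM2r // ltz_nat.
rewrite intrM natrM pmulrn.
by rewrite -mulf_div divff ?mulr1 // pnatr_eq0 -lt0n.
Qed.

Lemma supp_common f g : exists (d : nat) (r s : int), [/\ (0 < d)%N,
  forall q, f q != 0 -> exists2 n : int, r <= n & q = n%:~R / d%:R &
  forall q, g q != 0 -> exists2 n : int, s <= n & q = n%:~R / d%:R].
Proof.
have [d [r [d0 Hf]]] := puiseuxP f; have [e [s [e0 Hg]]] := puiseuxP g.
exists (d * e)%N, (r * e%:Z), (s * d%:Z); split; first by rewrite muln_gt0 d0.
  exact: supp_refine Hf.
by rewrite mulnC; exact: supp_refine Hg.
Qed.

Lemma puiseux_lb f : exists l : rat, forall a, f a != 0 -> l <= a.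
Proof.
have [d [r [d0 H]]] := puiseuxP f.
by exists (r%:~R / d%:R) => a /H[n rn ->]; rewrite ler_divn.
Qed.

Lemma puiseux_fin f (B : rat) : finite_set [set a | f a != 0 /\ a <= B].
Proof.
have [d [r [d0 H]]] := puiseuxP f.
have dp : 0 < (d%:R : rat) by rewrite ltr0n.
pose N := Num.bound (B * d%:R - r%:~R).
apply: (@sub_finite_set _ _ ((fun m : nat => (r + m%:Z)%:~R / d%:R) @` `I_N)).
  move=> a [/H[n rn ->]] nB; exists `|n - r|%N => /=; last first.
    by rewrite gez0_abs ?subr_ge0 // addrCA subrr addr0.
  have nr : 0 <= n - r by rewrite subr_ge0.
  rewrite -(ltr_nat rat) natr_absz ger0_norm // rmorphB /=.
  apply: (@le_lt_trans _ _ (B * d%:R - r%:~R)).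
    by rewrite lerD2r -ler_pdivrMr.
  apply: archi_boundP; rewrite subr_ge0.
  by move: nB; rewrite ler_pdivrMr //; apply: le_trans; rewrite ler_int.
by apply: finite_image; exact: finite_II.
Qed.

Lemma pzero_supp : puiseux_supp (fun _ : rat => 0 : F).
Proof. by exists 1%N, 0; split=> // q; rewrite eqxx. Qed.
Definition pzero := mkPuiseux pzero_supp.

Lemma pmono_supp (c : F) (a : rat) :
  puiseux_supp (fun q : rat => if q == a then c else 0).
Proof.
exists `|denq a|%N, (numq a); split; first by rewrite absz_gt0 denq_neq0.
move=> q; have [-> _|_ /eqP//] := eqVneq q a.
by exists (numq a); rewrite // natr_absz normr_denq divq_num_den.
Qed.
(* c t^a *)
Definition pmono (c : F) (a : rat) := mkPuiseux (pmono_supp c a).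

Lemma popp_supp f : puiseux_supp (fun q => - f q).
Proof.
have [d [r [d0 H]]] := puiseuxP f; exists d, r; split=> // q.
by rewrite oppr_eq0; exact: H.
Qed.
Definition popp f := mkPuiseux (popp_supp f).

Lemma padd_supp f g : puiseux_supp (fun q => f q + g q).
Proof.
have [d [r [s [d0 Hf Hg]]]] := supp_common f g.
exists d, (Order.min r s); split=> // q fg0.
have [f0|/Hf[n rn ->]] := eqVneq (f q) 0.
  have /Hg[n sn ->] : g q != 0 by move: fg0; rewrite f0 add0r.
  by exists n; rewrite // ge_min sn orbT.
by exists n; rewrite // ge_min rn.
Qed.
Definition padd f g := mkPuiseux (padd_supp f g).

(* Cauchy product; for each q only finitely many terms are nonzero. *)
Definition conv (f g : rat -> F) (q : rat) : F :=
  \sum_(a \in [set: rat]) (f a * g (q - a)).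

Lemma conv_neq0 (f g : rat -> F) q : conv f g q != 0 ->
  exists a, f a != 0 /\ g (q - a) != 0.
Proof.
move/(@fsbigN1 F 0 _ unit rat setT (fun _ a => f a * g (q - a)) tt) => [a _].
by rewrite mulf_eq0 negb_or => /andP[fa ga]; exists a.
Qed.

Lemma pmul_supp f g : puiseux_supp (conv f g).
Proof.
have [d [r [s [d0 Hf Hg]]]] := supp_common f g.
exists d, (r + s); split=> // q /conv_neq0[a [/Hf[n rn aE] /Hg[m sm qE]]].
exists (n + m); first exact: lerD.
by rewrite rmorphD mulrDl -aE -qE addrC subrK.
Qed.
Definition pmul f g := mkPuiseux (pmul_supp f g).

Lemma paddA : associative padd.
Proof. by move=> f g h; apply: puiseux_ext => q /=; rewrite addrA. Qed.
Lemma paddC : commutative padd.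
Proof. by move=> f g; apply: puiseux_ext => q /=; rewrite addrC. Qed.
Lemma padd0 : left_id pzero padd.
Proof. by move=> f; apply: puiseux_ext => q /=; rewrite add0r. Qed.
Lemma paddN : left_inverse pzero popp padd.
Proof. by move=> f; apply: puiseux_ext => q /=; rewrite addNr. Qed.

HB.instance Definition _ :=
  GRing.isZmodule.Build (puiseux F) paddA paddC padd0 paddN.

Lemma sumT_widen (P : set rat) (G : rat -> F) :
  (forall a, G a != 0 -> P a) ->
  \sum_(a \in [set: rat]) G a = \sum_(a \in P) G a.
Proof.
move=> H; apply/esym/fsbig_widen => // a [_ nP] /=.
by apply: contra_notP nP => /eqP; exact: H.
Qed.

Lemma pmulC : commutative pmul.
Proof.
move=> f g; apply: puiseux_ext => q /=; rewrite /conv.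
rewrite (reindex_fsbigT (fun a : rat => q - a)); last first.
  by exists (fun a => q - a) => a; rewrite subKr.
by apply: eq_fsbigr => a _; rewrite subKr mulrC.
Qed.

Lemma pmul1 : left_id (pmono 1 0) pmul.
Proof.
move=> f; apply: puiseux_ext => q /=; rewrite /conv.
rewrite (sumT_widen (P := [set 0])).
  by rewrite fsbig_set1 eqxx mul1r subr0.
by move=> a; have [->//|_] := eqVneq a 0; rewrite mul0r eqxx.
Qed.

Lemma pmulDl : left_distributive pmul padd.
Proof.
move=> f g h; apply: puiseux_ext => q /=; rewrite /conv.
have [l Hl] := puiseux_lb h.
pose P := [set a | f a != 0 /\ a <= q - l] `|` [set a | g a != 0 /\ a <= q - l].
have fP : finite_set P by rewrite finite_setU; split; exact: puiseux_fin.
rewrite !(sumT_widen (P := P)).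
- by rewrite -fsbig_split //; apply: eq_fsbigr => a _; rewrite mulrDl.
- move=> a; rewrite mulf_eq0 negb_or => /andP[ga /Hl ha]; right; split=> //.
  by lra.
- move=> a; rewrite mulf_eq0 negb_or => /andP[fa /Hl ha]; left; split=> //.
  by lra.
- move=> a; rewrite mulf_eq0 negb_or => /andP[fga /Hl ha].
  have aq : a <= q - l by lra.
  have [fa|fa] := eqVneq (f a) 0; last by left.
  by right; split=> //; move: fga; rewrite fa add0r.
Qed.

Lemma pmulA : associative pmul.
Proof.
move=> f g h; apply: puiseux_ext => q /=; rewrite /conv.
have [lf Hf] := puiseux_lb f; have [lg Hg] := puiseux_lb g.
have [lh Hh] := puiseux_lb h.
pose B := [set b | f b != 0 /\ b <= q - lh - lg].
pose C := [set c | g c != 0 /\ c <= q - lh - lf].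
pose A := (fun bc : rat * rat => bc.1 + bc.2) @` (B `*` C).
have fB : finite_set B by exact: puiseux_fin.
have fA : finite_set A.
  by apply: finite_image; apply: finite_setX => //; exact: puiseux_fin.
have inB a b : f b != 0 -> g (a - b) != 0 -> h (q - a) != 0 -> B b.
  by move=> fb /Hg gab /Hh hqa; split=> //; lra.
have inC a b : f b != 0 -> g (a - b) != 0 -> h (q - a) != 0 -> C (a - b).
  by move=> /Hf fb ga /Hh hqa; split=> //; lra.
have inA a b : f b != 0 -> g (a - b) != 0 -> h (q - a) != 0 -> A a.
  move=> fb ga ha; exists (b, a - b); last by rewrite /= addrC subrK.
  by split; [exact: inB ga ha | exact: inC fb ga ha].
rewrite [RHS](sumT_widen (P := A)); last first.
  move=> a; rewrite mulf_eq0 negb_or => /andP[/conv_neq0[b [fb gb]] ha].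
  exact: inA fb gb ha.
transitivity (\sum_(a \in A) \sum_(b \in B) f b * g (a - b) * h (q - a)); last first.
  apply: eq_fsbigr => a _; rewrite mulr_fsuml; apply/esym/sumT_widen => b.
  rewrite !mulf_eq0 !negb_or => /andP[/andP[fb gb] hb]; exact: inB fb gb hb.
rewrite exchange_fsbig // (sumT_widen (P := B)); last first.
  move=> b; rewrite mulf_eq0 negb_or => /andP[fb /conv_neq0[c [gc hc]]].
  have gE : b + c - b = c by rewrite addrAC subrr add0r.
  have hE : q - (b + c) = q - b - c by rewrite opprD addrA.
  by apply: (inB (b + c)); [exact: fb | rewrite gE; exact: gc | rewrite hE; exact: hc].
apply: eq_fsbigr => b; rewrite inE => -[fb _].
rewrite (reindex_fsbigT (fun a : rat => a - b)); last first.
  by exists (fun a => a + b) => a; rewrite ?subrK ?addrK.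
rewrite mulr_fsumr (sumT_widen (P := A)).
  by apply: eq_fsbigr => a _; rewrite mulrA opprB addrA subrK.
move=> a; rewrite !mulf_eq0 !negb_or opprB addrA subrK => /andP[_ /andP[ga ha]].
exact: inA fb ga ha.
Qed.

Lemma pone_neq0 : pmono 1 0 != 0 :> puiseux F.
Proof.
apply/eqP => /(congr1 (fun f : puiseux F => f 0)) /= /eqP.
by rewrite oner_eq0.
Qed.

HB.instance Definition _ := GRing.Zmodule_isComNzRing.Build (puiseux F)
  pmulA pmulC pmul1 pmulDl pone_neq0.


Fixpoint inv_seq (w : nat -> F) (n : nat) : seq F :=
  if n is m.+1 then
    let s := inv_seq w m in
    rcons s ((w 0%N)^-1 * ((m == 0%N)%:R - \sum_(i < m) s`_i * w (m - i)%N))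
  else [::].

Lemma size_inv_seq w n : size (inv_seq w n) = n.
Proof. by elim: n => //= n IH; rewrite size_rcons IH. Qed.

Lemma nth_inv_seq w n i : (i < n)%N -> (inv_seq w n)`_i = (inv_seq w i.+1)`_i.
Proof.
elim: n => // n IH; rewrite ltnS leq_eqVlt => /orP[/eqP -> //|lin].
by rewrite -IH //= nth_rcons size_inv_seq lin.
Qed.

Lemma inv_seqP (w : nat -> F) : w 0%N != 0 -> exists v : nat -> F,
  forall n, \sum_(i < n.+1) v i * w (n - i)%N = (n == 0%N)%:R.
Proof.
move=> w0; exists (fun n => (inv_seq w n.+1)`_n) => n.
rewrite big_ord_recr /= subnn nth_rcons size_inv_seq ltnn eqxx.
rewrite mulrAC mulVf // mul1r addrC.
under [in X in _ + X]eq_bigr => i _ do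
  rewrite -[rcons _ _]/(inv_seq w i.+1) -(nth_inv_seq w (ltn_ord i)).
by rewrite subrK.
Qed.

Lemma pinv_ex f : f != 0 -> exists g : puiseux F, g * f = 1.
Proof.
move=> f0; have [d [r [d0 Hf]]] := puiseuxP f.
have d1 : (d%:R : rat) != 0 by rewrite pnatr_eq0 -lt0n.
pose u n := f ((r + n%:Z)%:~R / d%:R).
have exu : exists n, u n != 0.
  apply: contra_notP (negP f0) => nu; apply/eqP/puiseux_ext => q /=.
  apply: contra_notP nu => /eqP fq; have [n rn qE] := Hf q fq.
  exists `|n - r|%N; rewrite /u gez0_abs ?subr_ge0 //.
  by rewrite addrCA subrr addr0 -qE.
case: (ex_minnP exu) => m um mmin; pose k := r + m%:Z.
pose w n := f ((k + n%:Z)%:~R / d%:R).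
have w0 : w 0%N != 0 by rewrite /w addr0.
have Hw q : f q != 0 -> exists n : nat, q = (k + n%:Z)%:~R / d%:R.
  move=> fq; have [n rn qE] := Hf q fq.
  have nE : r + `|n - r|%N = n by rewrite gez0_abs ?subr_ge0 // addrCA subrr addr0.
  have mn : (m <= `|n - r|)%N by apply: mmin; rewrite /u nE -qE.
  exists (`|n - r| - m)%N.
  by rewrite /k -addrA -PoszD subnKC // nE.
have [v vE] := inv_seqP w0.
pose z (q : rat) : rat := q * d%:R + k%:~R.
pose g0 q : F := if z q \is a Num.nat then v (Num.truncn (z q)) else 0.
have g0E n : g0 ((n%:Z - k)%:~R / d%:R) = v n.
  have zE : z ((n%:Z - k)%:~R / d%:R) = n%:R.
    by rewrite /z divfK // rmorphB /= subrK.
  by rewrite /g0 zE natr_nat natrK.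
have g0N q : g0 q != 0 -> exists n : nat, q = (n%:Z - k)%:~R / d%:R.
  rewrite /g0; case: ifP => [/natrP[n zn] _|_ /eqP//]; exists n.
  by rewrite rmorphB /= -[n%:~R]/(n%:R) -zn /z addrK mulfK.
have g0S : puiseux_supp g0.
  exists d, (- k); split=> // q /g0N[n ->]; exists (n%:Z - k) => //.
  by rewrite lerDr.
exists (mkPuiseux g0S); apply: puiseux_ext => q /=.
have [|nq] := pselect (exists n : nat, q = n%:~R / d%:R); last first.
  have -> : (q == 0) = false.
    by apply/negP => /eqP q0; apply: nq; exists 0%N; rewrite q0 mul0r.
  apply: contra_notP nq => /eqP /conv_neq0[a [/g0N[i aE] /Hw[j qE]]].
  exists (i + j)%N; rewrite -[q](subrK a) qE aE -mulrDl -rmorphD /=.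
  by congr (_%:~R / _); rewrite PoszD; ring.
move=> [n ->]; pose e i : rat := (i%:Z - k)%:~R / d%:R.
rewrite /conv (sumT_widen (P := e @` `I_n.+1)).
- rewrite fsbig_image; last first.
    move=> i j _ _ /(ratdivn_inj d0) /(congr1 (fun t => t + k)).
    by rewrite !subrK => -[].
  rewrite -(fsbig_ord _ n.+1 (fun i => g0 (e i) * f (n%:~R / d%:R - e i))).
  transitivity (\sum_(i < n.+1) v i * w (n - i)%N).
    apply: eq_bigr => i _; rewrite /e g0E /w; congr (_ * f _).
    rewrite -mulrBl -rmorphB /=; congr (_%:~R / _).
    by rewrite -subzn -1?ltnS //; ring.
  rewrite vE; case: n => [|n]; first by rewrite mul0r eqxx.
  by rewrite mulf_eq0 invr_eq0 (negPf d1) orbF intr_eq0 /=.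
- move=> a; rewrite mulf_eq0 negb_or => /andP[/g0N[i aE] /Hw[j qE]].
  exists i => //=; move: qE; rewrite aE -mulrBl -rmorphB /=.
  move/(ratdivn_inj d0) => E; rewrite ltnS -lez_nat; lia.
Qed.

Definition pinv f : puiseux F :=
  if pselect (exists g, g * f = 1) is left ex then projT1 (cid ex) else 0.

Lemma pmulV f : f != 0 -> pinv f * f = 1.
Proof.
by rewrite /pinv => /pinv_ex ex; case: pselect => // ex'; case: cid.
Qed.

Lemma pinv0 : pinv 0 = 0.
Proof.
rewrite /pinv; case: pselect => // ex; exfalso; case: ex => g /eqP.
by rewrite mulr0 eq_sym oner_eq0.
Qed.

HB.instance Definition _ :=
  GRing.ComNzRing_isField.Build (puiseux F) pmulV pinv0.

End PuiseuxField.

(* Points of C u {oo}: Some c is the finite point c, None is oo. The local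
   parameter t is x - c at c and 1 / x at oo; local_x is the expansion of x. *)
Definition local_x (F : fieldType) (delta : option F) : puiseux F :=
  if delta is Some c then pmono c 0 + pmono 1 1 else pmono 1 (- 1).

(* A C(x)-embedding in the field of Puiseux series at delta of a field K with
   C(x) <= K <= L, all inclusions being given by ring morphisms. Morphisms of
   fields commute with inverses, so pe_mapC and pe_mapX determine pe_map on the
   image of the whole of C(x): pe_map is C(x)-linear. *)
Record puiseux_embedding (C L : fieldType)
    (iota : {rmorphism {fraction {poly C}} -> L}) (delta : option C) :=
  PuiseuxEmbedding {
    pe_field : fieldType;
    pe_base : {rmorphism {fraction {poly C}} -> pe_field};
    pe_incl : {rmorphism pe_field -> L};
    pe_map : {rmorphism pe_field -> puiseux C};
    pe_inclE : forall f, pe_incl (pe_base f) = iota f;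
    pe_mapC : forall c : C, pe_map (pe_base (tofrac c%:P)) = pmono c 0;
    pe_mapX : pe_map (pe_base (tofrac 'X)) = local_x delta }.

(* s = sum_n p n t^(n / d) *)
Definition is_series (F : fieldType) (s : puiseux F) (d : nat)
    (p : int -> F) : Prop :=
  (forall n : int, s (n%:~R / d%:R) = p n) /\
  (forall q : rat, s q != 0 -> exists n : int, q = n%:~R / d%:R).

(* d is not required to be the least common denominator of the exponents. *)
Definition puiseux_expansion (C L : fieldType)
    (iota : {rmorphism {fraction {poly C}} -> L}) (delta : option C)
    (E : puiseux_embedding iota delta) (f : L) (d : nat) (p : int -> C) : Prop :=
  (0 < d)%N /\
  exists2 y : pe_field E, pe_incl E y = f & is_series (pe_map E y) d p.

Definition rational_seq (C : fieldType) (p : int -> C) : Prop :=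
  forall n, exists r : rat, p n = ratr r.

(* padic_val p 0 = 0 since logn p 0 = 0, which puts 0 in Zloc p. *)
Definition padic_val (p : nat) (r : rat) : int :=
  (logn p `|numq r|%N)%:Z - (logn p `|denq r|%N)%:Z.

Definition Zloc (p : nat) : set rat := [set r | 0 <= padic_val p r].

Definition gauss_congruences (p : nat) (a : int -> rat) : Prop :=
  forall n : int, exists2 r : rat,
    Zloc p r & a (n * p%:Z) - a n = (n * p%:Z)%:~R * r.

Definition gauss_property (a : int -> rat) : Prop :=
  finite_set [set p : nat | prime p /\ ~ gauss_congruences p a].

(* Given the denominator d, the sequence of coefficients is unique. *)
Definition has_gauss_property (C L : fieldType)
    (iota : {rmorphism {fraction {poly C}} -> L}) (delta : option C)
    (E : puiseux_embedding iota delta) (d : nat) (f : L) : Prop :=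
  exists2 a : int -> rat,
    puiseux_expansion E f d (fun n => ratr (a n)) & gauss_property a.

Definition eta_at (C L : fieldType)
    (iota : {rmorphism {fraction {poly C}} -> L}) (delta : option C)
    (eta : L) : L :=
  iota (tofrac (if delta is Some c then 'X - c%:P else 'X)) * eta.

(* Main.v *)
Require Import Defs.
From HB Require Import structures.
From mathcomp Require Import all_boot all_order all_algebra.
From mathcomp Require Import all_classical all_reals.
From mathcomp Require Import complex finfield ring lra zify.

Set Implicit Arguments.
Unset Strict Implicit.
Unset Printing Implicit Defensive.

Import Order.TTheory GRing.Theory Num.Theory.
Local Open Scope ring_scope.
Local Open Scope complex_scope.

(** Write y for a solution of y' = eta y, and g = (x - delta) eta (or x eta at
    infinity) with coefficients a_n. The Gauss congruences at p for (a_n) say that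
    y, up to a monomial, has an expansion with coefficients integral at p
    (Dieudonne and Dwork; gauss_exp_integral, exp_integral_gauss). This condition
    becomes independent of the point once it is expressed by the rational functions
    y^(n) / (n! y) of x and eta.

    - If y is integral at p up to a monomial, then so is (x - delta)^n y^(n) / n!, because
      binomial coefficients of rational numbers integral at p are integral at p.
      Hence all the ratios (x - delta)^n y^(n) / (n! y) are integral
      (gauss_ratio_integral).
    - Conversely, if all these ratios are integral, their coefficients determine
      those of y recursively, up to differences of binomial coefficients,
      one of which is a unit (gbin_separates, ratio_integral_gauss). A pole of g
      is excluded because p! divides no power of a unit
      (ratio_integral_order_ge0).
    - Let P be a minimal polynomial of eta over Q(x) and S its derivative in eta.
      Then S^(2n) y^(n) / y is a polynomial w_n in x and eta (deriv_ratio_num), and the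
      integrality of the ratios means that n! divides the expansion of w_n, as
      far as p is concerned. For almost all p this does not depend on the
      expansion (transfer_divisibility), because P stays irreducible
      modulo p: a factor of lower degree with the given expansion as a root would
      have bounded degree by Gauss's lemma (bounded_factor), and finitely many
      monomials in x and eta that are independent over Q stay independent
      modulo almost all p (monomials_reduce). The expansions themselves are integral at
      almost all p by Eisenstein's theorem (algebraic_integral).

    All this takes place over Q. It applies because eta satisfies rational
    relations in x - delta at both points, by linear algebra over the subfield Q
    of the complex numbers (rational_descent). The minimal ones are translates of
    each other up to a factor, so that either the points differ by a rational
    number or eta is constant (rational_or_constant). At infinity x replaces
    x - delta; the derivation (x - delta) d/dx, or x d/dx at infinity, acts on a power
    t^q of the local parameter as e q with e = 1, or e = - 1, which treats all points
    alike. *)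

(** * Rational numbers integral at a prime *)

Definition zloc (p : nat) : {pred rat} := fun r => coprime p `|denq r|%N.

Lemma zlocP p r : reflect (exists a : int, exists b : nat,
  [/\ (0 < b)%N, coprime p b & r = a%:~R / b%:R]) (r \in zloc p).
Proof.
apply: (iffP idP) => [pr|[a [b [b0 pb ->]]]].
  exists (numq r), `|denq r|%N; split=> //; first by rewrite absz_gt0 denq_neq0.
  by rewrite -[LHS]divq_num_den natr_absz normr_denq.
rewrite unfold_in /zloc; set s := _ / _.
suff : (`|denq s| %| b)%N by move=> /coprime_dvdr; apply.
have bn : (b%:R : rat) != 0 by rewrite pnatr_eq0 -lt0n.
have E : numq s * b%:Z = a * denq s.
  apply: (@intr_inj rat); rewrite !intrM -pmulrn.
  by rewrite numqE mulrAC divfK.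
rewrite -(@Gauss_dvdr _ `|numq s|%N); last by rewrite coprime_sym coprime_num_den.
by rewrite -[b]/(`|b%:Z|%N) -abszM E abszM dvdn_mull.
Qed.

Lemma zloc_frac p (a : int) b : (0 < b)%N -> coprime p b ->
  a%:~R / b%:R \in zloc p.
Proof. by move=> b0 pb; apply/zlocP; exists a, b. Qed.

Fact zloc_subring p : subring_closed (zloc p).
Proof.
split.
- by apply/zlocP; exists 1, 1%N; rewrite divr1 coprimen1.
- move=> _ _ /zlocP[a [b [b0 pb ->]]] /zlocP[c [d [d0 pd ->]]].
  apply/zlocP; exists (a * d%:Z - c * b%:Z), (b * d)%N.
  rewrite muln_gt0 b0 coprimeMr pb pd; split=> //.
  have [bn dn] : (b%:R : rat) != 0 /\ (d%:R : rat) != 0 by rewrite !pnatr_eq0 -!lt0n.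
  rewrite rmorphB /= !rmorphM /= -!pmulrn ?natrM.
  by field; rewrite bn dn.
- move=> _ _ /zlocP[a [b [b0 pb ->]]] /zlocP[c [d [d0 pd ->]]].
  apply/zlocP; exists (a * c), (b * d)%N.
  rewrite muln_gt0 b0 coprimeMr pb pd; split=> //.
  by rewrite intrM natrM mulf_div.
Qed.

HB.instance Definition _ p :=
  GRing.isSubringClosed.Build rat (zloc p) (zloc_subring p).

Lemma zloc_int p (a : int) : a%:~R \in zloc p.
Proof. by have := @zloc_frac p a 1; rewrite divr1; apply; rewrite ?coprimen1. Qed.

Lemma zloc_nat p n : n%:R \in zloc p.
Proof. exact: (zloc_int p n). Qed.

Lemma zlocV_nat p n : (0 < n)%N -> coprime p n -> n%:R^-1 \in zloc p.
Proof. by move=> n0 pn; have := @zloc_frac p 1 n n0 pn; rewrite mul1r. Qed.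

Lemma zlocM_unit p u r : u^-1 \in zloc p -> u * r \in zloc p -> u != 0 ->
  r \in zloc p.
Proof. by move=> uV ur u0; rewrite -(mulKf u0 r) rpredM. Qed.

Lemma zloc_sign p (e : rat) : e = 1 \/ e = -1 -> e \in zloc p.
Proof. by case=> ->; rewrite ?rpredN rpred1. Qed.

Lemma Zloc_zloc p (r : rat) : prime p -> Zloc p r <-> r \in zloc p.
Proof.
move=> pp; rewrite /Zloc /padic_val unfold_in /zloc /= prime_coprime // subr_ge0 lez_nat.
split=> [le|nd]; last by rewrite lognE (negPf nd) !andbF.
apply: contraL (coprime_num_den r) => pd; rewrite coprime_sym.
have n0 : (0 < logn p `|denq r|)%N.
  by rewrite logn_gt0 mem_primes pp absz_gt0 denq_neq0.
have : (0 < logn p `|numq r|)%N by exact: leq_trans le.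
rewrite logn_gt0 mem_primes => /and3P[_ _ pn].
apply/negP => /(coprime_dvdl pd); rewrite prime_coprime //.
by rewrite pn.
Qed.

Lemma zloc_not_div p r : prime p -> r != 0 -> r^-1 \in zloc p ->
  r / p%:R \notin zloc p.
Proof.
move=> pp r0 rV; apply/negP => rp.
have p0 : (p%:R : rat) != 0 by rewrite pnatr_eq0 -lt0n prime_gt0.
have : p%:R^-1 \in zloc p.
  by rewrite -(mulKf r0 p%:R^-1) rpredM.
have -> : (p%:R : rat)^-1 = 1%:~R / (p%:Z)%:~R by rewrite mul1r pmulrn.
rewrite unfold_in /zloc coprimeq_den //=; last by rewrite coprime1n.
have /negPf -> : (p%:Z != 0) by rewrite eqz_nat -lt0n prime_gt0.
by rewrite /coprime gcdnn => /eqP p1; rewrite p1 in pp.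
Qed.

(** ratr is a ring morphism on zloc p as soon as the integers prime to p are
    invertible in the target; p = 1 covers fields of characteristic 0. *)
Section Reduction.
Variables (p : nat) (k : fieldType).
Hypothesis unitk : forall b, (0 < b)%N -> coprime p b -> b%:R != 0 :> k.

Lemma denq_unit r : r \in zloc p -> (denq r)%:~R != 0 :> k.
Proof.
move=> rp; rewrite -[denq r]gez0_abs ?denq_ge0 // -pmulrn.
by apply: unitk => //; rewrite absz_gt0 denq_neq0.
Qed.

Lemma ratr_eq (a : int) (b : nat) : (0 < b)%N -> coprime p b ->
  ratr (a%:~R / b%:R) = a%:~R / b%:R :> k.
Proof.
move=> b0 pb; set r := _ / _ : rat.
have rz : r \in zloc p by exact: zloc_frac.
have bn : (b%:R : rat) != 0 by rewrite pnatr_eq0 -lt0n.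
have E : numq r * b%:Z = a * denq r.
  apply: (@intr_inj rat); rewrite !intrM -pmulrn.
  by rewrite numqE mulrAC divfK.
rewrite /ratr; apply/eqP; rewrite eqr_div ?denq_unit ?unitk //.
by rewrite pmulrn -!intrM E.
Qed.

Lemma ratrD_loc r s : r \in zloc p -> s \in zloc p ->
  ratr (r + s) = ratr r + ratr s :> k.
Proof.
move=> /zlocP[a [b [b0 pb ->]]] /zlocP[c [d [d0 pd ->]]].
have [bn dn] : (b%:R : rat) != 0 /\ (d%:R : rat) != 0 by rewrite !pnatr_eq0 -!lt0n.
have -> : a%:~R / b%:R + c%:~R / d%:R =
          (a * d%:Z + c * b%:Z)%:~R / (b * d)%:R :> rat.
  by rewrite rmorphD /= !rmorphM /= -!pmulrn ?natrM; field; rewrite bn dn.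
rewrite !ratr_eq ?muln_gt0 ?b0 ?coprimeMr ?pb //.
have [bk dk] := (unitk b0 pb, unitk d0 pd).
by rewrite rmorphD /= !rmorphM /= -!pmulrn ?natrM; field; rewrite bk dk.
Qed.

Lemma ratrM_loc r s : r \in zloc p -> s \in zloc p ->
  ratr (r * s) = ratr r * ratr s :> k.
Proof.
move=> /zlocP[a [b [b0 pb ->]]] /zlocP[c [d [d0 pd ->]]].
rewrite mulf_div -intrM -natrM !ratr_eq ?muln_gt0 ?b0 ?coprimeMr ?pb //.
by rewrite mulf_div intrM natrM.
Qed.

Lemma ratrN_loc r : r \in zloc p -> ratr (- r) = - ratr r :> k.
Proof.
move=> rp; apply/eqP; rewrite -addr_eq0 -ratrD_loc ?rpredN // addNr.
by apply/eqP; exact: (ratr_int k 0).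
Qed.

Lemma ratrB_loc r s : r \in zloc p -> s \in zloc p ->
  ratr (r - s) = ratr r - ratr s :> k.
Proof. by move=> rp sp; rewrite ratrD_loc ?rpredN // ratrN_loc. Qed.

Lemma ratr_sum_loc (I : Type) (s : seq I) (P : pred I) (F : I -> rat) :
  (forall i, P i -> F i \in zloc p) ->
  ratr (\sum_(i <- s | P i) F i) = \sum_(i <- s | P i) ratr (F i) :> k.
Proof.
move=> Fp; elim: s => [|i s IH]; first by rewrite !big_nil; exact: (ratr_int k 0).
rewrite !big_cons; case: ifP => // Pi.
by rewrite ratrD_loc ?IH ?Fp // rpred_sum.
Qed.

Lemma ratrX_loc r n : r \in zloc p -> ratr (r ^+ n) = ratr r ^+ n :> k.
Proof.
move=> rp; elim: n => [|n IH]; first by rewrite !expr0; exact: (ratr_int k 1).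
by rewrite !exprS ratrM_loc ?rpredX // IH.
Qed.

End Reduction.

Lemma char0_unit (k : numFieldType) b : (0 < b)%N -> coprime 1 b -> b%:R != 0 :> k.
Proof. by rewrite pnatr_eq0 -lt0n. Qed.
Arguments char0_unit k b _ _ : clear implicits.

Lemma Fp_unit p (pp : prime p) b : (0 < b)%N -> coprime p b -> b%:R != 0 :> 'F_p.
Proof.
by move=> _; rewrite prime_coprime // (GRing.dvdn_pcharf (pchar_Fp pp)).
Qed.
Arguments Fp_unit {p} pp b _ _.

Lemma ratr_Fp_eq0 p r : prime p -> r \in zloc p ->
  (ratr r == 0 :> 'F_p) = (r / p%:R \in zloc p).
Proof.
move=> pp rz; have p0 : (p%:R : rat) != 0 by rewrite pnatr_eq0 -lt0n prime_gt0.
apply/idP/idP; last first.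
  move=> rp; rewrite -[r](divfK p0) (ratrM_loc (Fp_unit pp)) ?zloc_nat //.
  by rewrite [ratr p%:R](ratr_int _ p%:Z) -pmulrn (pchar_Fp_0 pp) mulr0.
case/zlocP: rz => a [b [b0 pb ->]]; rewrite (ratr_eq (Fp_unit pp)) //.
rewrite mulf_eq0 invr_eq0 (negPf (Fp_unit pp b b0 pb)) orbF => a0.
have : (p %| `|a|)%N.
  rewrite (GRing.dvdn_pcharf (pchar_Fp pp)).
  by move: a0; case: a => n; rewrite ?NegzE ?rmorphN ?oppr_eq0.
move=> pa; have /dvdzP[c ->] : (p%:Z %| a)%Z by exact: pa.
by rewrite intrM -pmulrn mulrAC mulfK // zloc_frac.
Qed.

(** * Gauss congruences and integrality of exponentials *)

Section PrimePowers.
Variables (p : nat) (pp : prime p).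

Lemma natp_neq0 : (p%:R : rat) != 0.
Proof. by rewrite pnatr_eq0 -lt0n prime_gt0. Qed.

Lemma zloc_fermat c : c \in zloc p -> (c ^+ p - c) / p%:R \in zloc p.
Proof.
move=> cp; rewrite -ratr_Fp_eq0 ?rpredB ?rpredX //.
rewrite (ratrB_loc (Fp_unit pp)) ?rpredX // (ratrX_loc (Fp_unit pp)) //.
set x := ratr c; have := expf_card x; rewrite card_Fp // => ->.
by rewrite subrr.
Qed.

(** A congruence modulo M, with p dividing M, improves to p M on p-th powers:
    x^p - y^p = (x - y) S with S = p y^(p-1) = 0 modulo p. *)
Lemma zloc_lift_pow x y (m : nat) : x \in zloc p -> y \in zloc p ->
  (x - y) / (p * m)%:R \in zloc p ->
  (x ^+ p - y ^+ p) / (p * (p * m))%:R \in zloc p.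
Proof.
move=> xp yp xy; have [->|m0] := posnP m; first by rewrite !muln0 invr0 mulr0 rpred0.
have m1 : (m%:R : rat) != 0 by rewrite pnatr_eq0 -lt0n.
have p1 := natp_neq0.
set S := \sum_(i < p) x ^+ (p.-1 - i) * y ^+ i.
have Sp : S / p%:R \in zloc p.
  rewrite -ratr_Fp_eq0 //; last by apply: rpred_sum => i _; rewrite rpredM ?rpredX.
  have exy : ratr x = ratr y :> 'F_p.
    apply/eqP; rewrite -subr_eq0 -(ratrB_loc (Fp_unit pp)) // ratr_Fp_eq0 ?rpredB //.
    have -> : (x - y) / p%:R = (x - y) / (p * m)%:R * m%:R.
      by rewrite natrM; field; rewrite p1 m1.
    by apply: rpredM; rewrite ?zloc_nat.
  rewrite (ratr_sum_loc (Fp_unit pp)); last first.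
    by move=> i _; rewrite rpredM ?rpredX.
  rewrite (eq_bigr (fun=> ratr y ^+ p.-1)); last first.
    move=> i _; rewrite (ratrM_loc (Fp_unit pp)) ?rpredX //.
    rewrite !(ratrX_loc (Fp_unit pp)) // exy -exprD subnK //.
    by rewrite -ltnS prednK ?prime_gt0.
  by rewrite sumr_const card_ord -mulr_natr (pchar_Fp_0 pp) mulr0.
rewrite subrXX -/S.
have -> : (x - y) * S / (p * (p * m))%:R = (x - y) / (p * m)%:R * (S / p%:R).
  by rewrite !natrM; field; rewrite p1 m1.
exact: rpredM.
Qed.

(** The case of m prime to p is Fermat's little theorem for c^m, and each factor
    p of m is then gained by taking p-th powers. *)
Lemma zloc_pow c m : c \in zloc p ->
  (c ^+ (m * p) - c ^+ m) / (m * p)%:R \in zloc p.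
Proof.
elim/ltn_ind: m => m IH cp.
have [->|m0] := posnP m; first by rewrite mul0n invr0 mulr0 rpred0.
have [pm|pm] := boolP (p %| m)%N.
  case/dvdnP: pm => n ->{m} in IH m0 *; have n0 : (0 < n)%N by move: m0; case: n {IH}.
  have H := IH n (ltn_Pmulr (prime_gt1 pp) n0) cp.
  have := @zloc_lift_pow (c ^+ (n * p)) (c ^+ n) n (rpredX _ cp) (rpredX _ cp).
  by rewrite ![(p * _)%N]mulnC -!exprM; apply.
have m1 : (m%:R : rat) != 0 by rewrite pnatr_eq0 -lt0n.
have -> : (c ^+ (m * p) - c ^+ m) / (m * p)%:R =
          ((c ^+ m) ^+ p - c ^+ m) / p%:R * m%:R^-1.
  by rewrite exprM natrM; field; rewrite m1 natp_neq0.
by apply: rpredM; rewrite ?zlocV_nat ?prime_coprime ?zloc_fermat ?rpredX.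
Qed.

End PrimePowers.

(** For u the power series with coefficients u_n and constant term 1, the terms
    b_n with n >= 1 are the coefficients of x u' / u. *)
Definition log_deriv (b u : nat -> rat) : Prop :=
  u 0%N = 1 /\
  forall n, n.+1%:R * u n.+1 = \sum_(k < n.+1) b k.+1 * u (n - k)%N.

Definition gauss_at (p : nat) (b : nat -> rat) (n : nat) : Prop :=
  (b (n * p)%N - b n) / (n * p)%:R \in zloc p.

(** The factor 1 - c x^N contributes - N c^j to the coefficient of x^(j N) in the
    logarithmic derivative, for j >= 1; peel_b and peel_u are the effects on b
    and u of multiplying u by this factor. *)
Definition factor_log_deriv N c n : rat := if (N %| n)%N then N%:R * c ^+ (n %/ N) else 0.
Definition peel_b N c (b : nat -> rat) n : rat := b n - factor_log_deriv N c n.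
Definition peel_u N c (u : nat -> rat) n : rat :=
  u n - (if (N <= n)%N then c * u (n - N)%N else 0).

Section Peel.
Variables (N : nat) (c : rat).
Hypothesis N0 : (0 < N)%N.

Let shift (u : nat -> rat) n : rat := if (N <= n)%N then c * u (n - N)%N else 0.

Let sum_shift (b u : nat -> rat) n :
  \sum_(k < n.+1) b k.+1 * shift u (n - k)%N =
  if (N <= n)%N then c * \sum_(k < (n - N).+1) b k.+1 * u (n - N - k)%N else 0.
Proof.
rewrite -(big_mkord xpredT (fun k => b k.+1 * shift u (n - k)%N)).
case: leqP => [Nn|nN]; last first.
  rewrite big_nat_cond big1 // => k _; rewrite /shift leqNgt.
  by rewrite (leq_ltn_trans (leq_subr _ _) nN) mulr0.
rewrite -(big_mkord xpredT (fun k => b k.+1 * u (n - N - k)%N)).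
rewrite (@big_cat_nat _ _ _ (n - N).+1) //=; last by rewrite ltnS leq_subr.
rewrite [X in _ + X]big_nat_cond [X in _ + X]big1 ?addr0; last first.
  move=> k; rewrite andbT => /andP[k1 k2]; rewrite /shift leqNgt.
  by have -> : (n - k < N)%N by [lia]; rewrite mulr0.
rewrite mulr_sumr big_nat_cond [RHS]big_nat_cond; apply: eq_bigr => k.
rewrite andbT => /andP[_ kn]; rewrite /shift.
by have -> : (N <= n - k)%N by [lia]; rewrite mulrCA subnAC.
Qed.

Let delta_shift k : factor_log_deriv N c (N + k.+1)%N = c * factor_log_deriv N c k.+1.
Proof.
rewrite /factor_log_deriv -[X in (_ %| X + _)%N]mul1n dvdn_addr ?dvdn_mull //.
case: ifP => [/dvdnP[q ->]|]; last by rewrite mulr0.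
by rewrite -mulSn !mulnK // exprS; ring.
Qed.

Let sum_delta (u : nat -> rat) n :
  \sum_(k < n.+1) factor_log_deriv N c k.+1 * u (n - k)%N =
  (if (N <= n.+1)%N then N%:R * c * u (n.+1 - N)%N else 0) +
  (if (N <= n)%N
   then c * \sum_(k < (n - N).+1) factor_log_deriv N c k.+1 * u (n - N - k)%N else 0).
Proof.
have small k : (k.+1 < N)%N -> factor_log_deriv N c k.+1 = 0.
  by move=> kN; rewrite /factor_log_deriv; case: ifP => // /dvdn_leq; lia.
have dN : factor_log_deriv N c N = N%:R * c by rewrite /factor_log_deriv dvdnn divnn N0.
rewrite -(big_mkord xpredT (fun k => factor_log_deriv N c k.+1 * u (n - k)%N)).
have [Nn|nN] := leqP N n.+1; last first.
  rewrite big_nat_cond big1 ?add0r; last first.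
    by move=> k; rewrite andbT => /andP[_ kn]; rewrite small ?mul0r //; lia.
  by rewrite leqNgt (ltnW nN).
rewrite (@big_cat_nat _ _ _ N) //=. congr (_ + _).
  rewrite -[in LHS](prednK N0) big_nat_recr //= prednK // dN.
  rewrite big_nat_cond big1 ?add0r => [|k]; last first.
    by rewrite andbT => /andP[_ kN]; rewrite small ?mul0r //; lia.
  by congr (_ * u _); lia.
case: leqP => [Nn'|nN']; last by rewrite big_geq //; lia.
rewrite mulr_sumr -[X in index_iota X]add0n big_addn big_mkord.
rewrite subSn //; apply: eq_bigr => k _.
by rewrite [(k + N)%N]addnC -addnS delta_shift -mulrA subnDA.
Qed.

Lemma log_deriv_peel b u :
  log_deriv b u -> log_deriv (peel_b N c b) (peel_u N c u).
Proof.
move=> [u0 ub]; split=> [|n].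
  by rewrite /peel_u leqNgt N0 subr0.
transitivity (\sum_(k < n.+1) ((b k.+1 * u (n - k)%N - b k.+1 * shift u (n - k)%N)
   - (factor_log_deriv N c k.+1 * u (n - k)%N
      - factor_log_deriv N c k.+1 * shift u (n - k)%N))); last first.
  by apply: eq_bigr => k _; rewrite /peel_b /peel_u -/(shift _ _); ring.
rewrite sumrB !sumrB !sum_shift (sum_delta u n) -(ub n) /peel_u.
have [Nn|nN] := leqP N n.
  rewrite (leqW Nn) -(ub (n - N)%N) -subSn // natrB ?leqW //; ring.
case: leqP => [Nn1|_]; last by ring.
by have -> : n.+1 = N by [lia]; ring.
Qed.

End Peel.

Section DieudonneDwork.
Variables (p : nat) (pp : prime p).

Let vanish N (b : nat -> rat) := forall i, (0 < i < N)%N -> b i = 0.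

Let log_deriv_low N b u : (0 < N)%N -> log_deriv b u -> vanish N b ->
  vanish N u /\ N%:R * u N = b N.
Proof.
move=> N0 [u0 ub] bN.
have H i : (i.+1 < N)%N -> u i.+1 = 0.
  move=> iN; have /eqP := ub i; rewrite big1 => [|k _]; last first.
    by rewrite bN ?mul0r //; have := ltn_ord k; lia.
  by rewrite mulf_eq0 pnatr_eq0 /= => /eqP.
split=> [[|i] // /andP[_ iN]|]; first exact: H.
rewrite -(prednK N0) ub big_ord_recr /= subnn u0 mulr1 big1 ?add0r // => k _.
by rewrite bN ?mul0r //; have := ltn_ord k; lia.
Qed.

Let vanish_peel N b : (0 < N)%N -> vanish N b ->
  vanish N.+1 (peel_b N (b N / N%:R) b).
Proof.
move=> N0 bN i /andP[i0]; rewrite ltnS leq_eqVlt => /orP[/eqP ->|iN].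
  rewrite /peel_b /factor_log_deriv dvdnn divnn N0 expr1 mulrC divfK ?subrr //.
  by rewrite pnatr_eq0 -lt0n.
rewrite /peel_b /factor_log_deriv bN ?i0 //; case: ifP; last by rewrite subr0.
by move/dvdn_leq; lia.
Qed.

Let gauss_factor N c n : (0 < N)%N -> c \in zloc p ->
  gauss_at p (factor_log_deriv N c) n.
Proof.
move=> N0 cp; rewrite /gauss_at /factor_log_deriv.
have N1 : (N%:R : rat) != 0 by rewrite pnatr_eq0 -lt0n.
have p1 := natp_neq0 pp.
have [->|n0] := posnP n; first by rewrite mul0n subrr mul0r rpred0.
have n1 : (n%:R : rat) != 0 by rewrite pnatr_eq0 -lt0n.
have [/dvdnP[m nm]|Nn] := boolP (N %| n)%N.
  rewrite nm in n0 n1 *; rewrite mulnAC !dvdn_mull // !mulnK //.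
  move: n1; rewrite natrM mulf_eq0 negb_or => /andP[m1 _].
  have -> : (N%:R * c ^+ (m * p) - N%:R * c ^+ m) / (m * p * N)%:R =
    (c ^+ (m * p) - c ^+ m) / (m * p)%:R.
    by rewrite !natrM; field; rewrite N1 m1 p1.
  exact: zloc_pow.
case: ifP => [/dvdnP[m nm]|_]; last by rewrite subrr mul0r rpred0.
rewrite nm mulnK // natrM subr0.
have m0 : (0 < m)%N by move: nm n0 (prime_gt0 pp); case: m => //; lia.
have m1 : (m%:R : rat) != 0 by rewrite pnatr_eq0 -lt0n.
have -> : N%:R * c ^+ m / (m%:R * N%:R) = c ^+ m * m%:R^-1.
  by field; rewrite N1 m1.
apply: rpredM; first exact: rpredX.
apply: zlocV_nat => //; rewrite prime_coprime //; apply: contraNN Nn.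
case/dvdnP => q mq; apply/dvdnP; exists q; apply/eqP.
by rewrite -(eqn_pmul2r (prime_gt0 pp)) nm mq mulnAC.
Qed.

(** A series with constant term 1 is a product of factors 1 / (1 - c_N x^N), and
    c_N = b_N / N once the previous factors have been removed. The sequence
    contributed by one factor with c_N integral satisfies the Gauss congruences,
    so removing a factor preserves both the congruences for b and the
    integrality of u; what remains has its first N coefficients trivial. *)
Lemma gauss_exp_integral b u : log_deriv b u ->
  (forall n, b n \in zloc p) -> (forall n, gauss_at p b n) ->
  forall n, u n \in zloc p.
Proof.
suff H K N b' u' : (0 < N)%N -> log_deriv b' u' -> vanish N b' ->
    (forall n, b' n \in zloc p) -> (forall n, gauss_at p b' n) ->
    forall n, (n < N + K)%N -> u' n \in zloc p.
  by move=> bu bz bg n; apply: (H n.+1 1%N b) => //; case.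
elim: K N b' u' => [|K IH] N {}b {}u N0 bu bN bz bg n.
  have [uN _] := log_deriv_low N0 bu bN.
  rewrite addn0; case: n => [_|n nN]; last by rewrite uN ?rpred0.
  by case: bu => -> _; rewrite rpred1.
set c := b N / N%:R.
have cz : c \in zloc p.
  have [pN|pN] := boolP (p %| N)%N; last first.
    by apply: rpredM => //; apply: zlocV_nat; rewrite ?prime_coprime.
  case/dvdnP: (pN) => m Nm; have m0 : (0 < m)%N by move: N0; rewrite Nm; case: (m).
  have := bg m; rewrite /gauss_at -Nm [b m]bN ?subr0 // m0 Nm.
  by rewrite ltn_Pmulr ?prime_gt1.
rewrite addnS -addSn => nN.
have bu' := log_deriv_peel c N0 bu.
have u'z := IH _ _ _ (ltn0Sn N) bu' (vanish_peel N0 bN).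
elim/ltn_ind: n nN => n IHn nN.
have -> : u n = peel_u N c u n + (if (N <= n)%N then c * u (n - N)%N else 0).
  by rewrite /peel_u subrK.
apply: rpredD; last first.
  case: leqP => [Nn|_]; last exact: rpred0.
  by apply: rpredM => //; apply: IHn; lia.
apply: u'z => // [m|m].
  apply: rpredB => //; rewrite /factor_log_deriv; case: ifP => _; last exact: rpred0.
  by apply: rpredM; [exact: zloc_nat|exact: rpredX].
have E : peel_b N c b (m * p)%N - peel_b N c b m = b (m * p)%N - b m -
  (factor_log_deriv N c (m * p)%N - factor_log_deriv N c m) by rewrite /peel_b; ring.
by rewrite /gauss_at E mulrBl; apply: rpredB; [exact: bg|exact: (gauss_factor m N0 cz)].
Qed.

Lemma exp_integral_gauss b u : log_deriv b u ->
  (forall n, u n \in zloc p) -> forall n, gauss_at p b n.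
Proof.
suff H K N b' u' : (0 < N)%N -> log_deriv b' u' -> vanish N b' ->
    (forall n, u' n \in zloc p) ->
    forall n, (n * p < N + K)%N -> gauss_at p b' n.
  move=> bu uz n; apply: (H (n * p)%N 1%N b u) => //; by case.
elim: K N b' u' => [|K IH] N {}b {}u N0 bu bN uz n.
  rewrite addn0 /gauss_at; have [->|n0] := posnP n.
    by rewrite mul0n subrr mul0r rpred0.
  have np : (n <= n * p)%N by rewrite leq_pmulr ?prime_gt0.
  move=> npN; rewrite !bN ?subrr ?mul0r ?rpred0 // ?muln_gt0 ?n0 ?prime_gt0 //.
  exact: leq_ltn_trans npN.
set c := b N / N%:R.
have cz : c \in zloc p.
  have [_ bE] := log_deriv_low N0 bu bN.
  by rewrite /c -bE mulrC mulKf ?pnatr_eq0 -?lt0n.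
rewrite addnS -addSn => nN.
have bu' := log_deriv_peel c N0 bu.
have := IH _ _ _ (ltn0Sn N) bu' (vanish_peel N0 bN) _ n nN.
rewrite /gauss_at => H.
have -> : b (n * p)%N - b n = peel_b N c b (n * p)%N - peel_b N c b n +
  (factor_log_deriv N c (n * p)%N - factor_log_deriv N c n) by rewrite /peel_b; ring.
rewrite mulrDl; apply: rpredD; last exact: (gauss_factor n N0 cz).
apply: H => m; rewrite /peel_u; apply: rpredB => //; case: ifP => _; last exact: rpred0.
exact: rpredM.
Qed.

End DieudonneDwork.

(** * Generalized binomial coefficients *)

Definition gbin (z : rat) (n : nat) : rat := \prod_(i < n) ((z - i%:R) / i.+1%:R).

Lemma gbin0 z : gbin z 0 = 1.
Proof. by rewrite /gbin big_ord0. Qed.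

Lemma gbinS z n : gbin z n.+1 = gbin z n * ((z - n%:R) / n.+1%:R).
Proof. by rewrite /gbin big_ord_recr. Qed.

Lemma gbin_rec z n : n.+1%:R * gbin z n.+1 = (z - n%:R) * gbin z n.
Proof.
have n1 : (n.+1%:R : rat) != 0 by rewrite pnatr_eq0.
by rewrite gbinS mulrCA mulrC; congr (_ * _); rewrite mulrC divfK.
Qed.

Lemma gbin_absorb z n : n.+1%:R * gbin z n.+1 = z * gbin (z - 1) n.
Proof.
elim: n => [|n IH]; first by rewrite gbin_rec subr0 !gbin0.
have n1 : (n.+1%:R : rat) != 0 by rewrite pnatr_eq0.
apply: (mulfI n1); rewrite gbin_rec mulrCA IH [RHS]mulrCA gbin_rec.
by rewrite -[n.+1]addn1 natrD; ring.
Qed.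

Lemma gbinD a b n : gbin (a + b) n = \sum_(i < n.+1) gbin a (n - i)%N * gbin b i.
Proof.
elim: n => [|n IH]; first by rewrite big_ord_recl big_ord0 !gbin0 mul1r addr0.
have n1 : (n.+1%:R : rat) != 0 by rewrite pnatr_eq0.
apply: (mulfI n1); rewrite gbin_rec IH !mulr_sumr.
transitivity (\sum_(i < n.+2) (n.+1 - i)%:R * gbin a (n.+1 - i)%N * gbin b i +
              \sum_(i < n.+2) gbin a (n.+1 - i)%N * (i%:R * gbin b i)).
  rewrite [X in _ = X + _]big_ord_recr /= subnn mulr0n !mul0r addr0.
  rewrite [X in _ = _ + X]big_ord_recl /= mulr0n mul0r mulr0 add0r.
  rewrite -big_split /=; apply: eq_bigr => i _.
  have iN : (i <= n)%N by rewrite -ltnS.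
  rewrite /bump /= add1n subSS gbin_rec subSn // gbin_rec natrB //; ring.
rewrite -big_split /=; apply: eq_bigr => i _.
have iN : (i <= n.+1)%N by rewrite -ltnS.
by rewrite natrB //; ring.
Qed.

Lemma log_deriv_gbin z : log_deriv (fun n => z * (-1) ^+ n.+1) (gbin z).
Proof.
split=> [|n]; first exact: gbin0.
elim: n => [|n IH].
  by rewrite gbin_rec big_ord_recl big_ord0 !gbin0; ring.
rewrite gbin_rec big_ord_recl /= subn0.
have -> : \sum_(i < n.+1) z * (-1) ^+ (bump 0 i).+2 * gbin z (n.+1 - bump 0 i) =
  - \sum_(i < n.+1) z * (-1) ^+ i.+2 * gbin z (n - i).
  rewrite -sumrN; apply: eq_bigr => i _.
  by rewrite /bump /= add1n subSS exprS; ring.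
by rewrite -IH; ring.
Qed.

Section PadicBinomials.
Variables (p : nat) (pp : prime p) (p2 : (2 < p)%N).

(** The binomial series (1 + x)^z is the exponential of z log (1 + x), whose
    coefficients z (-1)^(n+1) satisfy trivially the Gauss congruences. *)
Lemma gbin_integral z n : z \in zloc p -> gbin z n \in zloc p.
Proof.
move=> zp; apply: (gauss_exp_integral pp (log_deriv_gbin z)) => {}n.
  by apply: rpredM => //; rewrite rpredX // rpredN1.
rewrite /gauss_at -signr_odd -[in X in _ - X]signr_odd /= oddM.
have -> : odd p by case: (even_prime pp) => // p2'; move: p2; rewrite p2'.
by rewrite andbT subrr mul0r rpred0.
Qed.

Lemma zlocV r : r \in zloc p -> ratr r != 0 :> 'F_p -> r^-1 \in zloc p.
Proof.
case/zlocP => a [b [b0 pb ->]]; rewrite (ratr_eq (Fp_unit pp)) //.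
rewrite mulf_eq0 negb_or => /andP[a0 _]; rewrite invf_div.
have pa : coprime p `|a|.
  rewrite prime_coprime // (GRing.dvdn_pcharf (pchar_Fp pp)).
  by move: a0; case: a => n; rewrite ?NegzE ?rmorphN ?oppr_eq0.
have a1 : a != 0 by apply: contraNneq a0 => ->.
have -> : b%:R / a%:~R = (sgz a * b%:Z)%:~R / `|a|%N%:R :> rat.
  have a2 : (a%:~R : rat) != 0 by rewrite intr_eq0.
  apply: (canLR (mulfK a2)).
  rewrite mulrAC -intrM mulrAC -abszEsg mulrC intrM -!pmulrn mulKf //.
  by rewrite pnatr_eq0 absz_eq0.
by apply: zloc_frac; rewrite ?absz_gt0.
Qed.

Lemma padic_decomp r : r \in zloc p -> r != 0 ->
  exists v s, [/\ s \in zloc p, ratr s != 0 :> 'F_p & r = (p ^ v)%:R * s].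
Proof.
case/zlocP => a [b [b0 pb ->]] ab; have a0 : a != 0.
  by apply: contraNneq ab => ->; rewrite mul0r.
have a1 : (0 < `|a|)%N by rewrite absz_gt0.
have [m pm am] := pfactor_coprime pp a1.
set v := logn p `|a| in am; exists v, ((sgz a * m%:Z)%:~R / b%:R); split.
- exact: zloc_frac.
- rewrite (ratr_eq (Fp_unit pp)) // mulf_neq0 ?invr_eq0 ?(Fp_unit pp) //.
  rewrite intrM mulf_neq0 //.
    by rewrite /sgz (negPf a0); case: ifP; rewrite ?rmorphN ?oppr_eq0 oner_eq0.
  rewrite -pmulrn (Fp_unit pp) //; by case: (m) pm a1 am => // _; lia.
rewrite mulrA; congr (_ / _); rewrite [in LHS](intEsg a) am PoszM mulrA.
by rewrite intrM mulrC -pmulrn.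
Qed.

(** Let n be the exact power of p dividing d. Modulo p, the coefficients of
    (1 + x)^d strictly between 0 and n vanish and the n-th one does not, so that
    by Vandermonde's identity the difference is this coefficient, a unit. *)
Lemma gbin_separates a d : a \in zloc p -> d \in zloc p -> d != 0 ->
  exists n, (gbin (a + d) n - gbin a n != 0) &&
            ((gbin (a + d) n - gbin a n)^-1 \in zloc p).
Proof.
move=> az dz d0; have [v [s [sz s0 dE]]] := padic_decomp dz d0.
exists (p ^ v)%N; set n := (p ^ v)%N.
have n0 : (0 < n)%N by rewrite expn_gt0 prime_gt0.
have r0 : ratr 0 = 0 :> 'F_p by exact: (ratr_int _ 0).
have r1 : ratr 1 = 1 :> 'F_p by exact: (ratr_int _ 1).
have di i : (0 < i < n)%N -> d / i%:R / p%:R \in zloc p.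
  case/andP=> i0 iN; have [j pj ij] := pfactor_coprime pp i0.
  set w := logn p i in ij.
  have j0 : (0 < j)%N by case: (j) ij i0 => // ->.
  have wv : (w < v)%N.
    rewrite -(ltn_exp2l _ _ (prime_gt1 pp)); apply: leq_ltn_trans iN.
    by rewrite ij leq_pmull.
  have -> : d / i%:R / p%:R = (p ^ (v - w.+1))%:R * s * j%:R^-1.
    have := natp_neq0 pp; have : (j%:R : rat) != 0 by rewrite pnatr_eq0 -lt0n.
    move=> j1 p1; have pw : ((p ^ w)%:R : rat) != 0 by rewrite natrX expf_neq0.
    rewrite dE -[in LHS](subnK wv) -addSnnS expnD expnS ij !natrM; field.
    by rewrite j1 p1 pw.
  by apply: rpredM; rewrite ?zlocV_nat // rpredM // zloc_nat.
have dz1 : d - 1 \in zloc p by rewrite rpredB ?rpred1.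
have small i : (0 < i < n)%N -> ratr (gbin d i) = 0 :> 'F_p.
  move=> iN; apply/eqP; rewrite ratr_Fp_eq0 ?gbin_integral //.
  case: i iN => // i /di iz; have i1 : (i.+1%:R : rat) != 0 by rewrite pnatr_eq0.
  rewrite -(mulKf i1 (gbin d i.+1)) gbin_absorb.
  have -> : i.+1%:R^-1 * (d * gbin (d - 1) i) / p%:R =
            d / i.+1%:R / p%:R * gbin (d - 1) i by ring.
  by rewrite rpredM ?gbin_integral.
have signs j : (j < n)%N -> ratr (gbin (d - 1) j) = (-1) ^+ j :> 'F_p.
  elim: j => [_|j IH jn]; first by rewrite gbin0.
  have jz := di j.+1 jn; have j1 : (j.+1%:R : rat) != 0 by rewrite pnatr_eq0.
  have jz' : d / j.+1%:R \in zloc p.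
    by rewrite -[_ / _](divfK (natp_neq0 pp)) rpredM // zloc_nat.
  have E : (d - 1 - j%:R) / j.+1%:R = d / j.+1%:R - 1.
    by move: j1; rewrite -[j.+1]addn1 natrD => j1; field.
  rewrite gbinS (ratrM_loc (Fp_unit pp)) ?gbin_integral ?E ?rpredB ?rpred1 //.
  rewrite IH ?(ltnW jn) // (ratrB_loc (Fp_unit pp)) ?rpred1 // r1.
  have /eqP -> : ratr (d / j.+1%:R) == 0 :> 'F_p by rewrite ratr_Fp_eq0.
  by rewrite exprS; ring.
have top : ratr (gbin d n) != 0 :> 'F_p.
  have -> : gbin d n = s * gbin (d - 1) n.-1.
    have n1 : (n%:R : rat) != 0 by rewrite pnatr_eq0 -lt0n.
    by apply: (mulfI n1); rewrite -{1 2}(prednK n0) gbin_absorb dE -/n mulrA.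
  rewrite (ratrM_loc (Fp_unit pp)) ?gbin_integral // signs ?ltn_predL //.
  by rewrite mulf_neq0 // signr_eq0.
have E : gbin (a + d) n - gbin a n =
    gbin d n + \sum_(i < n.-1) gbin a (n - i.+1)%N * gbin d i.+1.
  rewrite gbinD big_ord_recl /= subn0 gbin0 mulr1 addrAC subrr add0r.
  rewrite -(big_mkord xpredT (fun i => gbin a (n - bump 0 i)%N * gbin d (bump 0 i))).
  rewrite -[X in index_iota _ X](prednK n0) big_nat_recr // big_mkord /=.
  by rewrite /bump /= add1n (prednK n0) subnn gbin0 mul1r addrC.
have D0 : ratr (gbin (a + d) n - gbin a n) != 0 :> 'F_p.
  rewrite E (ratrD_loc (Fp_unit pp)) ?gbin_integral //; last first.
    by apply: rpred_sum => i _; rewrite rpredM ?gbin_integral.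
  rewrite (ratr_sum_loc (Fp_unit pp)) => [|i _]; last by rewrite rpredM ?gbin_integral.
  rewrite big1 ?addr0 // => i _.
  rewrite (ratrM_loc (Fp_unit pp)) ?gbin_integral // small ?mulr0 //=.
  by have := ltn_ord i; lia.
apply/andP; split; first by apply: contraNneq D0 => ->; rewrite r0.
by apply: zlocV => //; rewrite rpredB ?gbin_integral ?rpredD.
Qed.

End PadicBinomials.

(** * Puiseux series *)

Section PuiseuxBasics.
Variable F : fieldType.
Implicit Types (f g h : puiseux F) (q a b l m : rat) (c : F).

Lemma pcoefD f g q : (f + g) q = f q + g q. Proof. by []. Qed.
Lemma pcoefN f q : (- f) q = - f q. Proof. by []. Qed.
Lemma pcoef0 q : (0 : puiseux F) q = 0. Proof. by []. Qed.
Lemma pcoefB f g q : (f - g) q = f q - g q. Proof. by []. Qed.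

Lemma pcoef_sum (I : Type) (s : seq I) (P : pred I) (G : I -> puiseux F) q :
  (\sum_(i <- s | P i) G i) q = \sum_(i <- s | P i) G i q.
Proof. by elim/big_rec2: _ => // i x y _ <-. Qed.

Lemma pcoefM_seq f g q (s : seq rat) : uniq s ->
  (forall a, f a != 0 -> g (q - a) != 0 -> a \in s) ->
  (f * g) q = \sum_(a <- s) f a * g (q - a).
Proof.
move=> us H; change (conv f g q = \sum_(a <- s) f a * g (q - a)).
rewrite /conv (sumT_widen (P := [set` s]%classic)).
  by rewrite -fsbig_seq.
by move=> a; rewrite mulf_eq0 negb_or => /andP[fa ga]; exact: H.
Qed.

Lemma pcoefM_fin f g q : exists2 s : seq rat, uniq s &
  forall a, f a != 0 -> g (q - a) != 0 -> a \in s.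
Proof.
have [l Hl] := puiseux_lb g.
have /finite_seqP[s sE] := puiseux_fin f (q - l).
have sP a : a \in s <-> f a != 0 /\ a <= q - l.
  by have := congr1 (fun A => A a) sE => /= ->.
exists (undup s); first exact: undup_uniq.
move=> a fa /Hl ga; rewrite mem_undup; apply/sP; split=> //; lra.
Qed.

Lemma pmono_coef c a q : pmono c a q = if q == a then c else 0.
Proof. by []. Qed.

Lemma pcoefMmono c a f q : (pmono c a * f) q = c * f (q - a).
Proof.
rewrite (@pcoefM_seq _ _ _ [:: a]) //; first by rewrite big_seq1 pmono_coef eqxx.
by move=> b; rewrite inE pmono_coef; case: (eqVneq b a) => // _; rewrite eqxx.
Qed.

Lemma pmonoM c a c' b : pmono c a * pmono c' b = pmono (c * c') (a + b).
Proof.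
apply: puiseux_ext => q; rewrite pcoefMmono !pmono_coef subr_eq addrC.
by case: eqP => // _; rewrite mulr0.
Qed.

Lemma pmonoX a n : pmono 1 a ^+ n = pmono 1 (n%:R * a) :> puiseux F.
Proof.
elim: n => [|n IH]; first by rewrite mul0r.
by rewrite exprS IH pmonoM mulr1 -[n.+1]add1n natrD mulrDl mul1r.
Qed.

Definition pcst c : puiseux F := pmono c 0.

Lemma pcst_additive : zmod_morphism pcst.
Proof.
move=> c c'; apply: puiseux_ext => q; rewrite pcoefB !pmono_coef.
by case: eqP; rewrite ?subrr.
Qed.

Lemma pcst_multiplicative : monoid_morphism pcst.
Proof. by split=> [|c c']; rewrite // /pcst pmonoM addr0. Qed.

HB.instance Definition _ := GRing.isZmodMorphism.Build F (puiseux F) pcst pcst_additive.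
HB.instance Definition _ :=
  GRing.isMonoidMorphism.Build F (puiseux F) pcst pcst_multiplicative.

Lemma pcoefMcst c f q : (pcst c * f) q = c * f q.
Proof. by rewrite pcoefMmono subr0. Qed.

Definition order_ge l f := forall q, f q != 0 -> l <= q.

Lemma order_ge_coef0 l f q : order_ge l f -> q < l -> f q = 0.
Proof.
by move=> lf ql; apply/eqP; apply: contraLR ql => /lf; rewrite -leNgt.
Qed.

Lemma order_geD l f g : order_ge l f -> order_ge l g -> order_ge l (f + g).
Proof.
move=> lf lg q; rewrite pcoefD; have [->|/lf //] := eqVneq (f q) 0.
by rewrite add0r => /lg.
Qed.

Lemma order_ge_mono c a : order_ge a (pmono c a).
Proof. by move=> q; rewrite pmono_coef; case: (eqVneq q a) => [->//|_ /eqP]. Qed.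

Lemma pcoefM_neq0 f g q : (f * g) q != 0 -> exists a, f a != 0 /\ g (q - a) != 0.
Proof. exact: conv_neq0. Qed.

Lemma order_geM l m f g : order_ge l f -> order_ge m g -> order_ge (l + m) (f * g).
Proof. by move=> lf lg q /pcoefM_neq0[a [/lf la /lg mq]]; lra. Qed.

Lemma order_ge_le l m f : l <= m -> order_ge m f -> order_ge l f.
Proof. by move=> lm mf q /mf; apply: le_trans. Qed.

Lemma order_geX l f n : order_ge l f -> order_ge (n%:R * l) (f ^+ n).
Proof.
move=> lf; elim: n => [|n IH]; first by rewrite mul0r; exact: order_ge_mono.
by rewrite exprS -[n.+1]add1n natrD mulrDl mul1r; exact: order_geM.
Qed.

Lemma pcoefM_lead l m f g : order_ge l f -> order_ge m g -> (f * g) (l + m) = f l * g m.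
Proof.
move=> lf lg; rewrite (@pcoefM_seq _ _ _ [:: l]) ?big_seq1 //.
  by congr (_ * g _); ring.
by move=> a /lf la /lg mq; rewrite inE; apply/eqP; lra.
Qed.

Lemma puiseux_lead f : f != 0 -> exists2 l, f l != 0 & order_ge l f.
Proof.
move=> f0; have [d [r [d0 Hf]]] := puiseuxP f.
pose u n := f ((r + n%:Z)%:~R / d%:R).
have Hu q : f q != 0 -> exists2 n, q = (r + n%:Z)%:~R / d%:R & u n != 0.
  move=> fq; have [n rn qE] := Hf q fq; exists `|n - r|%N.
    by rewrite gez0_abs ?subr_ge0 // addrCA subrr addr0.
  by rewrite /u gez0_abs ?subr_ge0 // addrCA subrr addr0 -qE.
have exu : exists n, u n != 0.
  apply: contra_notP (negP f0) => nu; apply/eqP/puiseux_ext => q.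
  by apply: contra_notP nu => /eqP/Hu[n _ un]; exists n.
case: (ex_minnP exu) => n un nmin; exists ((r + n%:Z)%:~R / d%:R) => // q.
by case/Hu => k -> /nmin nk; rewrite ler_divn // lerD2l lez_nat.
Qed.

Definition ongrid (d : nat) f := forall q, f q != 0 -> exists n : int, q = n%:~R / d%:R.

Lemma ongrid_int d (n : int) : (0 < d)%N -> exists m : int, n%:~R = m%:~R / d%:R :> rat.
Proof.
move=> d0; exists (n * d%:Z); rewrite intrM -pmulrn mulfK //.
by rewrite pnatr_eq0 -lt0n.
Qed.

Lemma ongridD d f g : ongrid d f -> ongrid d g -> ongrid d (f + g).
Proof.
move=> df dg q; rewrite pcoefD; have [->|/df //] := eqVneq (f q) 0.
by rewrite add0r => /dg.
Qed.

Lemma ongridM d f g : ongrid d f -> ongrid d g -> ongrid d (f * g).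
Proof.
move=> df dg q /pcoefM_neq0[a [/df[m am] /dg[n an]]]; exists (m + n).
by rewrite intrD mulrDl -am -an addrC subrK.
Qed.

Lemma ongrid_mono d c (n : int) : (0 < d)%N -> ongrid d (pmono c n%:~R).
Proof.
by move=> d0 q; rewrite pmono_coef; case: (eqVneq q n%:~R) => [-> _|_ /eqP//]; exact: ongrid_int.
Qed.

Lemma pcoefM_grid d f g (n : nat) : (0 < d)%N ->
  ongrid d f -> ongrid d g -> order_ge 0 f -> order_ge 0 g ->
  (f * g) (n%:R / d%:R) = \sum_(i < n.+1) f (i%:R / d%:R) * g ((n - i)%:R / d%:R).
Proof.
move=> d0 df dg lf lg; have d1 : (d%:R : rat) != 0 by rewrite pnatr_eq0 -lt0n.
have inj : injective (fun i : nat => i%:R / d%:R : rat).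
  move=> i j /(mulIf (invr_neq0 d1))/eqP; rewrite eqr_nat; exact/eqP.
rewrite (@pcoefM_seq _ _ _ [seq i%:R / d%:R | i <- iota 0 n.+1]).
- rewrite big_map -[iota _ _]/(index_iota 0 n.+1) big_mkord; apply: eq_bigr => i _.
  by rewrite -mulrBl natrB // -ltnS.
- by rewrite map_inj_uniq // iota_uniq.
move=> a fa ga; have la := lf _ fa; have lb := lg _ ga.
have [m aE] := df _ fa; have a0 : 0 <= m.
  by move: la; rewrite aE -(mul0r d%:R^-1) -[0]/(0%:~R) ler_divn.
case: m aE a0 => // j aE _; apply/mapP; exists j; last by rewrite aE pmulrn.
rewrite mem_iota /= add0n ltnS -lez_nat -(ler_divn _ _ d0) -aE -pmulrn; lra.
Qed.

End PuiseuxBasics.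

Section PuiseuxReduction.
Variables (p : nat) (k : fieldType).
Hypothesis unitk : forall b, (0 < b)%N -> coprime p b -> b%:R != 0 :> k.
Implicit Types f g : puiseux rat.

Definition pintegral f := forall q, f q \in zloc p.

Lemma ratr0 : ratr 0 = 0 :> k. Proof. exact: (ratr_int k 0). Qed.
Lemma ratr1 : ratr 1 = 1 :> k. Proof. exact: (ratr_int k 1). Qed.

Fact pmap_supp f : puiseux_supp (fun q => ratr (f q) : k).
Proof.
have [d [r [d0 Hf]]] := puiseuxP f; exists d, r; split=> // q fq; apply: Hf.
by apply: contraNneq fq => ->; rewrite ratr0.
Qed.
Definition pmap f : puiseux k := mkPuiseux (pmap_supp f).

Lemma pmapE f q : pmap f q = ratr (f q). Proof. by []. Qed.

Lemma pintegralD f g : pintegral f -> pintegral g -> pintegral (f + g).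
Proof. by move=> fz gz q; exact: rpredD. Qed.

Lemma pintegralN f : pintegral f -> pintegral (- f).
Proof. by move=> fz q; rewrite pcoefN rpredN. Qed.

Lemma pintegralB f g : pintegral f -> pintegral g -> pintegral (f - g).
Proof. by move=> fz gz; apply/pintegralD/pintegralN. Qed.

Lemma pintegral_mono c a : c \in zloc p -> pintegral (pmono c a).
Proof. by move=> cz q; rewrite pmono_coef; case: eqP; rewrite ?rpred0. Qed.

Lemma pintegralM f g : pintegral f -> pintegral g -> pintegral (f * g).
Proof.
move=> fz gz q; have [s us sP] := pcoefM_fin f g q.
by rewrite (pcoefM_seq us sP); apply: rpred_sum => a _; exact: rpredM.
Qed.

Lemma pintegralX f n : pintegral f -> pintegral (f ^+ n).
Proof.
move=> fz; elim: n => [|n IH]; first by apply: pintegral_mono; exact: rpred1.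
by rewrite exprS; exact: pintegralM.
Qed.

Lemma pintegral0 : pintegral 0.
Proof. by move=> q; exact: rpred0. Qed.

Lemma pintegral_sum (I : Type) (s : seq I) (P : pred I) (G : I -> puiseux rat) :
  (forall i, P i -> pintegral (G i)) -> pintegral (\sum_(i <- s | P i) G i).
Proof.
by move=> Gz; elim/big_rec: _ => [|i f Pi]; [exact: pintegral0 | apply/pintegralD/Gz].
Qed.

Lemma pmapD f g : pintegral f -> pintegral g -> pmap (f + g) = pmap f + pmap g.
Proof. by move=> fz gz; apply: puiseux_ext => q; exact: (ratrD_loc unitk). Qed.

Lemma pmap_mono c a : pmap (pmono c a) = pmono (ratr c) a.
Proof.
by apply: puiseux_ext => q; rewrite pmapE !pmono_coef; case: eqP; rewrite ?ratr0.
Qed.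

Lemma pmapM f g : pintegral f -> pintegral g -> pmap (f * g) = pmap f * pmap g.
Proof.
move=> fz gz; apply: puiseux_ext => q; rewrite pmapE.
have [s us sP] := pcoefM_fin f g q.
rewrite (pcoefM_seq us sP) (@pcoefM_seq _ _ _ _ s us).
  rewrite (ratr_sum_loc unitk) => [|a _]; last exact: rpredM.
  by apply: eq_bigr => a _; rewrite (ratrM_loc unitk).
by move=> a fa ga; apply: sP; [apply: contraNneq fa|apply: contraNneq ga];
  rewrite pmapE => ->; rewrite ratr0.
Qed.

Lemma pmap0 : pmap 0 = 0.
Proof. by apply: puiseux_ext => q; rewrite pmapE ratr0. Qed.

Lemma pmap1 : pmap 1 = 1.
Proof. by rewrite -[1 in LHS]/(pmono 1 0) pmap_mono ratr1. Qed.

Lemma pmapX f n : pintegral f -> pmap (f ^+ n) = pmap f ^+ n.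
Proof.
move=> fz; elim: n => [|n IH]; first by rewrite pmap1.
by rewrite !exprS pmapM ?IH //; exact: pintegralX.
Qed.

Lemma pmap_sum (I : Type) (s : seq I) (P : pred I) (G : I -> puiseux rat) :
  (forall i, P i -> pintegral (G i)) ->
  pmap (\sum_(i <- s | P i) G i) = \sum_(i <- s | P i) pmap (G i).
Proof.
move=> Gz; suff [] : pintegral (\sum_(i <- s | P i) G i) /\
  pmap (\sum_(i <- s | P i) G i) = \sum_(i <- s | P i) pmap (G i) by [].
elim/big_rec2: _ => [|i f g Pi [fz <-]]; first by rewrite pmap0; split=> //; exact: pintegral0.
by rewrite pmapD //; [split=> //; apply: pintegralD => //; exact: Gz|exact: Gz].
Qed.

End PuiseuxReduction.

Section CancelIntegral.
Variables (p : nat) (pp : prime p).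
Implicit Types f g : puiseux rat.
Let red := @pmap 'F_p.

Lemma red_eq0 f : pintegral p f -> red f = 0 -> pintegral p (pcst p%:R^-1 * f).
Proof.
move=> fz f0 q; rewrite pcoefMcst mulrC -ratr_Fp_eq0 //.
by have := congr1 (fun h : puiseux 'F_p => h q) f0 => /= ->.
Qed.

(** Series modulo p form a field, so that a factor g that is nonzero modulo p can
    be cancelled from a divisibility by p; the factors p of m are treated one
    at a time. *)
Lemma cancel_integral f g m : (0 < m)%N -> pintegral p f -> pintegral p g ->
  red g != 0 -> pintegral p (pcst m%:R^-1 * (f * g)) ->
  pintegral p (pcst m%:R^-1 * f).
Proof.
elim/ltn_ind: m f => m IH f m0 fz gz g0 fgz.
have [/dvdnP[n mn]|pm] := boolP (p %| m)%N; last first.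
  apply: pintegralM => //; apply: pintegral_mono.
  by rewrite zlocV_nat // prime_coprime.
have n0 : (0 < n)%N by move: m0; rewrite mn; case: (n).
have n1 : (n%:R : rat) != 0 by rewrite pnatr_eq0 -lt0n.
have E h : pcst m%:R^-1 * h = pcst n%:R^-1 * (pcst p%:R^-1 * h).
  by rewrite mn natrM invfM rmorphM /= mulrA.
rewrite E; apply: IH => //.
- by rewrite mn ltn_Pmulr ?prime_gt1.
- apply: red_eq0 => //; apply/eqP; rewrite -(mulIr_eq0 _ (mulIf g0)) /red.
  rewrite -(pmapM (Fp_unit pp)) //; apply/eqP/puiseux_ext => q; apply/eqP.
  rewrite pmapE pcoef0 ratr_Fp_eq0 //; last exact: pintegralM.
  have := fgz q; rewrite pcoefMcst mn natrM => H.
  have -> : (f * g) q / p%:R = n%:R * ((n%:R * p%:R)^-1 * (f * g) q).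
    by have p1 := natp_neq0 pp; field; rewrite p1 n1.
  by rewrite rpredM ?zloc_nat.
- by rewrite -mulrA -E.
Qed.

End CancelIntegral.

(** * Polynomials in two variables and their values *)

Section Evaluation.
Variables (k A : comNzRingType) (i : {rmorphism k -> A}) (x f : A).

Definition evX (c : {poly k}) : A := (map_poly i c).[x].

Lemma evX_zmod : zmod_morphism evX.
Proof. by move=> c d; rewrite /evX rmorphB hornerD hornerN. Qed.
Lemma evX_monoid : monoid_morphism evX.
Proof.
by split=> [|c d]; rewrite /evX; [rewrite rmorph1 hornerC|rewrite rmorphM hornerM].
Qed.
HB.instance Definition _ := GRing.isZmodMorphism.Build {poly k} A evX evX_zmod.
HB.instance Definition _ := GRing.isMonoidMorphism.Build {poly k} A evX evX_monoid.

Lemma evX_C c : evX c%:P = i c.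
Proof. by rewrite /evX map_polyC hornerC. Qed.
Lemma evX_X : evX 'X = x.
Proof. by rewrite /evX map_polyX hornerX. Qed.

Lemma evX_sum (c : {poly k}) n : (size c <= n)%N ->
  evX c = \sum_(j < n) i c`_j * x ^+ j.
Proof.
move=> cn; rewrite /evX (@horner_coef_wide _ n) ?(leq_trans (size_poly _ _)) //.
by apply: eq_bigr => j _; rewrite coef_map.
Qed.

(** In {poly {poly k}} the inner variable stands for X and the outer one for Y;
    this is the substitution of x for X and of f for Y. *)
Definition ev (w : {poly {poly k}}) : A := (map_poly evX w).[f].

Lemma ev_zmod : zmod_morphism ev.
Proof. by move=> c d; rewrite /ev rmorphB hornerD hornerN. Qed.
Lemma ev_monoid : monoid_morphism ev.
Proof.
by split=> [|c d]; rewrite /ev; [rewrite rmorph1 hornerC|rewrite rmorphM hornerM].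
Qed.
HB.instance Definition _ := GRing.isZmodMorphism.Build {poly {poly k}} A ev ev_zmod.
HB.instance Definition _ := GRing.isMonoidMorphism.Build {poly {poly k}} A ev ev_monoid.

Lemma ev_C c : ev c%:P = evX c.
Proof. by rewrite /ev map_polyC hornerC. Qed.
Lemma ev_X : ev 'X = f.
Proof. by rewrite /ev map_polyX hornerX. Qed.

Lemma ev_sum (w : {poly {poly k}}) n : (size w <= n)%N ->
  ev w = \sum_(j < n) evX w`_j * f ^+ j.
Proof.
move=> wn; rewrite /ev (@horner_coef_wide _ n) ?(leq_trans (size_poly _ _)) //.
by apply: eq_bigr => j _; rewrite coef_map.
Qed.

End Evaluation.

Section EvaluationMorphism.
Variables (k A B : comNzRingType) (i : {rmorphism k -> A}) (j : {rmorphism k -> B}).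
Variables (psi : {rmorphism A -> B}) (psi_i : forall c, psi (i c) = j c).

Lemma evX_morph x c : psi (evX i x c) = evX j (psi x) c.
Proof.
rewrite (@evX_sum _ _ i x c (size c)) // (@evX_sum _ _ j _ c (size c)) // rmorph_sum.
by apply: eq_bigr => n _; rewrite rmorphM rmorphXn psi_i.
Qed.

Lemma ev_morph x f w : psi (ev i x f w) = ev j (psi x) (psi f) w.
Proof.
rewrite (@ev_sum _ _ i x f w (size w)) // (@ev_sum _ _ j _ _ w (size w)) // rmorph_sum.
by apply: eq_bigr => n _; rewrite rmorphM rmorphXn evX_morph.
Qed.

End EvaluationMorphism.

Notation pev := (ev (@pcst _)).

Definition integral2 (p : nat) : {pred {poly {poly rat}}} :=
  polyOver (polyOver (zloc p)).

Lemma integral2P p (w : {poly {poly rat}}) :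
  reflect (forall j l, w`_j`_l \in zloc p) (w \in integral2 p).
Proof.
apply: (iffP polyOverP) => [wz j l|wz j]; first by have /polyOverP := wz j; apply.
by apply/polyOverP => l.
Qed.

Fact integral2_subring p : subring_closed (integral2 p).
Proof.
split=> [|v w /integral2P vz /integral2P wz|v w /integral2P vz /integral2P wz];
  apply/integral2P => j l.
- by rewrite coef1 -polyC_natr coefC; case: ifP => _; rewrite ?zloc_nat ?rpred0.
- by rewrite !coefB rpredB.
- rewrite coefM coef_sum rpred_sum // => a _; rewrite coefM rpred_sum // => b _.
  exact: rpredM.
Qed.
HB.instance Definition _ p :=
  GRing.isSubringClosed.Build {poly {poly rat}} (integral2 p) (integral2_subring p).

Section EvaluationReduction.
Variables (p : nat) (k : fieldType).
Hypothesis unitk : forall b, (0 < b)%N -> coprime p b -> b%:R != 0 :> k.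
Implicit Types (x f : puiseux rat) (w : {poly {poly rat}}).

Definition red2 w : {poly {poly k}} := map_poly (map_poly ratr) w.

Lemma coef_red2 w j l : (red2 w)`_j`_l = ratr w`_j`_l.
Proof.
by rewrite /red2 coef_map_id0 ?map_poly0 // coef_map_id0 // ratr0.
Qed.

Lemma pev_sum2 (k0 : fieldType) (x f : puiseux k0) (w : {poly {poly k0}}) n m :
  (size w <= n)%N -> (forall j, size (w`_j)%R <= m)%N ->
  pev x f w = \sum_(j < n) \sum_(l < m) pcst w`_j`_l * x ^+ l * f ^+ j.
Proof.
move=> wn wm; rewrite (ev_sum _ _ _ wn); apply: eq_bigr => j _.
by rewrite (evX_sum _ _ (wm j)) mulr_suml.
Qed.

Lemma size2_bound (k0 : nzRingType) (w : {poly {poly k0}}) j :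
  (size (w`_j)%R <= \max_(j < size w) size (w`_j)%R)%N.
Proof.
have [jw|wj] := ltnP j (size w); first exact: (leq_bigmax (Ordinal jw)).
by rewrite nth_default // size_poly0.
Qed.

Lemma pev_integral x f w : pintegral p x -> pintegral p f -> w \in integral2 p ->
  pintegral p (pev x f w).
Proof.
move=> xz fz /integral2P wz; rewrite (pev_sum2 _ _ (leqnn _) (size2_bound w)).
apply: pintegral_sum => j _; apply: pintegral_sum => l _.
apply: pintegralM; last exact: pintegralX.
by apply: pintegralM; [apply: pintegral_mono|apply: pintegralX].
Qed.

Lemma pmap_pev x f w : pintegral p x -> pintegral p f -> w \in integral2 p ->
  pmap k (pev x f w) = pev (pmap k x) (pmap k f) (red2 w).
Proof.
move=> xz fz /integral2P wz; rewrite (pev_sum2 _ _ (leqnn _) (size2_bound w)).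
have pz j l : pintegral p (pcst w`_j`_l * x ^+ l).
  by apply: pintegralM; [apply: pintegral_mono|apply: pintegralX].
have sw : (size (red2 w) <= size w)%N by exact: size_poly.
have swj j : (size ((red2 w)`_j)%R <= \max_(j < size w) size (w`_j)%R)%N.
  apply: leq_trans (size2_bound w j); apply/leq_sizeP => l lw.
  by rewrite coef_red2 nth_default // ratr0.
rewrite (pev_sum2 _ _ sw swj) (pmap_sum unitk); last first.
  by move=> j _; apply: pintegral_sum => l _; apply: pintegralM => //; apply: pintegralX.
apply: eq_bigr => j _; rewrite (pmap_sum unitk); last first.
  by move=> l _; apply: pintegralM => //; apply: pintegralX.
apply: eq_bigr => l _; rewrite (pmapM unitk) //; last exact: pintegralX.
rewrite (pmapM unitk); [|exact: pintegral_mono|exact: pintegralX].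
by rewrite !(pmapX unitk) // pmap_mono coef_red2.
Qed.

End EvaluationReduction.

Section Transcendental.
Variables (k : fieldType) (a : rat) (a0 : a != 0).

Lemma pevX_sum x (c : {poly k}) n : (size c <= n)%N ->
  evX (@pcst k) x c = \sum_(j < n) pcst c`_j * x ^+ j.
Proof. exact: evX_sum. Qed.

Lemma evX_mono_coef (c : {poly k}) (j : nat) :
  (evX (@pcst k) (pmono 1 a) c) (j%:R * a) = c`_j.
Proof.
have [jc|cj] := ltnP j (size c).
  rewrite (pevX_sum _ (leqnn _)) pcoef_sum (bigD1 (Ordinal jc)) // big1.
    by rewrite pcoefMcst pmonoX pmono_coef /= eqxx mulr1 addr0.
  move=> l; rewrite andTb -val_eqE => lj; rewrite pcoefMcst pmonoX pmono_coef.
  by rewrite (inj_eq (mulIf a0)) eqr_nat eq_sym [_ == _](negPf lj) mulr0.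
rewrite nth_default // (pevX_sum _ (leqnn _)) pcoef_sum big1 // => l _.
rewrite pcoefMcst pmonoX pmono_coef (inj_eq (mulIf a0)) eqr_nat.
by rewrite gtn_eqF ?mulr0 // (leq_trans (ltn_ord l)).
Qed.

(** After a translation by b, the value of c at t^a has the coefficients of c
    at the distinct exponents j a. *)
Lemma evX_transcendental (b : k) (c : {poly k}) : c != 0 ->
  evX (@pcst k) (pcst b + pmono 1 a) c != 0.
Proof.
move=> c0; have -> : evX (@pcst k) (pcst b + pmono 1 a) c =
    evX (@pcst k) (pmono 1 a) (c \Po ('X + b%:P)).
  rewrite /evX map_comp_poly horner_comp rmorphD /= map_polyX map_polyC.
  by rewrite !hornerE addrC.
apply: contraNneq c0 => E; rewrite -(@comp_poly2_eq0 _ _ ('X + b%:P)) ?size_XaddC //.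
by apply/eqP/polyP => j; rewrite -evX_mono_coef E coef0.
Qed.

End Transcendental.

Section Theta.
Variable e : rat.
Implicit Types f g : puiseux rat.

Fact ptheta_supp f : puiseux_supp (fun q => e * q * f q).
Proof.
have [d [r [d0 Hf]]] := puiseuxP f; exists d, r; split=> // q.
by rewrite mulf_eq0 negb_or => /andP[_]; exact: Hf.
Qed.

(** For e = 1 at a finite point c this is (x - c) d/dx, and for e = -1 at infinity
    it is x d/dx: both derivations are diagonal on the powers of the local
    parameter. *)
Definition ptheta f : puiseux rat := mkPuiseux (ptheta_supp f).

Lemma pthetaE f q : ptheta f q = e * q * f q. Proof. by []. Qed.

Lemma pthetaD f g : ptheta (f + g) = ptheta f + ptheta g.
Proof. by apply: puiseux_ext => q; rewrite pcoefD !pthetaE pcoefD mulrDr. Qed.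

Lemma ptheta0 : ptheta 0 = 0.
Proof. by apply: puiseux_ext => q; rewrite pthetaE mulr0. Qed.

Lemma ptheta_mono c a : ptheta (pmono c a) = pmono (e * a * c) a.
Proof.
apply: puiseux_ext => q; rewrite pthetaE !pmono_coef.
by case: (eqVneq q a) => [->//|_]; rewrite mulr0.
Qed.

Lemma ptheta_cst c : ptheta (pcst c) = 0.
Proof. by rewrite ptheta_mono mulr0 mul0r; exact: (rmorph0 (@pcst rat)). Qed.

Lemma pthetaM f g : ptheta (f * g) = ptheta f * g + f * ptheta g.
Proof.
apply: puiseux_ext => q; rewrite pcoefD pthetaE.
have [s us sP] := pcoefM_fin f g q.
rewrite !(pcoefM_seq us) //.
- by rewrite mulr_sumr -big_split; apply: eq_bigr => a _ /=; ring.
- by move=> a fa; rewrite pthetaE mulf_eq0 negb_or => /andP[_]; exact: sP.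
- by move=> a; rewrite pthetaE mulf_eq0 negb_or => /andP[_]; exact: sP.
Qed.

Lemma pthetaX f n : ptheta (f ^+ n.+1) = (f ^+ n * ptheta f) *+ n.+1.
Proof.
elim: n => [|n IH]; first by rewrite expr1 expr0 mul1r.
by rewrite exprS pthetaM IH [RHS]mulrS mulrnAr exprS; congr (_ + _); [|congr (_ *+ _)]; ring.
Qed.

Lemma ptheta_evX x c : ptheta (evX (@pcst rat) x c) = evX (@pcst rat) x c^`() * ptheta x.
Proof.
elim/poly_ind: c => [|c b IH]; first by rewrite deriv0 !rmorph0 ptheta0 mul0r.
rewrite derivMXaddC !rmorphD !rmorphM /= evX_C evX_X pthetaD pthetaM IH ptheta_cst.
by ring.
Qed.

Lemma ptheta_pev x f w : ptheta (pev x f w) =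
  pev x f (map_poly (@deriv _) w) * ptheta x + pev x f w^`() * ptheta f.
Proof.
elim/poly_ind: w => [|w c IH].
  by rewrite deriv0 map_poly0 !rmorph0 ptheta0 !mul0r addr0.
have -> : map_poly (@deriv _) (w * 'X + c%:P) =
          map_poly (@deriv _) w * 'X + (c^`())%:P.
  apply/polyP => j; rewrite coef_map !coefD !coefMX !coefC !coef_map.
  by case: j => [|j] /=; rewrite derivD ?derivC ?deriv0 ?add0r ?addr0.
rewrite derivMXaddC.
rewrite !rmorphD !rmorphM /= !ev_C !ev_X pthetaD pthetaM IH ptheta_evX.
by ring.
Qed.

End Theta.

(** * Linear independence of monomials under change of coefficients *)

(** Take finitely many points with a value matrix of maximal rank: a nontrivial
    relation between its rows would fail at some further point, and adding this
    point would increase the rank. *)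
Lemma separating_points (k : fieldType) (T : Type) r (v : 'I_r -> T -> k) :
  (forall c : 'I_r -> k, (forall t, \sum_i c i * v i t = 0) -> forall i, c i = 0) ->
  exists m (t : 'I_m -> T) (B : 'M[k]_(m, r)),
    forall i j, \sum_l v i (t l) * B l j = (i == j)%:R.
Proof.
move=> indep; pose V m (t : 'I_m -> T) : 'M[k]_(r, m) := \matrix_(i, l) v i (t l).
pose P n := `[< exists m (t : 'I_m -> T), \rank (V m t) = n >].
have P0 : exists n, P n.
  have t0 : 'I_0 -> T by case.
  by exists (\rank (V 0%N t0)); apply/asboolP; exists 0%N, t0.
have Pub n : P n -> (n <= r)%N by move=> /asboolP[m [t <-]]; exact: rank_leq_row.
case: (ex_maxnP P0 Pub) => n /asboolP[m [t tn]] nmax.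
have free : row_free (V m t).
  rewrite -kermx_eq0; apply/eqP/row_matrixP => i; rewrite row0.
  set c := row i _.
  have cV : c *m V m t = 0 by rewrite -row_mul mulmx_ker row0.
  apply/rowP => j; rewrite [RHS]mxE; apply: (indep (fun j => c 0 j)) => t0.
  pose t' (l : 'I_(m + 1)) := if fintype.split l is inl l' then t l' else t0.
  have VE : V (m + 1)%N t' = row_mx (V m t) (\col_j v j t0).
    apply/matrixP => a l; rewrite !mxE /t'.
    by case: splitP => l' _; rewrite !mxE.
  have ker_le : (kermx (V (m + 1)%N t') <= kermx (V m t))%MS.
    apply/sub_kermxP; have := mulmx_ker (V (m + 1)%N t').
    by rewrite {2}VE mul_mx_row -[0]row_mx0 => /eq_row_mx[].
  have rk : \rank (V (m + 1)%N t') = n.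
    apply/eqP; rewrite eqn_leq nmax; last by apply/asboolP; exists (m + 1)%N, t'.
    have := mxrankS ker_le; rewrite !mxrank_ker tn.
    have := rank_leq_row (V (m + 1)%N t'); have := rank_leq_row (V m t); lia.
  have : (kermx (V m t) <= kermx (V (m + 1)%N t'))%MS.
    by rewrite -(geq_leqif (mxrank_leqif_sup ker_le)) !mxrank_ker rk tn.
  move=> /(submx_trans (row_sub i _))/sub_kermxP.
  rewrite -/c VE mul_mx_row -[0]row_mx0 => /eq_row_mx[_ /matrixP/(_ 0 0)].
  by rewrite !mxE => cv; rewrite -[RHS]cv; apply: eq_bigr => l _; rewrite !mxE.
exists m, t, (pinvmx (V m t)) => i j.
have := mulmxVp free => /matrixP/(_ i j); rewrite !mxE => <-.
by apply: eq_bigr => l _; rewrite !mxE.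
Qed.

(** A dual family of functionals, finite combinations of coefficients, proves
    independence over every field in which their coefficients make sense. *)
Lemma indep_reduce r (v : 'I_r -> puiseux rat) :
  (forall c : 'I_r -> rat, \sum_i pcst (c i) * v i = 0 -> forall i, c i = 0) ->
  exists s : seq rat, forall (p : nat) (k : fieldType),
    (forall b, (0 < b)%N -> coprime p b -> b%:R != 0 :> k) ->
    {subset s <= zloc p} -> (forall i, pintegral p (v i)) ->
    forall c : 'I_r -> k, \sum_i pcst (c i) * pmap k (v i) = 0 -> forall i, c i = 0.
Proof.
move=> indep; have [] := @separating_points rat rat r (fun i q => v i q).
  move=> c cv; apply: indep; apply: puiseux_ext => q.
  rewrite pcoef_sum pcoef0 -[RHS](cv q).
  by apply: eq_bigr => i _; rewrite pcoefMcst.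
move=> m [t [B vB]].
exists [seq B l.1 l.2 | l <- enum {: 'I_m * 'I_r}] => p k unitk sz vz c cv j.
have Bz l i : B l i \in zloc p.
  by apply: sz; apply/mapP; exists (l, i); rewrite ?mem_enum.
have E i : \sum_l ratr (v i (t l)) * ratr (B l j) = (i == j)%:R :> k.
  have <- : ratr (\sum_l v i (t l) * B l j) = (i == j)%:R :> k.
    by rewrite vB; case: (i == j); [exact: ratr1|exact: ratr0].
  rewrite (ratr_sum_loc unitk) => [|l _]; last by rewrite rpredM ?vz.
  by apply: eq_bigr => l _; rewrite (ratrM_loc unitk) ?vz.
transitivity (\sum_i c i * (i == j)%:R).
  rewrite (bigD1 j) //= eqxx mulr1 big1 ?addr0 // => i /negPf ->.
  by rewrite mulr0.
under eq_bigr => i _ do rewrite -E mulr_sumr.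
rewrite exchange_big /= big1 // => l _.
under eq_bigr => i _ do rewrite mulrA.
rewrite -mulr_suml; have := congr1 (fun h : puiseux k => h (t l)) cv.
rewrite /= pcoef_sum => {}cv.
rewrite [X in X * _](_ : _ = 0) ?mul0r // -[RHS]cv; apply: eq_bigr => i _.
by rewrite pcoefMcst.
Qed.

Definition supported (k : nzRingType) (S : seq (nat * nat)) (w : {poly {poly k}}) :=
  forall j l, w`_j`_l != 0 -> (j, l) \in S.

Definition monomial (k : nzRingType) (c : k) (s : nat * nat) : {poly {poly k}} :=
  (c *: 'X^(s.2))%:P * 'X^(s.1).

Lemma coef_sum_monomial (k : nzRingType) (S : seq (nat * nat)) (c : nat * nat -> k) j l :
  uniq S -> (\sum_(s <- S) monomial (c s) s)`_j`_l = if (j, l) \in S then c (j, l) else 0.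
Proof.
move=> uS; rewrite !coef_sum.
have E s : (monomial (c s) s)`_j`_l = if s == (j, l) then c (j, l) else 0.
  rewrite /monomial coefCM coefXn; case: s => a b /=; rewrite xpair_eqE [j == a]eq_sym.
  have [->|_] := eqVneq a j; last by rewrite mulr0 coef0.
  rewrite mulr1 coefZ coefXn eq_sym.
  by have [->|_] := eqVneq b l; rewrite ?mulr1 ?mulr0.
under eq_bigr => s _ do rewrite E.
by rewrite -big_mkcond /= big_const_seq count_uniq_mem //; case: (_ \in _); rewrite /= ?addr0.
Qed.

Lemma supported_sum (k : nzRingType) (S : seq (nat * nat)) (w : {poly {poly k}}) :
  uniq S -> supported S w -> w = \sum_(s <- S) monomial w`_s.1`_s.2 s.
Proof.
move=> uS Sw; apply/polyP => j; apply/polyP => l.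
rewrite (coef_sum_monomial (fun s => w`_s.1`_s.2)) //=.
by case: ifPn => // nS; apply/eqP; apply: contraNT nS => /Sw.
Qed.

Lemma pev_monomial (k : fieldType) (x f : puiseux k) c s :
  pev x f (monomial c s) = pcst c * (x ^+ s.2 * f ^+ s.1).
Proof.
rewrite /monomial rmorphM rmorphXn /= ev_C ev_X -mul_polyC rmorphM rmorphXn /=.
by rewrite evX_C evX_X mulrA.
Qed.

Lemma monomials_reduce (S : seq (nat * nat)) (x f : puiseux rat) : uniq S ->
  (forall w, supported S w -> pev x f w = 0 -> w = 0) ->
  exists s : seq rat, forall (p : nat) (k : fieldType),
    (forall b, (0 < b)%N -> coprime p b -> b%:R != 0 :> k) ->
    {subset s <= zloc p} -> pintegral p x -> pintegral p f ->
    forall w : {poly {poly k}}, supported S w ->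
      pev (pmap k x) (pmap k f) w = 0 -> w = 0.
Proof.
move=> uS indep; pose s_ (i : 'I_(size S)) := nth (0, 0)%N S i.
pose v i := x ^+ (s_ i).2 * f ^+ (s_ i).1.
have sumE (k : nzRingType) (V : zmodType) (G : nat * nat -> V) :
    \sum_(s <- S) G s = \sum_i G (s_ i).
  by rewrite (big_nth (0, 0)%N) big_mkord.
have [|s sP] := @indep_reduce _ v.
  move=> c cv i; pose c' s := if insub (index s S) is Some i then c i else 0.
  have c'E j : c' (s_ j) = c j.
    by rewrite /c' /s_ index_uniq // insubT //= => ltj; congr c; exact: val_inj.
  have w0 : \sum_(s <- S) monomial (c' s) s = 0.
    apply: indep => [j l|]; first by rewrite coef_sum_monomial //; case: ifP; rewrite ?eqxx.
    rewrite rmorph_sum (sumE rat) -[RHS]cv; apply: eq_bigr => j _.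
    by rewrite /= pev_monomial c'E.
  rewrite -c'E; have := congr1 (fun w : {poly {poly rat}} => w`_(s_ i).1`_(s_ i).2) w0.
  by rewrite /= coef_sum_monomial // !coef0 -surjective_pairing mem_nth.
exists s => p k unitk sz xz fz w Sw w0.
have vz i : pintegral p (v i) by apply: pintegralM; exact: pintegralX.
have {}sP := sP p k unitk sz vz (fun i => w`_(s_ i).1`_(s_ i).2).
apply/polyP => j; apply/polyP => l; rewrite !coef0; apply/eqP.
apply: contraTT isT => wjl; have jlS := Sw _ _ wjl.
have iS : (index (j, l) S < size S)%N by rewrite index_mem.
have := sP _ (Ordinal iS); rewrite /s_ /= nth_index //= => H.
rewrite H ?eqxx // in wjl; rewrite -[RHS]w0 [in RHS](supported_sum uS Sw).
rewrite rmorph_sum (sumE k) /=; apply: eq_bigr => i _; rewrite pev_monomial.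
by rewrite (pmapM unitk) ?(pmapX unitk) //; exact: pintegralX.
Qed.

(** * Almost all primes; integrality of algebraic series *)

Definition almost_all (Q : nat -> Prop) :=
  exists M, forall p, prime p -> (M < p)%N -> Q p.

Lemma ae_and (Q Q' : nat -> Prop) :
  almost_all Q -> almost_all Q' -> almost_all (fun p => Q p /\ Q' p).
Proof.
move=> [M QM] [N QN]; exists (maxn M N) => p pp; rewrite gtn_max => /andP[Mp Np].
by split; [exact: QM|exact: QN].
Qed.

Lemma ae_imp (Q Q' : nat -> Prop) : (forall p, prime p -> Q p -> Q' p) ->
  almost_all Q -> almost_all Q'.
Proof. by move=> QQ' [M QM]; exists M => p pp Mp; apply/QQ'/QM. Qed.

Lemma ae_forall n (Q : nat -> nat -> Prop) :
  (forall i, (i < n)%N -> almost_all (Q i)) ->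
  almost_all (fun p => forall i, (i < n)%N -> Q i p).
Proof.
elim: n => [|n IH] H; first by exists 0%N.
have := ae_and (IH (fun i ni => H i (ltnW ni))) (H n (ltnSn n)).
apply: ae_imp => p _ [Hp Hn] i; rewrite ltnS leq_eqVlt => /orP[/eqP ->//|].
exact: Hp.
Qed.

Lemma ae_zloc r : almost_all (fun p => r \in zloc p).
Proof.
exists `|denq r|%N => p pp lp; rewrite unfold_in /zloc prime_coprime //.
by apply: contraL lp => /dvdn_leq; rewrite -leqNgt absz_gt0 denq_neq0; apply.
Qed.

Lemma ae_zloc_seq (s : seq rat) : almost_all (fun p => {subset s <= zloc p}).
Proof.
elim: s => [|r s IH]; first by exists 0%N.
apply: ae_imp (ae_and (ae_zloc r) IH) => p _ [rz sz] x.
by rewrite inE => /orP[/eqP ->|/sz].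
Qed.

Lemma ae_coprime d : (0 < d)%N -> almost_all (fun p => coprime p d).
Proof.
move=> d0; exists d => p pp dp; rewrite prime_coprime //.
by apply: contraL dp => /dvdn_leq; rewrite -leqNgt; apply.
Qed.

Lemma ae_gt n : almost_all (fun p => (n < p)%N).
Proof. by exists n. Qed.

Lemma ae_false (Q : nat -> Prop) : almost_all Q -> exists p, prime p /\ Q p.
Proof.
move=> [M QM]; have [p Mp pp] := prime_above M.
by exists p; split=> //; exact: QM.
Qed.

Lemma common_order_ge (n : nat) (G : nat -> puiseux rat) :
  exists E, forall i, (i < n)%N -> order_ge E (G i).
Proof.
elim: n => [|n [E HE]]; first by exists 0.
have [l Hl] := puiseux_lb (G n); exists (Num.min E l) => i.
rewrite ltnS leq_eqVlt => /orP[/eqP ->|/HE Hi].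
  by apply: order_ge_le Hl; rewrite ge_min lexx orbT.
by apply: order_ge_le Hi; rewrite ge_min lexx.
Qed.

(** Eisenstein's theorem. If the coefficients of f below exponent q are known,
    Taylor expansion at f of the equation, evaluated at the truncation of f,
    determines f_q up to the leading coefficient of A'(f). *)
Lemma algebraic_integral (A : {poly puiseux rat}) (f : puiseux rat) :
  A.[f] = 0 -> A^`().[f] != 0 ->
  almost_all (fun p => forall j, pintegral p A`_j) ->
  almost_all (fun p => pintegral p f).
Proof.
move=> Af A'f Az; have [kap lam0 kapf] := puiseux_lead A'f.
set lam := A^`().[f] kap in lam0.
have [d [r [d0 Hf]]] := puiseuxP f.
have Hn a : f a != 0 -> exists n : nat, a = (r + n%:Z)%:~R / d%:R.
  move=> /Hf[m rm ->]; exists `|m - r|%N.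
  by rewrite gez0_abs ?subr_ge0 // addrCA subrr addr0.
pose N := (size A).+2.
have [E HE] := common_order_ge N (fun i => A^`N(i).[f]).
pose Q0 := Num.max 0 (kap - E).
have /finite_seqP[s sE] := puiseux_fin f Q0.
have sP a : f a != 0 -> a <= Q0 -> a \in s.
  by move=> fa aQ; have := congr1 (fun A => A a) sE => /= <-.
have := ae_and (ae_and Az (ae_zloc lam^-1)) (ae_zloc_seq [seq f a | a <- s]).
apply: ae_imp => p pp [[{}Az lamz] sz].
have main (n : nat) : f ((r + n%:Z)%:~R / d%:R) \in zloc p.
  elim/ltn_ind: n => n IH; set q := _ / _.
  have [->|fq] := eqVneq (f q) 0; first exact: rpred0.
  have [qQ|Qq] := leP q Q0.
    by apply: sz; apply: map_f; exact: sP.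
  pose gf a := if a < q then f a else 0.
  have gS : puiseux_supp gf.
    exists d, r; split=> // a; rewrite /gf; case: ifP => [_|_ /eqP//]; exact: Hf.
  pose g := mkPuiseux gS.
  have gE a : g a = if a < q then f a else 0 by [].
  have gz : pintegral p g.
    move=> a; rewrite gE; case: ifP => [aq|_]; last exact: rpred0.
    have [->|fa] := eqVneq (f a) 0; first exact: rpred0.
    have [m aE] := Hn _ fa; rewrite aE; apply: IH; move: aq; rewrite aE /q.
    by rewrite ltNge ler_divn // lerD2l lez_nat -ltnNge.
  pose h := f - g.
  have hq : order_ge q h.
    move=> a; rewrite /h pcoefB gE; case: ltP => // _; by rewrite subrr eqxx.
  have hqE : h q = f q by rewrite /h pcoefB gE ltxx subr0.
  have Agz : pintegral p A.[g].
    rewrite horner_coef; apply: pintegral_sum => i _.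
    by apply: pintegralM => //; exact: pintegralX.
  have taylor : A.[g] = - (A^`().[f] * h) +
      \sum_(i < size A) A^`N(i.+2).[f] * (- h) ^+ i.+2.
    have -> : g = f + - h by rewrite /h opprB addrCA subrr addr0.
    rewrite (nderiv_taylor_wide (n := N)); [|exact: mulrC|by rewrite /N; lia].
    rewrite !big_ord_recl nderivn0 Af mul0r add0r nderivn1 mulrN.
    by congr (_ + _); apply: eq_bigr => i _; rewrite /bump /= !add1n.
  have := Agz (kap + q); rewrite taylor pcoefD pcoef_sum.
  rewrite big1 => [|i _]; last first.
    have hN : order_ge q (- h) by move=> a; rewrite pcoefN oppr_eq0; exact: hq.
    have iN : (i.+2 < N)%N by rewrite /N !ltnS.
    have hi : order_ge (E + i.+2%:R * q) (A^`N(i.+2).[f] * (- h) ^+ i.+2).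
      by apply: order_geM; [exact: (HE _ iN)|exact: order_geX].
    apply: (order_ge_coef0 hi).
    have i0 : 0 <= (i%:R : rat) by rewrite ler0n.
    rewrite -[i.+2]addn2 natrD mulrDl; move: Qq; rewrite gt_max => /andP[q0 qE].
    have : 0 <= i%:R * q by rewrite mulr_ge0 // ltW.
    by lra.
  rewrite addr0 pcoefN (pcoefM_lead kapf hq) hqE rpredN => H.
  exact: zlocM_unit H _.
move=> q; have [->|fq] := eqVneq (f q) 0; first exact: rpred0.
have [m ->] := Hn _ fq.
exact: main.
Qed.

(** * Divisibility by p does not depend on the expansion *)

Section GaussLemma.
Variable k : fieldType.
Implicit Types (c l : {poly k}) (P Q M : {poly {poly k}}).

Lemma irreducible_factor l : (1 < size l)%N ->
  exists2 pi : {poly k}, irreducible_poly pi & pi %| l.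
Proof.
move=> l1; pose D n := `[< exists pi : {poly k}, [/\ size pi = n, (1 < n)%N & pi %| l] >].
have exD : exists n, D n by exists (size l); apply/asboolP; exists l.
case: (ex_minnP exD) => n /asboolP[pi [pin n1 pil]] nmin.
exists pi => //; split=> [|q q1 qpi]; first by rewrite pin.
have pi0 : pi != 0 by rewrite -size_poly_gt0 pin ltnW.
rewrite -dvdp_size_eqp // eqn_leq dvdp_leq // pin.
apply: nmin; apply/asboolP; exists q; split=> //; last exact: dvdp_trans qpi pil.
rewrite ltn_neqAle eq_sym q1 size_poly_gt0; apply: contraTneq qpi => ->.
by rewrite dvd0p.
Qed.

Lemma irreducible_prime pi Q M : irreducible_poly pi ->
  (forall j, pi %| (Q * M)`_j) ->
  (forall j, pi %| Q`_j) \/ (forall j, pi %| M`_j).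
Proof.
move=> irr QM; have [|nQ] := pselect (forall j, pi %| Q`_j); first by left.
have [|nM] := pselect (forall j, pi %| M`_j); first by right.
have exQ : exists j, ~~ (pi %| Q`_j).
  by apply: contra_notP nQ => nex j; apply/negPn/negP => h; apply: nex; exists j.
have exM : exists j, ~~ (pi %| M`_j).
  by apply: contra_notP nM => nex j; apply/negPn/negP => h; apply: nex; exists j.
case: (ex_minnP exQ) => a Qa amin; case: (ex_minnP exM) => b Mb bmin.
have := QM (a + b)%N; rewrite coefM.
have ab : (a < (a + b).+1)%N by rewrite ltnS leq_addr.
rewrite (bigD1 (Ordinal ab)) //= addKn dvdp_addl.
  rewrite -irreducible_poly_coprime // in Qa.
  by rewrite Gauss_dvdpr // (negPf Mb).
apply: (big_ind (fun c : {poly k} => pi %| c)); first exact: dvdp0.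
  by move=> c d; exact: dvdp_add.
move=> i; rewrite -val_eqE /= => ia.
have [lt|ge] := ltnP i a.
  by apply: dvdp_mulr; apply/negPn/negP => /amin; rewrite leqNgt lt.
apply: dvdp_mull; apply/negPn/negP => /bmin; have := ltn_ord i; move: ia ge; lia.
Qed.

Lemma divide_coefs pi Q : (forall j, pi %| Q`_j) -> exists Q', Q = pi%:P * Q'.
Proof.
move=> H; exists (map_poly (fun c => c %/ pi) Q); apply/polyP => j.
by rewrite coefCM coef_map_id0 ?div0p // mulrC divpK.
Qed.

(** Gauss's lemma: the irreducible factors of l can be removed one at a time from Q
    or from M, and once l is constant the degrees in X add up. *)
Lemma bounded_factor l P Q M : l != 0 -> P != 0 -> l%:P * P = Q * M ->
  exists c M0, M = c%:P * M0 /\ (sizeY M0 <= sizeY P)%N.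
Proof.
have [n] := ubnP (size l); elim: n l Q M => [//|n IH] l Q M ln l0 P0 E.
have [l1|l1] := leqP (size l) 1.
  have le := size1_polyC l1; set a := l`_0 in le; have a0 : a != 0.
    by apply: contraNneq l0 => a0; rewrite le a0.
  exists 1, M; rewrite polyC1 mul1r; split=> //.
  have PE : P = (a^-1)%:P%:P * Q * M.
    by rewrite -mulrA -E le mulrA -!polyCM mulVf // mul1r.
  have : swapXY P != 0 by rewrite -size_poly_eq0 -sizeYE sizeY_eq0.
  rewrite !sizeYE PE rmorphM /= mulf_eq0 negb_or => /andP[s1 s2].
  by rewrite size_mul // -[size (swapXY ((_ * _)))]prednK ?size_poly_gt0 // addSn leq_addl.
have [pi irr pil] := irreducible_factor l1.
have pi0 : pi != 0 by rewrite -size_poly_gt0 ltnW // (irr.1).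
have piP0 : pi%:P != 0 :> {poly {poly k}} by rewrite polyC_eq0.
case/dvdpP: pil => l' lE; have l'0 : l' != 0.
  by apply: contraNneq l0 => l'0; rewrite lE l'0 mul0r.
have l'n : (size l' < n)%N.
  have lt : (size l' < size l)%N.
    rewrite lE size_mul //; case: (size pi) (irr.1) => [|[|s]] // _.
    by rewrite !addnS ltnS leq_addr.
  by move: ln lt; rewrite ltnS => ln /leq_trans; apply.
have QM : forall j, pi %| (Q * M)`_j.
  by move=> j; rewrite -E coefCM lE -mulrA dvdp_mull // dvdp_mulr.
have [/divide_coefs[Q' QE]|/divide_coefs[M' ME]] := irreducible_prime irr QM.
  apply: (IH l' Q' M) => //; apply: (mulfI piP0).
  by rewrite mulrA -polyCM [pi * _]mulrC -lE E QE mulrA.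
have [|c [M0 [cM sM]]] := IH l' Q M' l'n l'0 P0.
  apply: (mulfI piP0).
  by rewrite mulrA -polyCM [pi * _]mulrC -lE E ME mulrCA.
by exists (pi * c), M0; rewrite ME cM polyCM mulrA.
Qed.

End GaussLemma.

Lemma pseudo_division (k : fieldType) (w M : {poly {poly k}}) : M != 0 ->
  exists l Q r, [/\ l != 0, l%:P * w = Q * M + r & (size r < size M)%N].
Proof.
move=> M0; exists (lead_coef M ^+ scalp w M), (w %/ M), (w %% M); split.
- by rewrite expf_neq0 // lead_coef_eq0.
- by rewrite mul_polyC Pdiv.Idomain.divp_eq.
- by rewrite ltn_modp.
Qed.

Section Lifts.
Variables (p : nat) (pp : prime p).

Definition lift1 (c : {poly 'F_p}) : {poly rat} :=
  map_poly (fun a : 'F_p => (nat_of_ord a)%:R) c.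
Definition lift2 (w : {poly {poly 'F_p}}) : {poly {poly rat}} := map_poly lift1 w.

Lemma lift1_0 : lift1 0 = 0.
Proof. by rewrite /lift1 map_poly0. Qed.

Lemma coef_lift2 w j l : (lift2 w)`_j`_l = (nat_of_ord w`_j`_l)%:R.
Proof. by rewrite /lift2 coef_map_id0 ?lift1_0 // /lift1 coef_map_id0. Qed.

Lemma lift2_integral w : lift2 w \in integral2 p.
Proof. by apply/integral2P => j l; rewrite coef_lift2 zloc_nat. Qed.

Lemma lift2K w : red2 'F_p (lift2 w) = w.
Proof.
apply/polyP => j; apply/polyP => l; rewrite coef_red2 coef_lift2.
by rewrite pmulrn ratr_int -pmulrn natr_Zp.
Qed.

Lemma red2D (v w : {poly {poly rat}}) : v \in integral2 p -> w \in integral2 p ->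
  red2 'F_p (v + w) = red2 'F_p v + red2 'F_p w.
Proof.
move=> /integral2P vz /integral2P wz; apply/polyP => j; apply/polyP => l.
by rewrite coef_red2 !coefD !coef_red2 (ratrD_loc (Fp_unit pp)).
Qed.

Lemma red2M (v w : {poly {poly rat}}) : v \in integral2 p -> w \in integral2 p ->
  red2 'F_p (v * w) = red2 'F_p v * red2 'F_p w.
Proof.
move=> /integral2P vz /integral2P wz; apply/polyP => j; apply/polyP => l.
rewrite coef_red2 !coefM !coef_sum (ratr_sum_loc (Fp_unit pp)); last first.
  by move=> a _; rewrite coefM rpred_sum // => b _; rewrite rpredM.
apply: eq_bigr => a _; rewrite !coefM (ratr_sum_loc (Fp_unit pp)); last first.
  by move=> b _; rewrite rpredM.
by apply: eq_bigr => b _; rewrite (ratrM_loc (Fp_unit pp)) // !coef_red2.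
Qed.

Lemma red2_eq0 (w : {poly {poly rat}}) : w \in integral2 p -> red2 'F_p w = 0 ->
  (p%:R^-1)%:P%:P * w \in integral2 p.
Proof.
move=> /integral2P wz w0; apply/integral2P => j l; rewrite !coefCM mulrC.
by rewrite -ratr_Fp_eq0 // -coef_red2 w0 !coef0.
Qed.

End Lifts.

Section Transfer.
Variables (c1 c2 e1 e2 : rat) (f1 f2 : puiseux rat) (P : {poly {poly rat}}).
Let x1 : puiseux rat := pcst c1 + pmono 1 e1.
Let x2 : puiseux rat := pcst c2 + pmono 1 e2.
Hypotheses (e10 : e1 != 0) (e20 : e2 != 0) (P0 : P != 0).
Hypotheses (P1 : pev x1 f1 P = 0) (P2 : pev x2 f2 P = 0).
Hypothesis Pmin : forall w : {poly {poly rat}}, (size w < size P)%N -> pev x1 f1 w = 0 -> w = 0.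
Hypotheses (f1z : almost_all (fun p => pintegral p f1)).
Hypotheses (f2z : almost_all (fun p => pintegral p f2)).

Lemma ae_integral2 : almost_all (fun p => P \in integral2 p).
Proof.
have := @ae_forall (size P) (fun j p => forall l, (l < size (P`_j)%R)%N -> P`_j`_l \in zloc p).
move=> H; apply: ae_imp (H (fun j _ => ae_forall (fun l _ => ae_zloc P`_j`_l))).
move=> p _ {}H; apply/integral2P => j l.
have [jP|Pj] := ltnP j (size P); last by rewrite [P`_j]nth_default // coef0 rpred0.
have [lP|Pl] := ltnP l (size P`_j); first exact: H.
by rewrite nth_default // rpred0.
Qed.

Lemma ae_red2_neq0 : almost_all (fun p => P \in integral2 p -> red2 'F_p P != 0).
Proof.
pose a := lead_coef (lead_coef P).
have a0 : a != 0 by rewrite !lead_coef_eq0.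
apply: ae_imp (ae_zloc a^-1) => p pp aV /integral2P Pz.
apply: contraTneq (zloc_not_div pp a0 aV) => P0'; apply/negPn.
rewrite -ratr_Fp_eq0 //; last exact: Pz.
by rewrite /a /lead_coef -coef_red2 P0' !coef0.
Qed.

Lemma pintegral_x (c e : rat) p : c \in zloc p -> pintegral p (pcst c + pmono 1 e).
Proof.
by move=> cz; apply: pintegralD; apply: pintegral_mono => //; exact: rpred1.
Qed.

Lemma pmap_x (c e : rat) p : prime p -> c \in zloc p ->
  pmap 'F_p (pcst c + pmono 1 e) = pcst (ratr c) + pmono 1 e.
Proof.
move=> pp cz; rewrite (pmapD (Fp_unit pp)); [|exact: pintegral_mono|]; last first.
  by apply: pintegral_mono; exact: rpred1.
by rewrite !pmap_mono ratr1.
Qed.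

(** Among the polynomials that vanish at f1 modulo p, one of least Y-degree divides P
    modulo p up to a factor in F_p[X], hence by Gauss's lemma can be taken of X-degree
    at most that of P. If its Y-degree were lower than that of P, it would be
    a relation modulo p between finitely many monomials that are independent
    over Q, hence modulo almost all p. *)
Lemma ae_minimal : almost_all (fun p =>
  forall M : {poly {poly 'F_p}}, M != 0 ->
    pev (pmap 'F_p x1) (pmap 'F_p f1) M = 0 -> (size P <= size M)%N).
Proof.
pose S := [seq (j, l) | j <- iota 0 (size P).-1, l <- iota 0 (sizeY P)].
have uS : uniq S by apply: allpairs_uniq => [||[? ?] [? ?]]; rewrite ?iota_uniq.
have SP j l : (j < (size P).-1)%N -> (l < sizeY P)%N -> (j, l) \in S.
  by move=> jP lP; apply/allpairsP; exists (j, l); rewrite !mem_iota.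
have SP1 j l : (j, l) \in S -> (j < (size P).-1)%N.
  by case/allpairsP => -[a b] [+ _ [-> _]]; rewrite mem_iota.
have sP : (0 < size P)%N by rewrite size_poly_gt0.
have [|s sz] := @monomials_reduce S x1 f1 uS.
  move=> w Sw; apply: Pmin; apply: (@leq_ltn_trans (size P).-1); last by rewrite ltn_predL.
  apply/leq_sizeP => j Pj; apply/polyP => l; rewrite coef0; apply/eqP.
  by apply: contraTT Pj => /Sw/SP1; rewrite -ltnNge.
have ae1 := ae_and (ae_and ae_integral2 ae_red2_neq0) (ae_and f1z (ae_zloc c1)).
apply: ae_imp (ae_and ae1 (ae_zloc_seq s)) => p pp [[[Pz Pnz] [fz cz]] sp] M M0 M1.
have {}Pnz := Pnz Pz; rewrite leqNgt; apply/negP => MP.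
have xz : pintegral p x1 by exact: pintegral_x.
have xE : pmap 'F_p x1 = pcst (ratr c1) + pmono 1 e1 by exact: pmap_x.
set X := pmap 'F_p x1 in M1 xE; set G := pmap 'F_p f1 in M1.
pose D n := `[< exists M : {poly {poly 'F_p}}, [/\ size M = n, M != 0 & pev X G M = 0] >].
have exD : exists n, D n by exists (size M); apply/asboolP; exists M.
case: (ex_minnP exD) => n /asboolP[N [Nn N0 N1]] nmin.
have NP : (size N < size P)%N.
  by apply: leq_ltn_trans MP; rewrite Nn; apply: nmin; apply/asboolP; exists M.
have [l [Q [r [l0 E rN]]]] := pseudo_division (red2 'F_p P) N0.
have P1' : pev X G (red2 'F_p P) = 0.
  by rewrite -(pmap_pev (Fp_unit pp)) // P1 pmap0.
have r0 : r = 0.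
  apply: contraTeq rN => r0; rewrite -leqNgt Nn; apply: nmin; apply/asboolP.
  exists r; split=> //; have := congr1 (pev X G) E.
  by rewrite rmorphM /= P1' mulr0 rmorphD rmorphM /= N1 mulr0 add0r.
rewrite r0 addr0 in E.
have [c [N' [NE sN']]] := bounded_factor l0 Pnz E.
have c0 : c != 0 by apply: contraNneq N0 => c0; rewrite NE c0 mul0r.
have N'1 : pev X G N' = 0.
  apply/eqP; move/eqP: N1; rewrite NE rmorphM /= ev_C mulf_eq0.
  by rewrite xE (negPf (evX_transcendental e10 _ c0)).
have N'0 : N' = 0.
  apply: (sz p 'F_p (Fp_unit pp) sp xz fz) N'1 => j l' jl.
  apply: SP; last first.
    have lN : (l' < size (N'`_j)%R)%N.
      by rewrite ltnNge; apply: contraNN jl => h; rewrite nth_default.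
    apply: leq_trans lN (leq_trans (size2_bound N' j) (leq_trans sN' _)).
    apply/bigmax_leqP => i _; apply: leq_trans (size2_bound P i).
    by apply/leq_sizeP => b Pb; rewrite coef_red2 nth_default // ratr0.
  have jN : (j < size N')%N.
    by rewrite ltnNge; apply: contraNN jl => h; rewrite [N'`_j]nth_default // coef0.
  have sNN' : size N = size N' by rewrite NE mul_polyC size_scale.
  by rewrite -ltnS prednK // (leq_trans _ NP) // ltnS sNN'.
by move: N0; rewrite NE N'0 mulr0 eqxx.
Qed.

(** If w vanishes at f1 modulo p, then P divides w modulo p over the field F_p(X):
    l w = Q P + p w' with l nonzero modulo p. At f1 and at f2 this reads
    l w = p w', so that w' at f1 is divisible by m / p, and induction on m applies to
    w'; finally l can be cancelled at f2. *)
Theorem transfer_divisibility : almost_all (fun p =>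
  forall m w, (0 < m)%N -> w \in integral2 p ->
    pintegral p (pcst m%:R^-1 * pev x1 f1 w) ->
    pintegral p (pcst m%:R^-1 * pev x2 f2 w)).
Proof.
have ae1 := ae_and (ae_and f1z f2z) (ae_and (ae_zloc c1) (ae_zloc c2)).
have ae2 := ae_and ae_integral2 (ae_and ae_red2_neq0 ae_minimal).
apply: ae_imp (ae_and ae1 ae2) => p pp [[[fz1 fz2] [cz1 cz2]] [Pz [Pnz Mmin]]] m.
have {}Pnz := Pnz Pz.
have xz1 : pintegral p x1 by exact: pintegral_x.
have xz2 : pintegral p x2 by exact: pintegral_x.
have P1' : pev (pmap 'F_p x1) (pmap 'F_p f1) (red2 'F_p P) = 0.
  by rewrite -(pmap_pev (Fp_unit pp)) // P1 pmap0.
elim/ltn_ind: m => m IH w m0 wz w1.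
have [pm|pm] := boolP (p %| m)%N; last first.
  apply: pintegralM; last exact: pev_integral.
  by apply: pintegral_mono; rewrite zlocV_nat // prime_coprime.
case/dvdnP: pm => n mn; have n0 : (0 < n)%N by move: m0; rewrite mn; case: (n).
have n1 : (n%:R : rat) != 0 by rewrite pnatr_eq0 -lt0n.
have p1 := natp_neq0 pp.
have w1' : pev (pmap 'F_p x1) (pmap 'F_p f1) (red2 'F_p w) = 0.
  rewrite -(pmap_pev (Fp_unit pp)) //; apply: puiseux_ext => q; apply/eqP.
  rewrite pmapE pcoef0 ratr_Fp_eq0 //; last exact: pev_integral.
  have := w1 q; rewrite pcoefMcst mn natrM; set a := _ q => az.
  have -> : a / p%:R = n%:R * ((n%:R * p%:R)^-1 * a) by field; rewrite p1 n1.
  by rewrite rpredM ?zloc_nat.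
have [l [Q [r [l0 E rP]]]] := pseudo_division (red2 'F_p w) Pnz.
have r0 : r = 0.
  have [//|r0] := eqVneq r 0.
  have : (size P <= size r)%N.
    apply: Mmin => //; have := congr1 (pev (pmap 'F_p x1) (pmap 'F_p f1)) E.
    by rewrite rmorphM /= w1' mulr0 rmorphD rmorphM /= P1' mulr0 add0r.
  by rewrite leqNgt (leq_trans rP) // size_poly.
rewrite r0 addr0 in E.
pose lz := lift2 l%:P; pose Qz := lift2 Q.
have lzz : lz \in integral2 p by exact: lift2_integral.
have Qzz : Qz \in integral2 p by exact: lift2_integral.
pose w' := (p%:R^-1)%:P%:P * (lz * w - Qz * P).
have w'z : w' \in integral2 p.
  apply: red2_eq0 => //; first by rewrite rpredB ?rpredM.
  rewrite -mulNr red2D ?red2M ?rpredM ?rpredN // lift2K E -mulrDl.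
  rewrite -[X in X + _](lift2K Q) -/Qz -red2D ?rpredN // subrr.
  by rewrite /red2 map_poly0 mul0r.
have w'E (x f : puiseux rat) : pev x f P = 0 ->
    pcst n%:R^-1 * pev x f w' = pcst m%:R^-1 * (pev x f w * pev x f lz).
  move=> Pxf; rewrite /w' rmorphM rmorphB !rmorphM /= Pxf mulr0 subr0 !ev_C !evX_C.
  by rewrite mulrA -rmorphM /= -invfM -natrM -mn [pev x f lz * _]mulrC.
have lz1 : pintegral p (pev x1 f1 lz) by exact: pev_integral.
have lz2 : pintegral p (pev x2 f2 lz) by exact: pev_integral.
apply: (cancel_integral pp m0 _ lz2).
- exact: pev_integral.
- rewrite (pmap_pev (Fp_unit pp)) // lift2K // ev_C pmap_x //.
  exact: evX_transcendental.
rewrite -w'E //; apply: IH => //; first by rewrite mn ltn_Pmulr ?prime_gt1.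
by rewrite w'E // mulrA; exact: pintegralM.
Qed.

End Transfer.

(** * The local criterion *)

Section LogDerivExists.
Variable b : nat -> rat.

Fixpoint exp_seq (n : nat) : seq rat :=
  if n is m.+1 then
    let s := exp_seq m in
    rcons s (if m is k.+1 then (\sum_(i < k.+1) b i.+1 * s`_(k - i)) / k.+1%:R else 1)
  else [::].

Lemma size_exp_seq n : size (exp_seq n) = n.
Proof. by elim: n => //= n IH; rewrite size_rcons IH. Qed.

Lemma nth_exp_seq n i : (i < n)%N -> (exp_seq n)`_i = (exp_seq i.+1)`_i.
Proof.
elim: n => // n IH; rewrite ltnS leq_eqVlt => /orP[/eqP -> //|lin].
by rewrite -IH //= nth_rcons size_exp_seq lin.
Qed.

Lemma log_deriv_exists : exists u, log_deriv b u.
Proof.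
exists (fun n => (exp_seq n.+1)`_n); split=> // n.
have -> : (exp_seq n.+2)`_n.+1 =
    (\sum_(i < n.+1) b i.+1 * (exp_seq n.+1)`_(n - i)) / n.+1%:R.
  rewrite -[exp_seq n.+2]/(rcons (exp_seq n.+1) _) nth_rcons size_exp_seq.
  by rewrite ltnn eqxx.
rewrite mulrC divfK ?pnatr_eq0 //; apply: eq_bigr => i _.
by rewrite nth_exp_seq // ltnS leq_subr.
Qed.

End LogDerivExists.

Section PowerSeries.
Variables (d : nat) (d0 : (0 < d)%N) (u : nat -> rat).

Let d1 : (d%:R : rat) != 0. Proof. by rewrite pnatr_eq0 -lt0n. Qed.
Let uf (q : rat) : rat :=
  if q * d%:R \is a Num.nat then u (Num.truncn (q * d%:R)) else 0.

Let ufN q : uf q != 0 -> exists n : nat, q = n%:R / d%:R.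
Proof.
rewrite /uf; case: ifP => [/natrP[n qn] _|_ /eqP//]; exists n.
by rewrite -qn mulfK.
Qed.

Fact puiseux_of_seq_supp : puiseux_supp uf.
Proof. by exists d, 0; split=> // q /ufN[n ->]; exists n. Qed.

Definition puiseux_of_seq : puiseux rat := mkPuiseux puiseux_of_seq_supp.

Lemma puiseux_of_seqE (n : nat) : puiseux_of_seq (n%:R / d%:R) = u n.
Proof. by rewrite -[LHS]/(uf _) /uf divfK // natr_nat natrK. Qed.

Lemma puiseux_of_seqN q : puiseux_of_seq q != 0 -> exists n : nat, q = n%:R / d%:R.
Proof. exact: ufN. Qed.

Lemma puiseux_of_seq_grid : ongrid d puiseux_of_seq.
Proof. by move=> q /puiseux_of_seqN[n ->]; exists n. Qed.

Lemma puiseux_of_seq_order : order_ge 0 puiseux_of_seq.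
Proof. by move=> q /puiseux_of_seqN[n ->]; rewrite divr_ge0 ?ler0n. Qed.

End PowerSeries.

Section Criterion.
Variables (e : rat) (g : puiseux rat) (d : nat).
Hypotheses (e1 : e = 1 \/ e = -1) (d0 : (0 < d)%N) (gd : ongrid d g).

(** For g = (x - c) f and y a solution of y' = f y, with derivatives y^(n) in x,
    this is (x - c)^n y^(n) / y, where x - c stands for t^e. *)
Fixpoint deriv_ratio (n : nat) : puiseux rat :=
  if n is m.+1 then
    ptheta e (deriv_ratio m) - pcst m%:R * deriv_ratio m + g * deriv_ratio m
  else 1.

Let a (n : int) : rat := g (n%:~R / d%:R).
Let d1 : (d%:R : rat) != 0. Proof. by rewrite pnatr_eq0 -lt0n. Qed.
Let ee : e * e = 1. Proof. by case: e1 => ->; rewrite ?mulrNN mulr1. Qed.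

Let e0 : e != 0. Proof. by case: e1 => ->; rewrite ?oppr_eq0 oner_eq0. Qed.

Lemma deriv_ratio_grid n : ongrid d (deriv_ratio n).
Proof.
have cst (c : rat) : ongrid d (pcst c) by have := @ongrid_mono rat d c 0 d0; rewrite mulr0z.
elim: n => [|n IH] /=; first exact: cst.
apply: ongridD; last exact: ongridM.
apply: ongridD; first by move=> q; rewrite pthetaE mulf_eq0 negb_or => /andP[_ /IH].
by move=> q; rewrite pcoefN oppr_eq0; apply: ongridM.
Qed.

Lemma deriv_ratio_order n : order_ge 0 g -> order_ge 0 (deriv_ratio n).
Proof.
move=> lg; elim: n => [|n IH]; first exact: order_ge_mono.
apply: order_geD; last by rewrite -[0](addr0 0); exact: order_geM.
apply: order_geD; first by move=> q; rewrite pthetaE mulf_eq0 negb_or => /andP[_ /IH].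
move=> q; rewrite pcoefN oppr_eq0 -[X in X <= _](addr0 0).
by apply: order_geM => //; exact: order_ge_mono.
Qed.

Section AtPrime.
Variables (p : nat) (pp : prime p) (p2 : (2 < p)%N) (pd : coprime p d).
Hypotheses (gz : pintegral p g) (lg : order_ge 0 g).

Let gridz q : (exists n : int, q = n%:~R / d%:R) -> q \in zloc p.
Proof. by case=> n ->; exact: zloc_frac. Qed.

Let ez : e \in zloc p. Proof. exact: zloc_sign. Qed.

Lemma deriv_ratio_integral n : pintegral p (deriv_ratio n).
Proof.
elim: n => [|n IH]; first by apply: pintegral_mono; exact: rpred1.
apply: pintegralD; last exact: pintegralM.
apply: pintegralB; last first.
  by apply: pintegralM => //; apply: pintegral_mono; exact: zloc_nat.
move=> q; rewrite pthetaE; have [->|Kq] := eqVneq (deriv_ratio n q) 0.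
  by rewrite mulr0 rpred0.
by apply: rpredM => //; apply: rpredM => //; apply: gridz; exact: deriv_ratio_grid Kq.
Qed.

Let b (n : nat) : rat := e * d%:R * a n.

Let b_gauss n : gauss_at p b n <-> exists2 r : rat,
  Zloc p r & a (n%:Z * p%:Z) - a n = (n%:Z * p%:Z)%:~R * r.
Proof.
have [->|n0] := posnP n.
  rewrite /gauss_at mul0n subrr mul0r mul0r; split=> _; last exact: rpred0.
  by exists 0; [apply/Zloc_zloc => //; exact: rpred0|rewrite subrr mulr0].
have np : ((n * p)%:R : rat) != 0 by rewrite pnatr_eq0 muln_eq0 negb_or -!lt0n n0 prime_gt0.
rewrite /gauss_at /b -PoszM -mulrBr -pmulrn; split=> [H|[r /(Zloc_zloc r pp) rz ->]].
  exists ((a (n * p)%N - a n) / (n * p)%:R); last by rewrite mulrC divfK.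
  apply/Zloc_zloc => //; move: H; set s := a _ - _ => H.
  have -> : s / (n * p)%:R = e * d%:R^-1 * (e * d%:R * s / (n * p)%:R).
    rewrite -[LHS]mul1r -ee; field.
    by rewrite d1 e0 natp_neq0 // pnatr_eq0 -lt0n n0.
  by apply: rpredM => //; apply: rpredM => //; exact: zlocV_nat.
rewrite mulrA mulrAC mulfK //.
by apply: rpredM => //; apply: rpredM => //; exact: zloc_nat.
Qed.

Let a0z : a 0 \in zloc p. Proof. exact: gz. Qed.

Lemma negative_coef0 (n : int) : n < 0 -> a n = 0.
Proof.
move=> n0; apply: (order_ge_coef0 lg).
by rewrite -[0](mul0r d%:R^-1) ltr_pM2r ?invr_gt0 ?ltr0n // ltrz0.
Qed.

Lemma gauss_b : gauss_congruences p a <-> forall n, gauss_at p b n.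
Proof.
split=> [H n|H [n|n]]; first by apply/b_gauss; exact: H.
  by apply/b_gauss.
exists 0; first by apply/Zloc_zloc => //; exact: rpred0.
rewrite !negative_coef0 ?subrr ?mulr0 // ?ltrNz0 //.
by rewrite pmulr_llt0 // ltz_nat prime_gt0.
Qed.

Section Exponential.
Variables (u : nat -> rat) (bu : log_deriv b u).
Let U := puiseux_of_seq d0 u.

Lemma theta_exp : ptheta e U = (g - pcst (a 0)) * U.
Proof.
have a0E : a 0 = g 0 by rewrite /a mul0r.
have gg : ongrid d (g - pcst (a 0)).
  apply: ongridD => //; move=> q; rewrite pcoefN oppr_eq0 => H.
  by have := @ongrid_mono rat d (a 0) 0 d0; rewrite mulr0z; exact.
have gl : order_ge 0 (g - pcst (a 0)).
  by apply: order_geD => // q; rewrite pcoefN oppr_eq0; exact: order_ge_mono.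
have Ug : ongrid d U := @puiseux_of_seq_grid d d0 u.
have Ul : order_ge 0 U := @puiseux_of_seq_order d d0 u.
apply: puiseux_ext => q; rewrite pthetaE.
have [[n ->]|nq] := pselect (exists n : nat, q = n%:R / d%:R); last first.
  rewrite [U q](_ : _ = 0); last first.
    by apply: contra_notP nq => /eqP /puiseux_of_seqN.
  rewrite mulr0; apply/esym; apply: contra_notP nq => /eqP H.
  have q0 := order_geM gl Ul H; have [m qE] := ongridM gg Ug H.
  exists `|m|%N; rewrite qE natr_absz ger0_norm //.
  move: q0; rewrite addr0 qE -[X in X <= _](mul0r d%:R^-1) -[X in X * _ <= _]/(0%:~R).
  by rewrite ler_divn.
rewrite (pcoefM_grid n d0 gg Ug gl Ul) puiseux_of_seqE.
rewrite big_ord_recl mul0r pcoefB pmono_coef eqxx -a0E subrr mul0r add0r.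
case: n => [|n]; first by rewrite big_ord0 mul0r mulr0 mul0r.
have -> : e * (n.+1%:R / d%:R) * u n.+1 = e / d%:R * (n.+1%:R * u n.+1) by ring.
rewrite (bu.2) mulr_sumr; apply: eq_bigr => i _.
rewrite !lift0 subSS puiseux_of_seqE pcoefB pmono_coef.
have -> : (i.+1%:R / d%:R == 0 :> rat) = false.
  by rewrite mulf_eq0 invr_eq0 (negPf d1) pnatr_eq0.
rewrite subr0 /b /a -pmulrn; set s := g _; set s' := u _.
transitivity (e * e * (s * s')); last by rewrite ee mul1r.
by field.
Qed.

(** The derivation theta acts on y = t^(e a0) U as multiplication by g, so that
    theta (theta - 1) ... (theta - n + 1), which is (x - c)^n times the n-th
    derivative, multiplies y by the n-th ratio. On the monomial of exponent
    e a0 + q the same operator is n! times a binomial coefficient of a0 + e q. *)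
Lemma deriv_ratio_exp n q :
  (deriv_ratio n * U) q = n`!%:R * gbin (a 0 + e * q) n * U q.
Proof.
elim: n q => [|n IH] q; first by rewrite mul1r gbin0 !mul1r.
have -> : deriv_ratio n.+1 * U =
    ptheta e (deriv_ratio n * U) + pcst (a 0 - n%:R) * (deriv_ratio n * U).
  by rewrite pthetaM theta_exp rmorphB /=; ring.
rewrite pcoefD pthetaE pcoefMcst IH factS natrM.
have -> : n.+1%:R * n`!%:R * gbin (a 0 + e * q) n.+1 =
          n`!%:R * (n.+1%:R * gbin (a 0 + e * q) n.+1) by ring.
by rewrite gbin_rec; ring.
Qed.

End Exponential.

Lemma b_integral n : b n \in zloc p.
Proof. by apply: rpredM; [apply: rpredM => //; exact: zloc_nat|exact: gz]. Qed.

(** The series U = exp (sum of b_n t^(n/d) / n) is integral, and so is the product of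
    U by the n-th ratio over n!, whose coefficients are binomial
    coefficients times those of U. *)
Lemma gauss_ratio_integral : gauss_congruences p a ->
  forall n, pintegral p (pcst n`!%:R^-1 * deriv_ratio n).
Proof.
move=> /gauss_b bg n; have [u bu] := log_deriv_exists b.
have uz := gauss_exp_integral pp bu b_integral bg.
set U := puiseux_of_seq d0 u.
have Uz : pintegral p U.
  move=> q; have [->|/puiseux_of_seqN[m ->]] := eqVneq (U q) 0; first exact: rpred0.
  by rewrite puiseux_of_seqE.
apply: (cancel_integral pp (fact_gt0 n) (deriv_ratio_integral n) Uz).
  apply/eqP => U0; have := pmapE 'F_p U (0%:R / d%:R).
  by rewrite U0 puiseux_of_seqE (bu.1) ratr1 pcoef0 => /esym/eqP; rewrite oner_eq0.
move=> q; rewrite pcoefMcst deriv_ratio_exp // !mulrA mulVf ?mul1r ?pnatr_eq0 -?lt0n ?fact_gt0 //.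
have [->|/puiseux_of_seqN[m ->]] := eqVneq (U q) 0; first by rewrite mulr0 rpred0.
rewrite rpredM ?gbin_integral ?rpredD // ?puiseux_of_seqE // rpredM //.
by apply: gridz; exists m.
Qed.

(** Let K_N be the N-th ratio. Comparing the coefficients of exponent n/d in
    (K_N / N!) U expresses the n-th coefficient of U through the previous ones, up to
    the factor binomial(a0 + e n/d, N) - binomial(a0, N), which is a unit for
    a suitable N. *)
Lemma ratio_integral_gauss : (forall n, pintegral p (pcst n`!%:R^-1 * deriv_ratio n)) ->
  gauss_congruences p a.
Proof.
move=> Kz; apply/gauss_b; have [u bu] := log_deriv_exists b.
apply: (exp_integral_gauss pp bu) => n.
elim/ltn_ind: n => -[|n] IH; first by rewrite bu.1 rpred1.
set U := puiseux_of_seq d0 u.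
pose z : rat := n.+1%:R / d%:R.
have zz : e * z \in zloc p by apply: rpredM => //; apply: gridz; exists n.+1.
have z0 : e * z != 0.
  by rewrite !mulf_neq0 ?invr_eq0 // pnatr_eq0.
have [N /andP[D0 DV]] := gbin_separates pp p2 a0z zz z0.
apply: zlocM_unit DV _ D0.
set h := pcst N`!%:R^-1 * deriv_ratio N.
have N0 : (N`!%:R : rat) != 0 by rewrite pnatr_eq0 -lt0n fact_gt0.
have hU q : (h * U) q = gbin (a 0 + e * q) N * U q.
  by rewrite /h -mulrA pcoefMcst deriv_ratio_exp // !mulrA mulVf // mul1r.
have hg : ongrid d h.
  by move=> q; rewrite pcoefMcst mulf_eq0 negb_or => /andP[_]; exact: deriv_ratio_grid.
have hl : order_ge 0 h.
  by move=> q; rewrite pcoefMcst mulf_eq0 negb_or => /andP[_]; exact: deriv_ratio_order.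
have Ug : ongrid d U := @puiseux_of_seq_grid d d0 u.
have Ul : order_ge 0 U := @puiseux_of_seq_order d d0 u.
have h0 : h 0 = gbin (a 0) N.
  have := hU (0%:R / d%:R); rewrite (pcoefM_grid 0 d0 hg Ug hl Ul) big_ord1 !puiseux_of_seqE.
  by rewrite (bu.1) !mulr1 mul0r mulr0 addr0.
have Uz : U z = u n.+1 by exact: puiseux_of_seqE.
have := hU z; rewrite Uz (pcoefM_grid n.+1 d0 hg Ug hl Ul) big_ord_recl mul0r h0.
rewrite !puiseux_of_seqE subn0 => E; rewrite mulrBl -E addrAC subrr add0r.
apply: rpred_sum => i _; apply: rpredM; first exact: Kz.
by rewrite puiseux_of_seqE lift0 subSS; apply: IH; rewrite ltnS leq_subr.
Qed.

End AtPrime.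

(** For n < 0 and p large a_(np) = 0, so that the congruence at n would make a_n
    divisible by infinitely many p. *)
Lemma gauss_order_ge0 : almost_all (fun p => gauss_congruences p a) -> order_ge 0 g.
Proof.
move=> aG q gq; rewrite leNgt; apply/negP => q0; have [n qE] := gd gq.
have n0 : n < 0.
  by move: q0; rewrite qE -[X in _ < X](mul0r d%:R^-1) ltr_pM2r ?invr_gt0 ?ltr0n // ltrz0.
have [l lP] := puiseux_lb g.
have an0 : a n != 0 by rewrite /a -qE.
have big : almost_all (fun p => a (n * p%:Z) = 0).
  apply: ae_imp (ae_gt (Num.bound `|l * d%:R|)) => p pp lp.
  apply/eqP; apply: contraT => /lP; rewrite ler_pdivlMr ?ltr0n // intrM -pmulrn => h.
  have p0 : 0 < (p%:R : rat) by rewrite ltr0n prime_gt0.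
  have lp' : `|l * d%:R| < p%:R.
    by apply: lt_le_trans (archi_boundP _) _; rewrite ?normr_ge0 // ler_nat ltnW.
  have n1 : (n%:~R : rat) <= -1 by rewrite -[-1]/((-1)%:~R) ler_int; lia.
  have np : n%:~R * p%:R <= - p%:R :> rat by rewrite -[X in _ <= X]mulN1r ler_pM2r.
  by move: lp'; rewrite ltr_norml => /andP[lp1 _]; lra.
have [p [pp [[pG az] aV]]] := ae_false (ae_and (ae_and aG big) (ae_zloc (a n)^-1)).
have [r /(Zloc_zloc r pp) rz] := pG n; rewrite az sub0r intrM -pmulrn => E.
have := zloc_not_div pp an0 aV; apply/negP/negPn.
have -> : a n / p%:R = - (n%:~R * r).
  by rewrite -[a n]opprK E; field; exact: natp_neq0.
by rewrite rpredN rpredM ?zloc_int.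
Qed.

(** If g has a pole with leading term c t^kappa, the p-th ratio over p! has leading
    coefficient c^p / p!, which is not integral at p for p large. *)
Lemma ratio_integral_order_ge0 :
  almost_all (fun p => forall n, pintegral p (pcst n`!%:R^-1 * deriv_ratio n)) -> order_ge 0 g.
Proof.
move=> Kz; have [->|g0] := eqVneq g 0; first by move=> q; rewrite pcoef0 eqxx.
have [kap c0 kapg] := puiseux_lead g0; set c := g kap in c0.
have [k0|k0] := leP 0 kap; first exact: order_ge_le kapg.
have lead n : order_ge (n%:R * kap) (deriv_ratio n) /\ deriv_ratio n (n%:R * kap) = c ^+ n.
  elim: n => [|n [IH IHc]]; first by rewrite mul0r expr0; split=> //; exact: order_ge_mono.
  have E : n.+1%:R * kap = kap + n%:R * kap by rewrite -[n.+1]add1n natrD mulrDl mul1r.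
  have lo : order_ge (n%:R * kap) (ptheta e (deriv_ratio n) - pcst n%:R * deriv_ratio n).
    apply: order_geD; first by move=> q; rewrite pthetaE mulf_eq0 negb_or => /andP[_ /IH].
    by move=> q; rewrite pcoefN oppr_eq0 pcoefMcst mulf_eq0 negb_or => /andP[_ /IH].
  split; rewrite E.
    by apply: order_geD; [apply: order_ge_le lo; lra|exact: order_geM].
  rewrite -[deriv_ratio n.+1]/(_ + _ * _) pcoefD (order_ge_coef0 lo); last by lra.
  by rewrite add0r (pcoefM_lead kapg IH) IHc exprS.
have [p [pp [pK cV]]] := ae_false (ae_and Kz (ae_zloc c^-1)).
have cp0 : c ^+ p != 0 by rewrite expf_neq0.
have cpV : (c ^+ p)^-1 \in zloc p by rewrite -exprVn rpredX.
have := zloc_not_div pp cp0 cpV; case/negP.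
have := pK p (p%:R * kap); rewrite pcoefMcst (lead p).2 => H.
have pE : p`! = (p * p.-1`!)%N by rewrite -{1}(prednK (prime_gt0 pp)) factS prednK // prime_gt0.
have f0 : (p.-1`!%:R : rat) != 0 by rewrite pnatr_eq0 -lt0n fact_gt0.
have -> : c ^+ p / p%:R = p.-1`!%:R * (p`!%:R^-1 * c ^+ p).
  by rewrite pE natrM; field; rewrite f0 natp_neq0.
by rewrite rpredM ?zloc_nat.
Qed.

End Criterion.

Lemma gauss_property_ae (a : int -> rat) :
  gauss_property a <-> almost_all (fun p => gauss_congruences p a).
Proof.
split=> [/finite_seqP[s sE]|[M MP]].
  exists (\max_(p <- s) p)%N => p pp sp; apply: contrapT => np.
  have ps : p \in s by have := congr1 (fun A => A p) sE => /= <-.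
  move: sp; rewrite ltnNge => /negP; apply.
  by rewrite (big_rem p ps) /= leq_maxl.
apply: (@sub_finite_set _ _ `I_M.+1); last exact: finite_II.
move=> p [pp np] /=; rewrite ltnS leqNgt; apply/negP => /(MP p pp).
exact: np.
Qed.

(** * Comparison of two expansions of one algebraic function *)

Section Numerators.
Variable P : {poly {poly rat}}.
Let S := P^`().
Let dX (w : {poly {poly rat}}) := map_poly (@deriv _) w.

(** Since S(f) f' = - P_X(f) for S = P_Y, each ratio (x - c)^n y^(n) / y is the quotient
    by S(f)^(2n) of (x - c)^n w_n(x, f), for a polynomial w_n that does not
    depend on the expansion considered. *)
Fixpoint ratio_num (n : nat) : {poly {poly rat}} :=
  if n is m.+1 then
    S ^+ 2 * dX (ratio_num m) - S * (ratio_num m)^`() * dX P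
    - (ratio_num m * (S * dX S - S^`() * dX P)) *+ (2 * m) + S ^+ 2 * 'X * ratio_num m
  else 1.

Lemma integral2_deriv p w : w \in integral2 p -> w^`() \in integral2 p.
Proof.
by move=> /integral2P wz; apply/integral2P => j l; rewrite coef_deriv coefMn rpredMn.
Qed.

Lemma integral2_dX p w : w \in integral2 p -> dX w \in integral2 p.
Proof.
move=> /integral2P wz; apply/integral2P => j l; rewrite coef_map /= coef_deriv.
by apply: rpredMn; exact: wz.
Qed.

Lemma integral2_Y p : 'X \in integral2 p.
Proof.
apply/integral2P => j l; rewrite coefX; case: eqP => _; rewrite ?coef0 ?rpred0 //.
by rewrite coef1; case: eqP => _; rewrite ?rpred1 ?rpred0.
Qed.

Lemma ratio_num_integral p n : P \in integral2 p -> ratio_num n \in integral2 p.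
Proof.
move=> Pz; have Sz : S \in integral2 p by exact: integral2_deriv.
elim: n => [|n IH]; first exact: rpred1.
have [dw ew] := (integral2_dX IH, integral2_deriv IH).
have [dP [dS eS]] := (integral2_dX Pz, (integral2_dX Sz, integral2_deriv Sz)).
have Yz := integral2_Y p.
rewrite /=; apply: rpredD; last first.
  by apply: rpredM => //; apply: rpredM => //; exact: rpredX.
apply: rpredB; last by apply/rpredMn/rpredM => //; apply: rpredB; exact: rpredM.
by apply: rpredB; apply: rpredM => //; [exact: rpredX|exact: rpredM].
Qed.

Section OneExpansion.
Variables (e c : rat) (f : puiseux rat).
Hypotheses (e1 : e = 1 \/ e = -1).
Let T : puiseux rat := pmono 1 e.
Let x : puiseux rat := pcst c + T.
Let g := T * f.
Hypothesis Pf : pev x f P = 0.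

Let ee : e * e = 1. Proof. by case: e1 => ->; rewrite ?mulrNN mulr1. Qed.

Lemma theta_x : ptheta e x = T.
Proof. by rewrite pthetaD ptheta_cst add0r ptheta_mono ee mulr1. Qed.

Lemma deriv_ratio_num n :
  pev x f S ^+ (2 * n) * deriv_ratio e g n = pmono 1 (n%:R * e) * pev x f (ratio_num n).
Proof.
have theta_w w : ptheta e (pev x f w) =
    pev x f (dX w) * T + pev x f w^`() * ptheta e f by rewrite ptheta_pev theta_x.
set s := pev x f S; have sf : s * ptheta e f = - (T * pev x f (dX P)).
  have := theta_w P; rewrite Pf ptheta0 -/S -/s => /eqP.
  by rewrite eq_sym addrC addr_eq0 mulrC [T * _]mulrC => /eqP.
elim: n => [|n IH]; first by rewrite muln0 mul0r !mul1r rmorph1.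
set m := (2 * n)%N in IH *; have -> : (2 * n.+1)%N = m.+2 by rewrite /m; lia.
set E := s ^+ m in IH *; set K := deriv_ratio e g n in IH *.
have thE : s * ptheta e E = (E * ptheta e s) *+ m.
  rewrite /E; case: (m) => [|m']; first by rewrite expr0 ptheta_cst mulr0 mulr0n.
  by rewrite pthetaX -mulrnAr exprS; ring.
have thT : ptheta e (pmono 1 (n%:R * e)) = pcst n%:R * pmono 1 (n%:R * e).
  by rewrite ptheta_mono pmonoM add0r !mulr1 mulrCA ee mulr1.
set t := pmono 1 (n%:R * e) in IH thT *; set w := pev x f (ratio_num n) in IH *.
have -> : pmono 1 (n.+1%:R * e) = T * t :> puiseux rat.
  by rewrite pmonoM mulr1 -[n.+1]add1n natrD mulrDl mul1r.
have thEK : E * ptheta e K = pcst n%:R * t * w + t * ptheta e w - ptheta e E * K.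
  by rewrite -thT -pthetaM -IH pthetaM; ring.
have sths : s * ptheta e s = T * (s * pev x f (dX S) - pev x f S^`() * pev x f (dX P)).
  have -> : s * ptheta e s = s * pev x f (dX S) * T + pev x f S^`() * (s * ptheta e f).
    by rewrite {2}/s theta_w; ring.
  by rewrite sf; ring.
have sthw : s ^+ 2 * ptheta e w = T * (s ^+ 2 * pev x f (dX (ratio_num n))
     - s * pev x f (ratio_num n)^`() * pev x f (dX P)).
  have -> : s ^+ 2 * ptheta e w = s ^+ 2 * pev x f (dX (ratio_num n)) * T +
      s * pev x f (ratio_num n)^`() * (s * ptheta e f) by rewrite /w theta_w; ring.
  by rewrite sf; ring.
have -> : s ^+ m.+2 * deriv_ratio e g n.+1 =
    s ^+ 2 * (E * ptheta e K) - pcst n%:R * s ^+ 2 * (E * K) + s ^+ 2 * g * (E * K).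
  have -> : deriv_ratio e g n.+1 = ptheta e K - pcst n%:R * K + g * K by [].
  have -> : s ^+ m.+2 = s ^+ 2 * E by rewrite /E -exprD.
  by ring.
rewrite thEK IH.
have -> : s ^+ 2 * (pcst n%:R * t * w + t * ptheta e w - ptheta e E * K) =
  pcst n%:R * s ^+ 2 * t * w + t * (s ^+ 2 * ptheta e w) - s * (s * ptheta e E) * K.
  by ring.
rewrite thE sthw.
have -> : s * (E * ptheta e s *+ m) * K = (s * ptheta e s) * (E * K) *+ m.
  by rewrite mulrnAr mulrnAl; congr (_ *+ _); ring.
have wE : pev x f (ratio_num n.+1) = s ^+ 2 * pev x f (dX (ratio_num n))
    - s * pev x f (ratio_num n)^`() * pev x f (dX P)
    - (w * (s * pev x f (dX S) - pev x f S^`() * pev x f (dX P))) *+ m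
    + s ^+ 2 * f * w.
  have evM u v : pev x f (u * v) = pev x f u * pev x f v := rmorphM _ u v.
  have evB u v : pev x f (u - v) = pev x f u - pev x f v := rmorphB _ u v.
  have evD u v : pev x f (u + v) = pev x f u + pev x f v := rmorphD _ u v.
  have evMn u k : pev x f (u *+ k) = pev x f u *+ k := rmorphMn _ k u.
  have evXn u k : pev x f (u ^+ k) = pev x f u ^+ k := rmorphXn _ k u.
  by rewrite [ratio_num n.+1]/= !(evB, evD, evMn, evXn, evM, ev_X) -/s -/w -/m.
rewrite sths IH wE /g.
have -> : T * (s * pev x f (dX S) - pev x f S^`() * pev x f (dX P)) * (t * w) *+ m =
  T * t * (w * (s * pev x f (dX S) - pev x f S^`() * pev x f (dX P)) *+ m).
  by rewrite mulrnAr; congr (_ *+ _); ring.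
ring.
Qed.

End OneExpansion.
End Numerators.

Section Comparison.
Variables (e1 e2 c1 c2 : rat) (f1 f2 : puiseux rat) (d1 d2 : nat).
Hypotheses (e1P : e1 = 1 \/ e1 = -1) (e2P : e2 = 1 \/ e2 = -1).
Hypotheses (d10 : (0 < d1)%N) (d20 : (0 < d2)%N).
Hypotheses (f1d : ongrid d1 f1) (f2d : ongrid d2 f2).
Let T1 : puiseux rat := pmono 1 e1.
Let T2 : puiseux rat := pmono 1 e2.
Let x1 : puiseux rat := pcst c1 + T1.
Let x2 : puiseux rat := pcst c2 + T2.
Hypothesis alg : exists w : {poly {poly rat}}, w != 0 /\ pev x1 f1 w = 0.
Hypothesis conj12 : forall w, pev x1 f1 w = 0 <-> pev x2 f2 w = 0.

Lemma sign_neq0 (e : rat) : e = 1 \/ e = -1 -> e != 0.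
Proof. by case=> ->; rewrite ?oppr_eq0 oner_eq0. Qed.

Lemma algebraic_ae (P : {poly {poly rat}}) (c e : rat) (f : puiseux rat) :
  let x := pcst c + pmono 1 e in
  pev x f P = 0 -> pev x f P^`() != 0 -> almost_all (fun p => pintegral p f).
Proof.
move=> x Pf Sf; apply: (@algebraic_integral (map_poly (evX (@pcst rat) x) P)) => //.
  by rewrite deriv_map.
apply: ae_imp (ae_and (ae_integral2 P) (ae_zloc c)) => p pp [/integral2P Pz cz] j.
rewrite coef_map /= -(ev_C _ _ 0); apply: pev_integral.
- exact: pintegral_x.
- exact: pintegral0.
apply/integral2P => i l; rewrite coefC; case: eqP => _; first exact: Pz.
by rewrite coef0 rpred0.
Qed.

Lemma minimal_polynomial : exists P : {poly {poly rat}},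
  [/\ P != 0, pev x1 f1 P = 0, pev x1 f1 P^`() != 0 &
  forall w : {poly {poly rat}}, (size w < size P)%N -> pev x1 f1 w = 0 -> w = 0].
Proof.
pose D n := `[< exists w : {poly {poly rat}}, [/\ size w = n, w != 0 & pev x1 f1 w = 0] >].
have exD : exists n, D n.
  by have [w [w0 wf]] := alg; exists (size w); apply/asboolP; exists w.
case: (ex_minnP exD) => n /asboolP[P [Pn P0 Pf]] nmin.
have Pmin (w : {poly {poly rat}}) : (size w < size P)%N -> pev x1 f1 w = 0 -> w = 0.
  move=> sw wf; apply/eqP; apply: contraTT sw => w0.
  by rewrite -leqNgt Pn; apply: nmin; apply/asboolP; exists w.
exists P; split=> //; have S0 : P^`() != 0.
  have P1 : (1 < size P)%N.
    rewrite ltnNge; apply/negP => P1.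
    have PE := size1_polyC P1; move: Pf P0; rewrite PE ev_C polyC_eq0 => Pf P0.
    by have := evX_transcendental (sign_neq0 e1P) c1 P0; rewrite Pf eqxx.
  apply/eqP => S0; have := congr1 (fun w : {poly {poly rat}} => w`_(size P).-2) S0.
  rewrite coef_deriv coef0 -scaler_nat => /eqP; rewrite scaler_eq0 pnatr_eq0 /=.
  have -> : (size P).-2.+1 = (size P).-1 by move: P1; case: (size P) => [|[]].
  by rewrite -/(lead_coef P) lead_coef_eq0 (negPf P0).
apply/eqP => /Pmin E; move/eqP: S0; apply; apply: E.
by rewrite lt_size_deriv.
Qed.

(** What passes from one expansion to the other is the divisibility by n! of the values
    of w_n; at each of them it amounts, for almost all p, to the integrality of
    the ratios (x - c)^n y^(n) / (n! y). *)
Theorem gauss_transfer :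
  gauss_property (fun n => (T1 * f1) (n%:~R / d1%:R)) ->
  gauss_property (fun n => (T2 * f2) (n%:~R / d2%:R)).
Proof.
have [P [P0 P1 S1 Pmin]] := minimal_polynomial.
have P2 : pev x2 f2 P = 0 by apply/conj12.
have S2 : pev x2 f2 P^`() != 0.
  by apply: contraNneq S1 => /conj12 ->.
have f1z := algebraic_ae P1 S1; have f2z := algebraic_ae P2 S2.
have Td d (e : rat) (f : puiseux rat) : (0 < d)%N -> e = 1 \/ e = -1 -> ongrid d f ->
    ongrid d (pmono 1 e * f).
  move=> d0 eP fd; apply: ongridM => //.
  by case: eP => ->; [exact: (@ongrid_mono _ d 1 1)|exact: (@ongrid_mono _ d 1 (-1))].
have g1d := Td _ _ _ d10 e1P f1d; have g2d := Td _ _ _ d20 e2P f2d.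
have Tz p e : pintegral p (pmono 1 e) by apply: pintegral_mono; exact: rpred1.
move=> /gauss_property_ae G1; have lob1 := gauss_order_ge0 e1P d10 g1d G1.
have tr := transfer_divisibility (sign_neq0 e1P) (sign_neq0 e2P) P0 P1 P2 Pmin f1z f2z.
have [kap k0 _] := puiseux_lead S2.
have aeK : almost_all (fun p => [/\ (2 < p)%N, coprime p d2, pintegral p (T2 * f2) &
    forall n, pintegral p (pcst n`!%:R^-1 * deriv_ratio e2 (T2 * f2) n)]).
  have a1 := ae_and (ae_and f1z f2z) (ae_and (ae_zloc c1) (ae_zloc c2)).
  have a2 := ae_and (ae_and (ae_gt 2) (ae_integral2 P)) (ae_and (ae_coprime d10) (ae_coprime d20)).
  have a3 := ae_and tr (ae_and G1 (ae_zloc (pev x2 f2 P^`() kap)^-1)).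
  apply: ae_imp (ae_and a1 (ae_and a2 a3)) => p pp.
  move=> [[[fz1 fz2] [cz1 cz2]] [[[p2 Pz] [pd1 pd2]] [{}tr [{}G1 kV]]]].
  have gz1 : pintegral p (T1 * f1) by exact: pintegralM (Tz _ _) fz1.
  have gz2 : pintegral p (T2 * f2) by exact: pintegralM (Tz _ _) fz2.
  split=> // n.
  have K1 := gauss_ratio_integral e1P d10 g1d pp p2 pd1 gz1 lob1 G1 n.
  have xz1 : pintegral p x1 by exact: pintegral_x.
  have xz2 : pintegral p x2 by exact: pintegral_x.
  have Sz : P^`() \in integral2 p by exact: integral2_deriv.
  have sz2 : pintegral p (pev x2 f2 P^`()) by exact: pev_integral.
  have w1 : pintegral p (pcst n`!%:R^-1 * pev x1 f1 (ratio_num P n)).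
    have -> : pcst n`!%:R^-1 * pev x1 f1 (ratio_num P n) =
        pmono 1 (- (n%:R * e1)) * pev x1 f1 P^`() ^+ (2 * n) *
        (pcst n`!%:R^-1 * deriv_ratio e1 (T1 * f1) n).
      have -> : pmono 1 (- (n%:R * e1)) * pev x1 f1 P^`() ^+ (2 * n) *
        (pcst n`!%:R^-1 * deriv_ratio e1 (T1 * f1) n) = pcst n`!%:R^-1 *
        (pmono 1 (- (n%:R * e1)) * (pev x1 f1 P^`() ^+ (2 * n) * deriv_ratio e1 (T1 * f1) n)).
        by ring.
      by rewrite (deriv_ratio_num e1P P1) [pmono _ _ * _]mulrA pmonoM mulr1 addNr mul1r.
    apply: pintegralM K1; apply: pintegralM => //; apply: pintegralX.
    exact: pev_integral.
  have w2 := tr _ _ (fact_gt0 n) (ratio_num_integral n Pz) w1.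
  have sz2n : pintegral p (pev x2 f2 P^`() ^+ (2 * n)) by exact: pintegralX.
  apply: (cancel_integral pp (fact_gt0 n) _ sz2n).
  - exact: (deriv_ratio_integral e2P d20 g2d pd2 gz2).
  - rewrite (pmapX (Fp_unit pp)) // expf_neq0 //; apply/eqP => s0.
    have := zloc_not_div pp k0 kV; rewrite -ratr_Fp_eq0 //.
    by rewrite -pmapE s0 pcoef0 eqxx.
  rewrite [deriv_ratio _ _ _ * _]mulrC (deriv_ratio_num e2P P2) mulrCA.
  exact: pintegralM.
have lob2 : order_ge 0 (T2 * f2).
  by apply: (@ratio_integral_order_ge0 e2 _); apply: ae_imp aeK => p pp [].
apply/gauss_property_ae; apply: ae_imp aeK => p pp [p2 pd gz Kz].
exact: (ratio_integral_gauss e2P d20 g2d pp p2 pd gz lob2 Kz).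
Qed.

End Comparison.

(** * Descent to rational coefficients *)

Lemma fraction_num_den (A : idomainType) (z : {fraction A}) :
  exists a b : A, b != 0 /\ tofrac b * z = tofrac a.
Proof.
elim/quotW: z => r; exists (frac r).1, (frac r).2; split; first exact: denom_ratioP.
unlock FracField.tofrac; rewrite -[LHS]FracField.pi_mul; apply/eqmodP.
rewrite /= FracField.equivfE /FracField.mulf.
rewrite !numden_Ratio ?mulf_neq0 ?oner_neq0 ?denom_ratioP //.
by rewrite mulr1 mul1r.
Qed.

Lemma clear_denominators (A : idomainType) (q : {poly {fraction A}}) :
  exists b w, b != 0 /\ map_poly (@FracField.tofrac A) w = (tofrac b) *: q.
Proof.
elim/poly_ind: q => [|q z [b [w [b0 wE]]]].
  by exists 1, 0; rewrite oner_neq0 rmorph0 scaler0.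
have [a [b' [b'0 aE]]] := fraction_num_den z.
exists (b' * b), (b'%:P * w * 'X + (b * a)%:P); split; first exact: mulf_neq0.
rewrite rmorphD /= [map_poly _ (_ * 'X)]rmorphM /= [map_poly _ (_%:P * w)]rmorphM /=.
rewrite map_polyX !map_polyC wE /= !tofracM -aE -!mul_polyC !polyCM.
by ring.
Qed.

Section ComplexCoefficients.
Variable C : numClosedFieldType.
Let unitC := char0_unit C.
Local Notation cast := (red2 C).

Lemma zloc1 r : r \in zloc 1.
Proof. by rewrite unfold_in /zloc coprime1n. Qed.

Lemma pintegral1 (f : puiseux rat) : pintegral 1 f.
Proof. by move=> q; exact: zloc1. Qed.

Lemma integral2_1 w : w \in integral2 1.
Proof. by apply/integral2P => j l; exact: zloc1. Qed.

Lemma pmap_inj (f g : puiseux rat) : pmap C f = pmap C g -> f = g.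
Proof.
move=> E; apply: puiseux_ext => q; apply: (fmorph_inj (@ratr C)).
exact: (congr1 (fun h : puiseux C => h q) E).
Qed.

Lemma pev_cast (x f : puiseux rat) w :
  pev (pmap C x) (pmap C f) (cast w) = 0 <-> pev x f w = 0.
Proof.
rewrite -(pmap_pev unitC (pintegral1 x) (pintegral1 f) (integral2_1 w)).
split=> [E|->]; last exact: pmap0.
by apply: pmap_inj; rewrite E pmap0.
Qed.

Lemma cast_eq0 w : cast w = 0 -> w = 0.
Proof.
move=> w0; apply/polyP => j; apply/polyP => l; apply: (fmorph_inj (@ratr C)).
by have := coef_red2 C w j l; rewrite w0 !coef0 rmorph0.
Qed.

Lemma size_cast1 w j : size (cast w)`_j = size w`_j.
Proof. by rewrite /red2 coef_map_id0 ?map_poly0 // size_map_poly. Qed.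

(** Otherwise the monomials in the support of w would be linearly independent over
    Q after substitution, and so also over C. *)
Lemma rational_descent (x f : puiseux rat) (w : {poly {poly C}}) : w != 0 ->
  pev (pmap C x) (pmap C f) w = 0 ->
  exists w', [/\ w' != 0, pev x f w' = 0 &
                 forall j l, w'`_j`_l != 0 -> w`_j`_l != 0].
Proof.
move=> w0 wf; apply: contrapT => nex.
pose S := [seq jl <- [seq (j, l) | j <- iota 0 (size w), l <- iota 0 (sizeY w)] |
            w`_jl.1`_jl.2 != 0].
have uS : uniq S.
  by apply: filter_uniq; apply: allpairs_uniq => [||[? ?] [? ?]]; rewrite ?iota_uniq.
have Sw : supported S w.
  move=> j l wjl; rewrite mem_filter /= wjl; apply/allpairsP; exists (j, l).
  rewrite !mem_iota /= !add0n; split=> //.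
    rewrite ltnNge; apply: contraNN wjl => h.
    by rewrite [w`_j]nth_default // coef0.
  apply: leq_trans (size2_bound w j); rewrite ltnNge.
  by apply: contraNN wjl => h; rewrite nth_default.
have [|s sP] := @monomials_reduce S x f uS.
  move=> w' Sw' w'f; apply/eqP; apply: contraPT isT => w'0; exfalso; apply: nex.
  by exists w'; split=> // j l /Sw'; rewrite mem_filter => /andP[].
have := sP 1%N C unitC (fun r _ => zloc1 r) (pintegral1 x) (pintegral1 f) w Sw wf.
by move/eqP; rewrite (negPf w0).
Qed.

Definition shift (b : C) (w : {poly {poly C}}) := map_poly (comp_poly ('X + b%:P)) w.

Lemma ev_shift (A : comNzRingType) (i : {rmorphism C -> A}) x f b w :
  ev i x f (shift b w) = ev i (x + i b) f w.
Proof.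
rewrite /ev /shift -map_poly_comp; congr (_.[f]); apply: eq_map_poly => c /=.
by rewrite /evX map_comp_poly horner_comp rmorphD /= map_polyX map_polyC !hornerE.
Qed.

Lemma size_shift1 b (c : {poly C}) : size (c \Po ('X + b%:P)) = size c.
Proof. by rewrite size_comp_poly2 // size_XaddC. Qed.

Lemma size_shift b w : size (shift b w) = size w.
Proof.
apply: size_map_inj_poly; last exact: comp_poly0.
move=> u v /eqP; rewrite -subr_eq0 -comp_polyB comp_poly2_eq0 ?size_XaddC // subr_eq0.
by move/eqP.
Qed.

Lemma shift_coef b w j : (shift b w)`_j = w`_j \Po ('X + b%:P).
Proof. by rewrite coef_map_id0 // comp_poly0. Qed.

Lemma coef_shift1 b (c : {poly C}) n : (c \Po ('X + b%:P))`_n = c^`N(n).[b].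
Proof.
have cn : (size (map_poly (@polyC C) c) <= size c + n.+1)%N.
  by apply: leq_trans (size_poly _ _) (leq_addr _ _).
rewrite /comp_poly addrC (nderiv_taylor_wide (mulrC _ _) cn) coef_sum.
have nn : (n < size c + n.+1)%N by rewrite addnS ltnS leq_addl.
rewrite (bigD1 (Ordinal nn)) //= big1 ?addr0 => [|i ni].
  by rewrite nderivn_map horner_map coefCM coefXn eqxx mulr1.
rewrite nderivn_map horner_map coefCM coefXn; move: ni; rewrite -val_eqE /= eq_sym.
by move=> /negPf ->; rewrite mulr0.
Qed.

(** The leading coefficients of both sides have a rational ratio, equal to
    that of the factors, and the next coefficients are then rational up to the
    same factor and a rational multiple of b. *)
Lemma rational_translation (A B : {poly rat}) (al be b : C) : (1 < size A)%N ->
  al != 0 -> be != 0 ->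
  al *: (map_poly ratr A \Po ('X + b%:P)) = be *: map_poly ratr B ->
  exists r, b = ratr r.
Proof.
move=> A1 al0 be0 E; pose n := (size A).-2.
have nE : size A = n.+2 by rewrite /n; move: A1; case: (size A) => [|[]].
have a0 : A`_n.+1 != 0.
  have : lead_coef A != 0 by rewrite lead_coef_eq0 -size_poly_gt0 nE.
  by rewrite /lead_coef nE.
have Ak k : (map_poly (ratr : rat -> C) A)`_k = ratr A`_k by rewrite coef_map.
have E1 : al * ratr A`_n.+1 = be * ratr B`_n.+1.
  have := congr1 (fun q : {poly C} => q`_n.+1) E; rewrite !coefZ coef_shift1 coef_map /= => <-.
  rewrite (@horner_coef_wide _ 1).
    by rewrite big_ord1 coef_nderivn addn0 binn mulr1n expr0 mulr1 Ak.
  by apply: leq_trans (size_poly _ _) _; rewrite size_map_poly nE subSS subSnn.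
have E0 : al * (ratr A`_n + n.+1%:R * ratr A`_n.+1 * b) = be * ratr B`_n.
  have := congr1 (fun q : {poly C} => q`_n) E; rewrite !coefZ coef_shift1 coef_map /= => <-.
  rewrite (@horner_coef_wide _ 2).
    rewrite big_ord_recl big_ord1 !coef_nderivn addn0 binn mulr1n expr0 mulr1 Ak.
    by rewrite /= addn1 binSn expr1 Ak mulr_natl.
  by apply: leq_trans (size_poly _ _) _; rewrite size_map_poly nE -addn2 addKn.
exists ((A`_n.+1 / B`_n.+1 * B`_n - A`_n) / (n.+1%:R * A`_n.+1)).
have ra0 : ratr A`_n.+1 != 0 :> C by rewrite fmorph_eq0.
have rb0 : ratr B`_n.+1 != 0 :> C.
  by apply: contraNneq ra0 => rb; move: E1; rewrite rb mulr0 => /eqP; rewrite mulf_eq0 (negPf al0).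
have n0 : (n.+1%:R : C) != 0 by rewrite pnatr_eq0.
rewrite !(fmorph_div, rmorphB, rmorphM) /= ratr_nat.
have beE : be = al * ratr A`_n.+1 / ratr B`_n.+1 by rewrite E1 mulfK.
have : ratr A`_n + n.+1%:R * ratr A`_n.+1 * b = ratr A`_n.+1 / ratr B`_n.+1 * ratr B`_n.
  by apply: (mulfI al0); rewrite E0 beE; field.
by move=> <-; move: (n.+1%:R : C) n0 => N n0; field; rewrite ra0 n0.
Qed.

End ComplexCoefficients.

(** Polynomials are compared by their degree in Y, then by the degree in X of
    their leading coefficient. *)
Definition lexle (k k' : nzRingType) (v : {poly {poly k}}) (w : {poly {poly k'}}) :=
  (size v <= size w)%N /\
  (size v = size w -> (size (lead_coef v) <= size (lead_coef w))%N).

Lemma lexle_trans (k1 k2 k3 : nzRingType) (u : {poly {poly k1}})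
    (v : {poly {poly k2}}) (w : {poly {poly k3}}) :
  lexle u v -> lexle v w -> lexle u w.
Proof.
move=> [uv uv'] [vw vw']; split; first exact: leq_trans vw.
move=> E; have uv1 : size u = size v.
  by apply/eqP; rewrite eqn_leq uv E vw.
by apply: leq_trans (uv' uv1) (vw' _); rewrite -uv1.
Qed.

Lemma lexmin_exists (k : fieldType) (K : {poly {poly k}} -> Prop) :
  (exists w : {poly {poly k}}, w != 0 /\ K w) ->
  exists P, [/\ P != 0, K P & forall w : {poly {poly k}}, w != 0 -> K w -> lexle P w].
Proof.
move=> [w0 [w00 Kw0]].
pose D n := `[< exists w : {poly {poly k}}, [/\ size w = n, w != 0 & K w] >].
have exD : exists n, D n by exists (size w0); apply/asboolP; exists w0.
case: (ex_minnP exD) => n /asboolP[w1 [w1n w10 Kw1]] nmin.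
pose D' m := `[< exists w : {poly {poly k}},
  [/\ size (lead_coef w) = m, size w = n, w != 0 & K w] >].
have exD' : exists m, D' m by exists (size (lead_coef w1)); apply/asboolP; exists w1.
case: (ex_minnP exD') => m /asboolP[P [Pm Pn P0 KP]] mmin.
exists P; split=> // w w0' Kw; split.
  by rewrite Pn; apply: nmin; apply/asboolP; exists w.
by rewrite Pn Pm => wn; apply: mmin; apply/asboolP; exists w.
Qed.

Lemma lexle_support (k k' : nzRingType) (v : {poly {poly k}}) (w : {poly {poly k'}}) :
  (forall j l, v`_j`_l != 0 -> w`_j`_l != 0) -> lexle v w.
Proof.
move=> H; split=> [|E].
  apply/leq_sizeP => j wj; apply/polyP => l; rewrite coef0; apply/eqP.
  by apply: contraT => /H; rewrite [w`_j]nth_default // coef0 eqxx.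
apply/leq_sizeP => l wl; apply/eqP; apply: contraT; rewrite /lead_coef E => /H.
by rewrite -/(lead_coef w) nth_default // eqxx.
Qed.

(** The linear combination of P and Q that cancels the leading terms of their leading
    coefficients is smaller than P, so that it vanishes. *)
Lemma lexmin_unique (k : fieldType) (A : comNzRingType) (i : {rmorphism k -> A})
    (x f : A) (P Q : {poly {poly k}}) :
  P != 0 -> Q != 0 -> ev i x f P = 0 -> ev i x f Q = 0 ->
  (forall w : {poly {poly k}}, w != 0 -> ev i x f w = 0 -> lexle P w) -> lexle Q P ->
  exists al be : k, [/\ al != 0, be != 0 & forall j, al *: P`_j = be *: Q`_j].
Proof.
move=> P0 Q0 KP KQ Pmin [QP QP']; have [PQ PQ'] := Pmin _ Q0 KQ.
have sPQ : size P = size Q by apply/eqP; rewrite eqn_leq PQ.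
have lPQ : size (lead_coef P) = size (lead_coef Q).
  by apply/eqP; rewrite eqn_leq PQ' // QP'.
set al := lead_coef (lead_coef Q); set be := lead_coef (lead_coef P).
have al0 : al != 0 by rewrite !lead_coef_eq0.
have be0 : be != 0 by rewrite !lead_coef_eq0.
exists al, be; split=> //.
pose Z := al%:P%:P * P - be%:P%:P * Q.
have Zj j : Z`_j = al *: P`_j - be *: Q`_j.
  by rewrite coefB !coefCM !mul_polyC.
suff Z0 : Z = 0 by move=> j; apply/eqP; rewrite -subr_eq0 -Zj Z0 coef0.
have KZ : ev i x f Z = 0.
  have evM u v : ev i x f (u * v) = ev i x f u * ev i x f v := rmorphM _ u v.
  have evB u v : ev i x f (u - v) = ev i x f u - ev i x f v := rmorphB _ u v.
  by rewrite /Z evB !evM KP KQ !mulr0 subrr.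
apply/eqP; apply: contraT => Zn0; have [PZ PZ'] := Pmin _ Zn0 KZ.
have ZP : (size Z <= size P)%N.
  apply/leq_sizeP => j Pj; rewrite Zj nth_default // [Q`_j]nth_default -?sPQ //.
  by rewrite !scaler0 subrr.
have sPZ : size P = size Z by apply/eqP; rewrite eqn_leq PZ.
have := PZ' sPZ; rewrite leqNgt => /negP; case.
have lead0 : (0 < size (lead_coef P))%N by rewrite size_poly_gt0 lead_coef_eq0.
apply: (@leq_ltn_trans (size (lead_coef P)).-1); last by rewrite ltn_predL.
apply/leq_sizeP => l lP; rewrite {1}/lead_coef -sPZ Zj [Q`__](_ : _ = lead_coef Q); last first.
  by rewrite /lead_coef sPQ.
rewrite -/(lead_coef P) coefB !coefZ.
move: lP; rewrite leq_eqVlt => /orP[/eqP <-|lP].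
  by rewrite {2}lPQ -/(lead_coef (lead_coef P)) -/(lead_coef (lead_coef Q)) mulrC subrr.
rewrite nth_default; last by rewrite -(prednK lead0).
rewrite [X in _ - _ * X]nth_default ?mulr0 ?subrr //.
by rewrite -lPQ -(prednK lead0).
Qed.

Section Points.
Variables (C : numClosedFieldType) (L : fieldType).
Variable iota : {rmorphism {fraction {poly C}} -> L}.
Variable eta : L.

Definition center (delta : option C) : C := if delta is Some c then c else 0.
Definition local_sign (delta : option C) : rat := if delta is Some _ then 1 else -1.

Lemma local_signP delta : local_sign delta = 1 \/ local_sign delta = -1.
Proof. by case: delta => [c|]; [left|right]. Qed.

Lemma local_xE delta : local_x delta = pcst (center delta) + pmono 1 (local_sign delta).
Proof.
case: delta => [c|] //=; apply: puiseux_ext => q; rewrite pcoefD.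
by rewrite [pcst 0 q]pmono_coef; case: (q == 0); rewrite add0r.
Qed.

Let jC : {rmorphism C -> L} := (iota \o (@FracField.tofrac {poly C}) \o polyC)%FUN.
Let xL : L := iota (tofrac 'X).

Section Embedding.
Variables (delta : option C) (E : puiseux_embedding iota delta) (y : pe_field E).
Hypothesis yE : pe_incl E y = eta.

Let jK : {rmorphism C -> pe_field E} :=
  (pe_base E \o (@FracField.tofrac {poly C}) \o polyC)%FUN.

(** Morphisms of fields are injective, so that a relation satisfied by eta can be
    tested on any of its expansions. *)
Lemma embedding_ev b w : ev jC (xL - jC b) eta w = 0 <->
  pev (local_x delta - pcst b) (pe_map E y) w = 0.
Proof.
pose x : pe_field E := pe_base E (tofrac 'X) - jK b.
have H1 : pe_incl E (ev jK x y w) = ev jC (xL - jC b) eta w.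
  rewrite (ev_morph (j := jC)) => [|c]; last exact: pe_inclE.
  by congr (ev _ _ _ _); rewrite // /x rmorphB; congr (_ - _); exact: pe_inclE.
have H2 : pe_map E (ev jK x y w) = pev (local_x delta - pcst b) (pe_map E y) w.
  rewrite (ev_morph (j := @pcst C)) => [|c]; last exact: pe_mapC.
  congr (ev _ _ _ _); rewrite /x rmorphB.
  by congr (_ - _); [exact: pe_mapX|exact: pe_mapC].
rewrite -H1 -H2; split=> /eqP; rewrite fmorph_eq0 => /eqP ->; exact: rmorph0.
Qed.

Lemma embedding_rational (f : puiseux rat) b c w : pe_map E y = pmap C f ->
  center delta - b = ratr c ->
  ev jC (xL - jC b) eta (red2 C w) = 0 <-> pev (pcst c + pmono 1 (local_sign delta)) f w = 0.
Proof.
move=> yf cb; rewrite embedding_ev yf.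
have -> : local_x delta - pcst b = pmap C (pcst c + pmono 1 (local_sign delta)).
  rewrite (pmapD (char0_unit C)); [|exact: pintegral1|exact: pintegral1].
  rewrite !pmap_mono ratr1 -cb local_xE addrAC; congr (_ + _).
  exact: (esym (rmorphB (@pcst C) _ _)).
exact: pev_cast.
Qed.

End Embedding.

Hypothesis alg : algebraicOver iota eta.

Lemma algebraic_polynomial : exists w : {poly {poly C}}, w != 0 /\ ev jC xL eta w = 0.
Proof.
have [q q0 qeta] := alg; have [b [w [b0 wE]]] := clear_denominators q.
have bq0 : (tofrac b) *: q != 0 by rewrite scaler_eq0 tofrac_eq0 negb_or b0.
exists w; split; first by apply: contraNneq bq0 => w0; rewrite -wE w0 map_poly0.
have evXE (c : {poly C}) : evX jC xL c = iota (tofrac c).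
  pose psi : {rmorphism {poly C} -> L} := (iota \o (@FracField.tofrac {poly C}))%FUN.
  have /(_ 'X c) := @evX_morph C {poly C} L polyC jC psi (fun c => erefl _).
  by rewrite /evX -/(comp_poly 'X c) comp_polyXr => <-.
have -> : ev jC xL eta w = (map_poly iota (map_poly (@FracField.tofrac _) w)).[eta].
  by rewrite /ev -map_poly_comp; congr (_.[eta]); apply: eq_map_poly.
by rewrite wE map_polyZ hornerZ (eqP qeta) mulr0.
Qed.

Section TwoPoints.
Variables (delta1 delta2 : option C).
Variables (E1 : puiseux_embedding iota delta1) (E2 : puiseux_embedding iota delta2).
Variables (y1 : pe_field E1) (y2 : pe_field E2) (f1 f2 : puiseux rat).
Hypotheses (y1E : pe_incl E1 y1 = eta) (y2E : pe_incl E2 y2 = eta).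
Hypotheses (f1E : pe_map E1 y1 = pmap C f1) (f2E : pe_map E2 y2 = pmap C f2).

Lemma algebraic_shift b : exists w : {poly {poly C}}, w != 0 /\ ev jC (xL - jC b) eta w = 0.
Proof.
have [w [w0 wE]] := algebraic_polynomial; exists (shift b w); split.
  by rewrite -size_poly_gt0 size_shift size_poly_gt0.
by rewrite ev_shift subrK.
Qed.

Let vanish b w := ev jC (xL - jC b) eta w = 0.

(** A relation over C yields a relation over Q supported by the same monomials, so
    that a minimal relation over Q is also minimal over C. *)
Lemma rational_lexmin delta (E : puiseux_embedding iota delta) (y : pe_field E)
    (f : puiseux rat) : pe_incl E y = eta -> pe_map E y = pmap C f ->
  exists P : {poly {poly rat}}, [/\ red2 C P != 0, vanish (center delta) (red2 C P) &
    forall w : {poly {poly C}}, w != 0 -> vanish (center delta) w -> lexle (red2 C P) w].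
Proof.
move=> yE fE; pose T : puiseux rat := pmono 1 (local_sign delta).
have c0 : center delta - center delta = ratr 0 by rewrite subrr rmorph0.
have T0 : pcst 0 + T = T by rewrite (rmorph0 (@pcst rat)) add0r.
have desc w : w != 0 -> vanish (center delta) w -> exists w' : {poly {poly rat}},
    [/\ w' != 0, pev T f w' = 0 & lexle w' w].
  move=> w0 /(embedding_ev yE); rewrite fE local_xE addrAC subrr add0r => wf.
  have wf' : pev (pmap C T) (pmap C f) w = 0 by rewrite pmap_mono ratr1.
  have [w' [w'0 w'f sup]] := rational_descent w0 wf'.
  by exists w'; split=> //; exact: lexle_support.
have [w1 [w10 w1f]] := algebraic_shift (center delta).
have [w2 [w20 w2f _]] := desc w1 w10 w1f.
have [|P [P0 Pf Pmin]] := @lexmin_exists rat (fun w => pev T f w = 0).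
  by exists w2.
exists P; split.
- by apply: contraNneq P0 => /cast_eq0 ->.
- by apply/(embedding_rational yE P fE c0); rewrite T0.
move=> w w0 wf; have [w' [w'0 w'f w'w]] := desc w w0 wf.
apply: lexle_trans (lexle_trans (Pmin w' w'0 w'f) w'w).
apply: lexle_support => j l; rewrite coef_red2.
by apply: contraNneq => ->; rewrite rmorph0.
Qed.

Lemma lexle_shift b (w : {poly {poly C}}) : lexle (shift b w) w /\ lexle w (shift b w).
Proof.
have E : size (lead_coef (shift b w)) = size (lead_coef w).
  by rewrite /lead_coef size_shift shift_coef size_shift1.
by split; split=> [|_]; rewrite ?size_shift ?E.
Qed.

Lemma constant_root (A : {poly C}) : A != 0 -> (map_poly jC A).[eta] = 0 ->
  exists z, eta = jC z.
Proof.
move=> A0; have [s ->] := closed_field_poly_normal A.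
rewrite map_polyZ rmorph_prod hornerZ horner_prod => /eqP.
rewrite mulf_eq0 fmorph_eq0 lead_coef_eq0 (negPf A0) /= prodf_seq_eq0.
case/hasP => z _ /=; rewrite map_polyXsubC hornerXsubC subr_eq0 => /eqP ->.
by exists z.
Qed.

(** The minimal polynomials of eta with rational coefficients in x - delta1 and in
    x - delta2 are both minimal over C, hence proportional after a translation by
    delta2 - delta1. Either they involve x and the translation is rational, or eta is
    a root of a polynomial with constant coefficients. *)
Lemma rational_or_constant :
  (exists r, center delta2 - center delta1 = ratr r) \/ (exists z, eta = jC z).
Proof.
have [P1 [P10 P1v P1min]] := rational_lexmin y1E f1E.
have [P2 [P20 P2v P2min]] := rational_lexmin y2E f2E.
set b := center delta2 - center delta1.
have jB u v : jC (u - v) = jC u - jC v := rmorphB _ u v.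
have Qv : vanish (center delta2) (shift b (red2 C P1)).
  rewrite /vanish ev_shift.
  have -> : xL - jC (center delta2) + jC b = xL - jC (center delta1).
    by rewrite /b jB addrA subrK.
  exact: P1v.
have Q0 : shift b (red2 C P1) != 0.
  by rewrite -size_poly_gt0 size_shift size_poly_gt0.
have Q2v : vanish (center delta1) (shift (- b) (red2 C P2)).
  rewrite /vanish ev_shift.
  have -> : xL - jC (center delta1) + jC (- b) = xL - jC (center delta2).
    by rewrite /b opprB jB addrA subrK.
  exact: P2v.
have Q20 : shift (- b) (red2 C P2) != 0.
  by rewrite -size_poly_gt0 size_shift size_poly_gt0.
have QP2 : lexle (shift b (red2 C P1)) (red2 C P2).
  apply: lexle_trans (lexle_shift b _).1 _.
  exact: lexle_trans (P1min _ Q20 Q2v) (lexle_shift _ _).1.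
have [al [be [al0 be0 albe]]] := lexmin_unique P20 Q0 P2v Qv P2min QP2.
have [[j jP]|nP] := pselect (exists j, (1 < size (P1`_j)%R)%N).
  left; apply: (rational_translation jP be0 al0).
  have := albe j; rewrite shift_coef /red2 !coef_map_id0 ?map_poly0 // => /esym.
  exact.
right; pose A := map_poly (fun c : {poly C} => c`_0) (red2 C P1).
have AE : red2 C P1 = map_poly polyC A.
  apply/polyP => j; rewrite [RHS]coef_map /A /= [in RHS]coef_map_id0 ?coef0 //.
  apply: size1_polyC; rewrite size_cast1 leqNgt.
  by apply/negP => jP; apply: nP; exists j.
apply: (@constant_root A); first by apply: contraNneq P10 => A0; rewrite AE A0 map_poly0.
have evA x : map_poly (evX jC x) (map_poly polyC A) = map_poly jC A.
  apply/polyP => j; rewrite [LHS]coef_map [in LHS]coef_map [RHS]coef_map.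
  exact: evX_C.
by have := P1v; rewrite /vanish AE /ev evA.
Qed.

Lemma constant_expansion delta (E : puiseux_embedding iota delta) (y : pe_field E)
    (f : puiseux rat) z : pe_incl E y = eta -> pe_map E y = pmap C f -> eta = jC z ->
  f = pcst (f 0) /\ z = ratr (f 0).
Proof.
move=> yE fE ez; have yz : y = pe_base E (tofrac z%:P).
  by apply: (fmorph_inj (pe_incl E)); rewrite yE pe_inclE ez.
have fz : pmap C f = pcst z by rewrite -fE yz pe_mapC.
have f0 : z = ratr (f 0) by rewrite -pmapE fz pmono_coef eqxx.
by split=> //; apply: (@pmap_inj C); rewrite fz pmap_mono f0.
Qed.

(** If the centers differ by a rational number, eta satisfies the same rational
    relations at both points. If eta is constant, so are both expansions, and any
    two transcendental coordinates satisfy the same relations with them. *)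
Lemma gauss_property_transfer d1 d2 : (0 < d1)%N -> (0 < d2)%N ->
  ongrid d1 f1 -> ongrid d2 f2 ->
  gauss_property (fun n => (pmono 1 (local_sign delta1) * f1) (n%:~R / d1%:R)) ->
  gauss_property (fun n => (pmono 1 (local_sign delta2) * f2) (n%:~R / d2%:R)).
Proof.
move=> d10 d20 f1d f2d.
have gt c1 c2 := @gauss_transfer _ _ c1 c2 _ _ _ _
  (local_signP delta1) (local_signP delta2) d10 d20 f1d f2d.
have [[r rE]|[z zE]] := rational_or_constant.
  have c0 : center delta1 - center delta1 = ratr 0 by rewrite subrr rmorph0.
  apply: (gt 0 r) => [|w].
    have [P [P0 Pv _]] := rational_lexmin y1E f1E; exists P; split.
      by apply: contraNneq P0 => ->; rewrite /red2 map_poly0.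
    exact/(embedding_rational y1E P f1E c0).
  apply: iff_trans (embedding_rational y2E w f2E rE).
  exact: iff_sym (embedding_rational y1E w f1E c0).
have [f1c z1] := constant_expansion y1E f1E zE.
have [f2c z2] := constant_expansion y2E f2E zE.
have f12 : f1 0 = f2 0 by apply: (fmorph_inj (@ratr C)); exact: etrans (esym z1) z2.
have evc (e : rat) (w : {poly {poly rat}}) : e = 1 \/ e = -1 ->
    pev (pcst 0 + pmono 1 e) (pcst (f1 0)) w = 0 <-> w.[(f1 0)%:P] = 0.
  move=> eP; set x := pcst 0 + _.
  have -> : pev x (pcst (f1 0)) w = evX (@pcst rat) x w.[(f1 0)%:P].
    by rewrite /ev -[pcst (f1 0)](evX_C _ x) horner_map.
  split=> [H|->]; last exact: rmorph0.
  apply/eqP; apply: contraT => w0.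
  by have := evX_transcendental (sign_neq0 eP) 0 w0; rewrite H eqxx.
apply: (gt 0 0) => [|w].
  exists ('X - (f1 0)%:P%:P); rewrite polyXsubC_eq0; split=> //.
  by rewrite f1c; apply/evc; [exact: local_signP|rewrite hornerXsubC -f1c subrr].
rewrite f1c f2c -f12; apply: iff_trans (iff_sym (evc _ w (local_signP _))).
by have := evc _ w (local_signP delta1).
Qed.

End TwoPoints.
End Points.

Section Expansions.
Variables (C : numClosedFieldType) (L : fieldType).
Variable iota : {rmorphism {fraction {poly C}} -> L}.

Lemma rational_series (F : puiseux C) d (p : int -> C) : (0 < d)%N ->
  is_series F d p -> rational_seq p ->
  exists f : puiseux rat, F = pmap C f /\ ongrid d f.
Proof.
move=> d0 [Fp Fd] prat.
have Fr q : exists r : rat, F q = ratr r.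
  have [Fq|/Fd[n ->]] := eqVneq (F q) 0; first by exists 0; rewrite Fq rmorph0.
  by rewrite Fp.
pose f0 q := projT1 (cid (Fr q)).
have f0E q : F q = ratr (f0 q) by rewrite /f0; case: cid.
have f0N q : f0 q != 0 -> F q != 0.
  by rewrite f0E fmorph_eq0.
have fS : puiseux_supp f0.
  have [d' [r [d'0 H]]] := puiseuxP F; exists d', r; split=> // q /f0N; exact: H.
exists (mkPuiseux fS); split; last by move=> q /f0N /Fd.
by apply: puiseux_ext => q; rewrite f0E.
Qed.

Lemma eta_atE delta eta :
  eta_at iota delta eta = iota (tofrac ('X - (center delta)%:P)) * eta.
Proof. by case: delta => [c|] //=; rewrite polyC0 subr0. Qed.

Lemma has_gaussE delta (E : puiseux_embedding iota delta) eta (y : pe_field E)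
    (f : puiseux rat) d : (0 < d)%N -> pe_incl E y = eta -> pe_map E y = pmap C f ->
  ongrid d f ->
  has_gauss_property E d (eta_at iota delta eta) <->
  gauss_property (fun n => (pmono 1 (local_sign delta) * f) (n%:~R / d%:R)).
Proof.
move=> d0 yE yf fd; set g := pmono 1 _ * f.
pose T : pe_field E := pe_base E (tofrac ('X - (center delta)%:P)).
have Ty : pe_incl E (T * y) = eta_at iota delta eta.
  by rewrite rmorphM eta_atE yE; congr (_ * _); exact: pe_inclE.
have gE : pe_map E (T * y) = pmap C g.
  rewrite rmorphM yf (pmapM (char0_unit C)); [|exact: pintegral1|exact: pintegral1].
  congr (_ * _); rewrite pmap_mono ratr1 /T !rmorphB /= pe_mapX pe_mapC local_xE.
  by rewrite addrAC subrr add0r.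
have gd : ongrid d g.
  apply: ongridM => //; case: (local_signP delta) => ->.
    exact: (@ongrid_mono _ d 1 1).
  exact: (@ongrid_mono _ d 1 (-1)).
split=> [[a [_ [y' y'E [ya _]]] aG]|gG].
  suff -> : (fun n : int => g (n%:~R / d%:R)) = a by [].
  have y'T : y' = T * y by apply: (fmorph_inj (pe_incl E)); rewrite y'E Ty.
  apply/funext => n; apply: (fmorph_inj (@ratr C)).
  by have := ya n; rewrite y'T gE.
exists (fun n : int => g (n%:~R / d%:R)) => //; split=> //.
exists (T * y) => //; split=> [n|q]; first by rewrite gE.
rewrite gE => gq; apply: gd; apply: contraNneq gq => gq.
by rewrite pmapE gq rmorph0.
Qed.

End Expansions.

Theorem corollary2 (R : realType) (L : closedFieldType)
    (iota : {rmorphism {fraction {poly R[i]}} -> L})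
    (algL : forall y : L, algebraicOver iota y)
    (eta : L) (delta1 delta2 : option R[i])
    (E1 : puiseux_embedding iota delta1) (E2 : puiseux_embedding iota delta2)
    (d1 d2 : nat) (p1 p2 : int -> R[i])
    (exp1 : puiseux_expansion E1 eta d1 p1) (rat1 : rational_seq p1)
    (exp2 : puiseux_expansion E2 eta d2 p2) (rat2 : rational_seq p2) :
  has_gauss_property E1 d1 (eta_at iota delta1 eta) <->
  has_gauss_property E2 d2 (eta_at iota delta2 eta).
Proof.
case: exp1 => d10 [y1 y1E s1]; case: exp2 => d20 [y2 y2E s2].
have [f1 [f1E f1d]] := rational_series d10 s1 rat1.
have [f2 [f2E f2d]] := rational_series d20 s2 rat2.
rewrite (has_gaussE d10 y1E f1E f1d) (has_gaussE d20 y2E f2E f2d).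
split; first exact: (gauss_property_transfer (algL eta) y1E y2E f1E f2E d10 d20 f1d f2d).
exact: (gauss_property_transfer (algL eta) y2E y1E f2E f1E d20 d10 f2d f1d).
Qed.
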